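(* For each $\varepsilon\in(0,1)$ there is $c_\varepsilon>0$ such that for every network $G(V)$ with total conductance $\mathcal C$, $$t^*_{\mathrm{bl}}(G,\varepsilon)\ge c_\varepsilon\,\mathcal C\Big(\mathbb E\sup_{x\in V}\eta_x\Big)^2,$$ where $\{\eta_x\}$ is the Gaussian free field on $G$.
   Context: A network is a finite connected graph $G=(V,E)$ with symmetric conductances $c_{xy}\ge0$, $c_{xy}>0$ iff $xy\in E$; $c_x=\sum_yc_{xy}$, $\mathcal C=\sum_xc_x$. The continuous-time random walk $\{X_t\}$ jumps with probabilities $c_{xy}/c_x$ after i.i.d. Exp(1) holding times; local time $L^v_t=\frac1{c_v}\int_0^t\mathbf 1_{\{X_s=v\}}ds$. Define $t^*_{\mathrm{bl}}(G,\varepsilon)=\max_{w\in V}\inf\{s:\ \mathbb P_w(\forall u,v\in V:\ L^u_t\le 2L^v_t)>\varepsilon\text{ for all }t\ge s\}$. Gaussian free field: for fixed $v_0\in V$, the centered Gaussian process $\{\eta_x\}$ with $\eta_{v_0}=0$ and $\mathbb E(\eta_x-\eta_y)^2=R_{\mathrm{eff}}(x,y)$, $R_{\mathrm{eff}}$ the effective resistance. *)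

(* Defs.v *)
From HB Require Import structures.
From mathcomp Require Import all_boot all_order all_algebra.
From mathcomp Require Import all_classical all_reals all_analysis.
Set Implicit Arguments. Unset Strict Implicit. Unset Printing Implicit Defensive.
Import Order.TTheory GRing.Theory Num.Theory.
Local Open Scope classical_set_scope.
Local Open Scope ring_scope.

Section Network.
Context {R : realType} {V : finType}.

Definition network (c : V -> V -> R) : Prop :=
  [/\ (forall x y, c x y = c y x),
      (forall x y, 0 <= c x y),
      (forall x, c x x = 0) &
      (forall x y, connect [rel a b | 0 < c a b] x y)].

Definition cv (c : V -> V -> R) (x : V) : R := \sum_(y : V) c x y.

Definition total_cond (c : V -> V -> R) : R := \sum_(x : V) cv c x.

Definition energy (c : V -> V -> R) (f : V -> R) : R :=
  2^-1 * \sum_(x : V) \sum_(y : V) c x y * (f x - f y) ^+ 2.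

(** Effective resistance, via the Dirichlet principle:
    R_eff(x,y)^-1 = inf { energy f : f x = 1, f y = 0 }  (x <> y),
    R_eff(x,x) = 0. *)
Definition Reff (c : V -> V -> R) (x y : V) : R :=
  if x == y then 0 else
  (inf [set e | exists f : V -> R, [/\ f x = 1, f y = 0 & e = energy c f]])^-1.

End Network.

Section RandomWalk.
Context {R : realType} {V : finType} {d : measure_display} {T : measurableType d}.

(** The continuous-time random walk started at w is given by its jump chain
    J n (the n-th visited vertex) and its holding times S n (time spent at
    J n); [is_crw c w P J S] says that (J, S) has the law of the walk:
    J is a Markov chain from w with transitions c_xy/c_x, and the S n are
    i.i.d. Exp(1), independent of J.  This is specified through the joint law
    of (J_0..J_n, S_0..S_n), which determines the law of the whole process. *)
Definition is_crw (c : V -> V -> R) (w : V) (P : probability T R)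
    (J : nat -> T -> V) (S : nat -> T -> R) : Prop :=
  [/\ (forall n v, measurable [set t | J n t = v]),
      (forall n, measurable_fun setT (S n)) &
      (forall (n : nat) (x : nat -> V) (s : nat -> R),
        P [set t | forall i, (i <= n)%N -> J i t = x i /\ s i < S i t] =
        ((x 0%N == w)%:R
          * (\prod_(i < n) (c (x i) (x i.+1) / cv c (x i)))
          * (\prod_(i < n.+1) expR (- Num.max (s i) 0)))%:E)].

Definition jump_time (S : nat -> T -> R) (n : nat) (t : T) : R :=
  \sum_(k < n) S k t.

Definition occupation (J : nat -> T -> V) (S : nat -> T -> R) (v : V)
    (time : R) (t : T) : \bar R :=
  (\sum_(0 <= n <oo)
     ((J n t == v)%:R *
      Num.max 0 (Num.min time (jump_time S n.+1 t)
                 - Num.min time (jump_time S n t)))%:E)%E.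

Definition local_time (c : V -> V -> R) (J : nat -> T -> V)
    (S : nat -> T -> R) (v : V) (time : R) (t : T) : \bar R :=
  (occupation J S v time t * ((cv c v)^-1)%:E)%E.

Definition blanket_event (c : V -> V -> R) (J : nat -> T -> V)
    (S : nat -> T -> R) (time : R) : set T :=
  [set t | forall u v : V,
     (local_time c J S u time t <= 2%:E * local_time c J S v time t)%E].

Definition blanket_time_from (c : V -> V -> R) (eps : R) (P : probability T R)
    (J : nat -> T -> V) (S : nat -> T -> R) : \bar R :=
  ereal_inf [set s%:E | s in
     [set s : R | 0 <= s /\
        forall time : R, s <= time -> (eps%:E < P (blanket_event c J S time))%E]].

Definition blanket_time (c : V -> V -> R) (eps : R) (P : probability T R)
    (J : V -> nat -> T -> V) (S : V -> nat -> T -> R) : \bar R :=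
  ereal_sup (range (fun w : V => blanket_time_from c eps P (J w) (S w))).

End RandomWalk.

Section GFF.
Context {R : realType} {V : finType} {d : measure_display} {T : measurableType d}.

Definition centered_normal (P : probability T R) (Y : T -> R) (s2 : R) : Prop :=
  if s2 == 0 then P [set t | Y t != 0] = 0%E
  else forall A : set R, measurable A ->
         P (Y @^-1` A) = normal_prob 0 (Num.sqrt s2) A.

Definition is_GFF (c : V -> V -> R) (v0 : V) (P : probability T R)
    (eta : V -> T -> R) : Prop :=
  [/\ (forall v, measurable_fun setT (eta v)),
      (forall t, eta v0 t = 0),
      (forall a : V -> R, exists2 s2 : R, 0 <= s2 &
          centered_normal P (fun t => \sum_(v : V) a v * eta v t) s2) &
      (forall x y : V,
          (\int[P]_t ((eta x t - eta y t) ^+ 2)%:E)%E = (Reff c x y)%:E)].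

Definition expected_sup (P : probability T R) (v0 : V) (eta : V -> T -> R)
    : \bar R :=
  (\int[P]_t (\big[Num.max/eta v0 t]_(v : V) eta v t)%:E)%E.

End GFF.

(* Main.v *)
Require Import Defs.
From HB Require Import structures.
From mathcomp Require Import all_boot all_order all_algebra.
From mathcomp Require Import all_classical all_reals all_analysis.
From mathcomp Require Import measurable_realfun.
From mathcomp Require Import ring lra.
Import Order.TTheory GRing.Theory Num.Theory.
Import numFieldNormedType.Exports.
Set Implicit Arguments. Unset Strict Implicit. Unset Printing Implicit Defensive.
Local Open Scope classical_set_scope.
Local Open Scope ring_scope.
(** Run the walk from [v0] up to the time its local time at [v0] reaches an
    independent Exp([q]) variable.  A Feynman-Kac martingale gives the Laplace
    transform of the local times then collected, and a rank-one Gaussian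
    computation gives the one of the field, so that
    [L^x + eta_x^2 / 2] and [(eta_x + sqrt (2 t'))^2 / 2], with [t'] of law
    Exp([q]), have the same joint law on [V].

    Suppose the blanket event has probability [> eps] at time [T0 = 2 C t0], where
    [C] is the total conductance.  On that event all local times lie in
    [[t0, 4 t0]].  Let [m] be the expected maximum of the field.  If all variances
    are much smaller than [m^2], then [max eta] and [max (- eta)] are within [u m] of
    [m] with high probability; for [t0 = u m^2] and [q = 1 / t0], the left side of the
    identity is at most [4 t0 + ((1 + u) m)^2 / 2] everywhere with probability of order
    [eps], whereas the maximum of the right side exceeds this level as soon as [t']
    exceeds a multiple of [u^2 m^2]: a contradiction.  If some variance
    [R_eff (v0, x)] is not small, the local time at [x] is too likely to vanish.

    Concentration of the maximum comes from rotating two independent copies of the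
    field; only characteristic functions are used, and laws of maxima are recovered
    from polynomials in Gaussian bumps. *)

Section Expectation.
Context {R : realType}.

Definition Ex d (T : measurableType d) (P : probability T R) (f : T -> R) : R :=
  \int[P]_t f t.

Definition L1 d (T : measurableType d) (P : probability T R) (f : T -> R) :=
  P.-integrable setT (EFin \o f).

Definition bmeas d (T : measurableType d) (f : T -> R) :=
  measurable_fun setT f /\ exists M : R, forall x, `|f x| <= M.

Section OneSpace.
Context d (T : measurableType d) (P : probability T R).
Implicit Types f g : T -> R.

Lemma L1_measurable f : L1 P f -> measurable_fun setT f.
Proof. by move=> /integrableP[/measurable_EFinP]. Qed.

Lemma bmeas_L1 f : bmeas f -> L1 P f.
Proof.
move=> [mf [M hM]]; apply: measurable_bounded_integrable => //.
  by apply: (le_lt_trans (probability_le1 P measurableT)); rewrite ltry.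
exists M; split; first exact: num_real.
by move=> x Mx y _; exact: (le_trans (hM y) (ltW Mx)).
Qed.

Lemma Ex_EFin f : L1 P f -> (\int[P]_t (f t)%:E)%E = (Ex P f)%:E.
Proof. by move=> Lf; rewrite /Ex /Rintegral fineK// integrable_fin_num. Qed.

Lemma L1D f g : L1 P f -> L1 P g -> L1 P (fun t => f t + g t).
Proof.
move=> Lf Lg; rewrite /L1.
by apply: eq_integrable (integrableD measurableT Lf Lg).
Qed.

Lemma L1Z k f : L1 P f -> L1 P (fun t => k * f t).
Proof.
move=> Lf; rewrite /L1.
by apply: eq_integrable (integrableZl measurableT k Lf).
Qed.

Lemma L1B f g : L1 P f -> L1 P g -> L1 P (fun t => f t - g t).
Proof.
move=> Lf Lg.
by rewrite /L1; apply: eq_integrable (integrableB measurableT Lf Lg).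
Qed.

Lemma L1_cst k : L1 P (fun=> k).
Proof. by apply: bmeas_L1; split => //; exists `|k|. Qed.

Lemma L1_norm f : L1 P f -> L1 P (fun t => `|f t|).
Proof. exact: integrable_norm. Qed.

Lemma L1_le f g : measurable_fun setT f -> L1 P g ->
  (forall t, `|f t| <= g t) -> L1 P f.
Proof.
move=> mf Lg fg; apply: (le_integrable measurableT _ _ Lg).
  exact/measurable_EFinP.
by move=> t _ /=; rewrite lee_fin (le_trans (fg t))// ler_norm.
Qed.

Lemma ExD f g : L1 P f -> L1 P g ->
  Ex P (fun t => f t + g t) = Ex P f + Ex P g.
Proof. by move=> *; rewrite /Ex RintegralD. Qed.

Lemma ExB f g : L1 P f -> L1 P g ->
  Ex P (fun t => f t - g t) = Ex P f - Ex P g.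
Proof. by move=> *; rewrite /Ex RintegralB. Qed.

Lemma ExZ k f : L1 P f -> Ex P (fun t => k * f t) = k * Ex P f.
Proof. by move=> *; rewrite /Ex RintegralZl. Qed.

Lemma Ex_cst k : Ex P (fun=> k) = k.
Proof.
rewrite /Ex Rintegral_cst//.
transitivity (k * fine (1%E : \bar R)); last by rewrite mulr1.
by congr (_ * fine _); exact: probability_setT.
Qed.

Lemma Ex_ext f g : f =1 g -> Ex P f = Ex P g.
Proof. by move=> /funext ->. Qed.

Lemma Ex_le f g : L1 P f -> L1 P g -> (forall t, f t <= g t) -> Ex P f <= Ex P g.
Proof. by move=> Lf Lg fg; apply: le_Rintegral. Qed.

Lemma Ex_ge0 f : (forall t, 0 <= f t) -> 0 <= Ex P f.
Proof. by move=> f0; apply: Rintegral_ge0. Qed.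

Lemma L1_sum (I : Type) (s : seq I) (F : I -> T -> R) :
  (forall i, L1 P (F i)) -> L1 P (fun t => \sum_(i <- s) F i t).
Proof.
move=> LF; elim: s => [|i s IH].
  by under eq_fun do rewrite big_nil; exact: L1_cst.
by under eq_fun do rewrite big_cons; exact: L1D.
Qed.

Lemma Ex_sum (I : Type) (s : seq I) (F : I -> T -> R) :
  (forall i, L1 P (F i)) ->
  Ex P (fun t => \sum_(i <- s) F i t) = \sum_(i <- s) Ex P (F i).
Proof.
move=> LF; elim: s => [|i s IH].
  by under eq_fun do rewrite big_nil; rewrite Ex_cst big_nil.
by under eq_fun do rewrite big_cons; rewrite big_cons -IH ExD//; exact: L1_sum.
Qed.

Lemma Ex_norm f : L1 P f -> `|Ex P f| <= Ex P (fun t => `|f t|).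
Proof. by move=> Lf; exact: le_normr_Rintegral. Qed.

Lemma Ex_indic (A : set T) : measurable A -> Ex P \1_A = fine (P A).
Proof. by move=> mA; rewrite /Ex /Rintegral integral_indic// setIT. Qed.

Lemma bmeas_indic (A : set T) : measurable A -> bmeas (\1_A : T -> R).
Proof.
move=> mA; split; first exact: measurable_indic.
by exists 1 => x; rewrite indicE; case: (_ \in _); rewrite ?normr1 ?normr0.
Qed.

Lemma bmeasM f g : bmeas f -> bmeas g -> bmeas (fun t => f t * g t).
Proof.
move=> [mf [M hM]] [mg [N hN]]; split; first exact: measurable_funM.
by exists (M * N) => x; rewrite normrM ler_pM.
Qed.

Lemma bmeasD f g : bmeas f -> bmeas g -> bmeas (fun t => f t + g t).
Proof.
move=> [mf [M hM]] [mg [N hN]]; split; first exact: measurable_funD.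
by exists (M + N) => x; rewrite (le_trans (ler_normD _ _))// lerD.
Qed.

Lemma bmeas_cst k : bmeas (fun _ : T => k).
Proof. by split => //; exists `|k|. Qed.

Lemma bmeasN f : bmeas f -> bmeas (fun t => - f t).
Proof.
by move=> [mf [M hM]]; split; [exact: measurableT_comp|exists M => x; rewrite normrN].
Qed.

Lemma bmeas_prod (I : Type) (s : seq I) (F : I -> T -> R) :
  (forall i, bmeas (F i)) -> bmeas (fun t => \prod_(i <- s) F i t).
Proof.
move=> LF; elim: s => [|i s IH].
  by under eq_fun do rewrite big_nil; exact: bmeas_cst.
by under eq_fun do rewrite big_cons; exact: bmeasM.
Qed.

Lemma bmeas_sum (I : Type) (s : seq I) (F : I -> T -> R) :
  (forall i, bmeas (F i)) -> bmeas (fun t => \sum_(i <- s) F i t).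
Proof.
move=> LF; elim: s => [|i s IH].
  by under eq_fun do rewrite big_nil; exact: bmeas_cst.
by under eq_fun do rewrite big_cons; exact: bmeasD.
Qed.

Lemma bmeasX f n : bmeas f -> bmeas (fun t => f t ^+ n).
Proof.
move=> bf; elim: n => [|n IH].
  by under eq_fun do rewrite expr0; exact: bmeas_cst.
by under eq_fun do rewrite exprS; exact: bmeasM.
Qed.

Lemma bmeas_cos f : measurable_fun setT f -> bmeas (fun t => cos (f t)).
Proof.
move=> mf; split.
  apply: (measurableT_comp _ mf).
  exact: continuous_measurable_fun (@continuous_cos R).
by exists 1 => x; rewrite ler_norml cos_geN1 cos_le1.
Qed.

Lemma bmeas_expN f : measurable_fun setT f -> (forall t, 0 <= f t) ->
  bmeas (fun t => expR (- f t)).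
Proof.
move=> mf f0; split.
  by apply: (measurableT_comp (f := expR)) => //; exact: measurableT_comp.
by exists 1 => x; rewrite ger0_norm ?expR_ge0// expR_le1 oppr_le0.
Qed.

Lemma measurable_ge_set f (a : R) : measurable_fun setT f ->
  measurable [set t | a <= f t].
Proof.
move=> mf; have := mf measurableT _ (measurable_itv `[a, +oo[).
by rewrite setTI preimage_itvcy.
Qed.

Lemma measurable_gt_set f (a : R) : measurable_fun setT f ->
  measurable [set t | a < f t].
Proof.
move=> mf; have := mf measurableT _ (measurable_itv `]a, +oo[).
by rewrite setTI preimage_itvoy.
Qed.

Lemma measurable_le_set f (a : R) : measurable_fun setT f ->
  measurable [set t | f t <= a].
Proof.
move=> mf; have := mf measurableT _ (measurable_itv `]-oo, a]).
by rewrite setTI preimage_itvNyc.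
Qed.

Lemma Markov f (a : R) : L1 P f -> (forall t, 0 <= f t) -> 0 < a ->
  fine (P [set t | a <= f t]) <= Ex P f / a.
Proof.
move=> Lf f0 a0.
have mA : measurable [set t | a <= f t].
  exact/measurable_ge_set/L1_measurable/Lf.
rewrite -Ex_indic// mulrC -ExZ//; apply: Ex_le.
- exact/bmeas_L1/bmeas_indic.
- exact: L1Z.
move=> t; rewrite indicE mulrC; case: (boolP (t \in _)) => [/set_mem/= h|_].
  by rewrite ler_pdivlMr// mul1r.
by rewrite divr_ge0// ltW.
Qed.

End OneSpace.

Section TwoSpaces.
Context d1 d2 (T1 : measurableType d1) (T2 : measurableType d2).
Context (P1 : probability T1 R) (P2 : probability T2 R).

Lemma bmeas_prod_L1 (f : T1 * T2 -> R) : bmeas f ->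
  (P1 \x P2)%E.-integrable setT (EFin \o f).
Proof.
move=> [mf [M hM]]; apply: measurable_bounded_integrable => //.
  suff h : ((P1 \x P2)%E setT = 1)%E by apply: (@le_lt_trans _ _ 1%E); rewrite ?ltry// -h.
  rewrite -setXTT product_measure1E//.
  transitivity (1 * 1 : \bar R)%E; last by rewrite mule1.
  by congr (_ * _)%E; exact: probability_setT.
exists M; split; first exact: num_real.
by move=> x Mx y _; exact: (le_trans (hM y) (ltW Mx)).
Qed.

Lemma bmeas_pair1 (f : T1 * T2 -> R) x : bmeas f -> bmeas (fun y => f (x, y)).
Proof.
move=> [mf [M hM]]; split; last by exists M.
exact: measurableT_comp mf (pair1_measurable x).
Qed.

Lemma bmeas_pair2 (f : T1 * T2 -> R) y : bmeas f -> bmeas (fun x => f (x, y)).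
Proof.
move=> [mf [M hM]]; split; last by exists M.
exact: measurableT_comp mf (pair2_measurable y).
Qed.

End TwoSpaces.

Lemma Ex_bound d (T : measurableType d) (P : probability T R) (f : T -> R) M :
  measurable_fun setT f -> (forall x, `|f x| <= M) -> `|Ex P f| <= M.
Proof.
move=> mf hM; have Lf : L1 P f by apply: bmeas_L1; split => //; exists M.
rewrite (le_trans (Ex_norm Lf))// -[leRHS](Ex_cst P).
by apply: Ex_le => //; [exact: L1_norm|exact: L1_cst].
Qed.

Section Fubini.
Context d1 d2 (T1 : measurableType d1) (T2 : measurableType d2).
Context (P1 : probability T1 R) (P2 : probability T2 R).

Lemma bmeas_Ex1 (f : T1 * T2 -> R) : bmeas f ->
  bmeas (fun x => Ex P2 (fun y => f (x, y))).
Proof.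
move=> bf; split; last first.
  have [mf [M hM]] := bf; exists M => x; apply: Ex_bound => //.
  by have [] := bmeas_pair1 x bf.
apply/measurable_EFinP.
have /= := measurable_fubini_F (bmeas_prod_L1 P1 P2 bf).
apply: eq_measurable_fun => x _ /=.
by rewrite /fubini_F -Ex_EFin//; exact/bmeas_L1/bmeas_pair1.
Qed.

Lemma bmeas_Ex2 (f : T1 * T2 -> R) : bmeas f ->
  bmeas (fun y => Ex P1 (fun x => f (x, y))).
Proof.
move=> bf; split; last first.
  have [mf [M hM]] := bf; exists M => x; apply: Ex_bound => //.
  by have [] := bmeas_pair2 x bf.
apply/measurable_EFinP.
have /= := measurable_fubini_G (bmeas_prod_L1 P1 P2 bf).
apply: eq_measurable_fun => x _ /=.
by rewrite /fubini_G -Ex_EFin//; exact/bmeas_L1/bmeas_pair2.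
Qed.

Lemma Ex_swap (f : T1 * T2 -> R) : bmeas f ->
  Ex P1 (fun x => Ex P2 (fun y => f (x, y))) =
  Ex P2 (fun y => Ex P1 (fun x => f (x, y))).
Proof.
move=> bf; apply: EFin_inj.
rewrite -!Ex_EFin; [|exact/bmeas_L1/bmeas_Ex2|exact/bmeas_L1/bmeas_Ex1].
under eq_integral.
  move=> x _; rewrite -Ex_EFin; last exact/bmeas_L1/bmeas_pair1.
  over.
under [RHS]eq_integral.
  move=> x _; rewrite -Ex_EFin; last exact/bmeas_L1/bmeas_pair2.
  over.
exact: (Fubini (bmeas_prod_L1 P1 P2 bf)).
Qed.

End Fubini.

Definition prodP d1 d2 (T1 : measurableType d1) (T2 : measurableType d2)
  (P1 : probability T1 R) (P2 : probability T2 R) : probability (T1 * T2)%type R :=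
  (P1 \x P2)%E.
End Expectation.

Section Gaussian.
Context {R : realType}.
Notation mu := (@lebesgue_measure R).

Lemma ge0_integral_density (P : probability (measurableTypeR R) R) (g : R -> R) :
  measurable_fun setT g -> (forall x, 0 <= g x) ->
  (forall A, measurable A -> P A = (\int[mu]_(x in A) (g x)%:E)%E) ->
  forall f : R -> \bar R, (forall x, 0 <= f x)%E -> measurable_fun setT f ->
  (\int[P]_x f x = \int[mu]_x (f x * (g x)%:E))%E.
Proof.
move=> mg g0 Pg f f0 mf.
have Pmu : P `<< mu.
  apply/null_content_dominatesP => A mA muA0; rewrite Pg//.
  apply: null_set_integral => //.
  by apply/measurable_EFinP; exact: measurable_funTS.
rewrite -(@Radon_Nikodym_SigmaFinite.change_of_variables _ _ _ P mu Pmu)//.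
apply: ge0_ae_eq_integral => //.
- apply: emeasurable_funM => //.
  exact: (measurable_int mu (Radon_Nikodym_SigmaFinite.f_integrable Pmu)).
- by apply: emeasurable_funM => //; exact/measurable_EFinP.
- by move=> x _; rewrite mule_ge0// Radon_Nikodym_SigmaFinite.f_ge0.
- by move=> x _; rewrite mule_ge0// lee_fin.
- apply: ae_eqe_mul2l.
  apply: integral_ae_eq => //.
  + exact: Radon_Nikodym_SigmaFinite.f_integrable.
  + exact/measurable_EFinP.
  + by move=> E _ mE; rewrite -(Pg _ mE) (@Radon_Nikodym_SigmaFinite.f_integral _ _ _ P mu Pmu).
Qed.

Lemma Ex_density (P : probability (measurableTypeR R) R) (g : R -> R) :
  measurable_fun setT g -> (forall x, 0 <= g x) ->
  (forall A, measurable A -> P A = (\int[mu]_(x in A) (g x)%:E)%E) ->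
  forall f : R -> R, bmeas f ->
  mu.-integrable setT (EFin \o (fun x => f x * g x)) /\
  Ex P f = \int[mu]_x (f x * g x).
Proof.
move=> mg g0 Pg f [mf [M hM]].
have ig : mu.-integrable setT (EFin \o g).
  apply/integrableP; split; first exact/measurable_EFinP.
  under eq_integral do rewrite /= ger0_norm//.
  rewrite -Pg//; apply: (le_lt_trans (probability_le1 P measurableT)).
  by rewrite ltry.
have ifg : mu.-integrable setT (EFin \o (fun x => f x * g x)).
  apply: (le_integrable measurableT _ _ (integrableZl measurableT M ig)) => //.
    by apply/measurable_EFinP; exact: measurable_funM.
  move=> x _ /=; rewrite lee_fin normrM (ger0_norm (g0 x)).
  by rewrite (le_trans _ (ler_norm _))// ler_wpM2r.
split => //.
have Lf : L1 P f by apply: bmeas_L1; split => //; exists M.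
have <- : Ex P (fun x => f x + M) - M = Ex P f.
  by rewrite ExD ?Ex_cst ?addrK//; exact: L1_cst.
have M0 x : 0 <= f x + M.
  by have := hM x; rewrite ler_norml => /andP[h _]; rewrite -lerBlDr sub0r.
have e : (\int[P]_x (f x + M)%:E)%E = (\int[mu]_x ((f x + M)%:E * (g x)%:E))%E.
  apply: (ge0_integral_density mg g0 Pg); first by move=> x; rewrite lee_fin.
  by apply/measurable_EFinP; exact: measurable_funD.
rewrite {1}/Ex {1}/Rintegral e.
under eq_integral do rewrite -EFinM mulrDl.
rewrite -/(Rintegral _ _ _) RintegralD//; last exact: (integrableZl measurableT M ig).
rewrite RintegralZl//.
have -> : \int[mu]_x g x = 1.
  by rewrite /Rintegral -Pg//; transitivity (fine (1%E : \bar R)) => //;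
    congr fine; exact: probability_setT.
by rewrite mulr1 addrK.
Qed.

Section ibp.
Variables (m s : R).
Hypothesis s0 : 0 < s.
Let w := normal_pdf m s.

Let wE x : w x = normal_peak s * expR (- (x - m) ^+ 2 / (s ^+ 2 *+ 2)).
Proof. by rewrite /w normal_pdfE// gt_eqF. Qed.

Let s2 : 0 < s ^+ 2. Proof. by rewrite exprn_gt0. Qed.

Lemma normal_pdf_tail : exists2 K, 0 <= K & forall x,
  (1 + (x - m) ^+ 2) * w x <= K * normal_pdf m (2 * s) x.
Proof.
exists (normal_peak s * (1 + 8 * s ^+ 2) / normal_peak (2 * s)).
  by rewrite mulr_ge0 ?invr_ge0 ?mulr_ge0 ?normal_peak_ge0// addr_ge0// mulr_ge0// ltW.
move=> x; rewrite wE normal_pdfE; last by rewrite mulf_neq0 ?gt_eqF.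
rewrite /normal_fun [leRHS]mulrA divfK; last first.
  by rewrite gt_eqF// normal_peak_gt0// mulf_neq0 ?gt_eqF.
rewrite mulrCA -!mulrA ler_wpM2l ?normal_peak_ge0//.
set u := (x - m) ^+ 2 / (8 * s ^+ 2).
have u0 : 0 <= u by rewrite divr_ge0 ?sqr_ge0// mulr_ge0// ltW.
have -> : - (x - m) ^+ 2 / (s ^+ 2 *+ 2) = - u - 3 * u.
  by rewrite /u; field; rewrite gt_eqF.
have -> : - (x - m) ^+ 2 / ((2 * s) ^+ 2 *+ 2) = - u.
  by rewrite /u; field; rewrite gt_eqF.
have -> : (x - m) ^+ 2 = 8 * s ^+ 2 * u.
  by rewrite /u; field; rewrite gt_eqF.
rewrite expRD mulrCA mulrC; apply: ler_wpM2r; first exact: expR_ge0.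
rewrite expRN ler_pdivrMr ?expR_gt0//.
have h := expR_ge1Dx (3 * u).
have h2 : 1 + u <= expR (3 * u) by lra.
apply: (@le_trans _ _ ((1 + 8 * s ^+ 2) * (1 + u))); last first.
  by rewrite ler_wpM2l// addr_ge0// mulr_ge0// ltW.
by nra.
Qed.

Lemma integrable_normal_poly (f : R -> R) (C : R) :
  measurable_fun setT f -> (forall x, `|f x| <= C * ((1 + (x - m) ^+ 2) * w x)) ->
  mu.-integrable setT (EFin \o f).
Proof.
move=> mf hf; have [K K0 hK] := normal_pdf_tail.
have i2 := integrable_normal_pdf m (2 * s).
have C0 : 0 <= C.
  have := le_trans (normr_ge0 _) (hf m); rewrite pmulr_lge0//.
  by rewrite subrr expr0n addr0 mul1r wE mulr_gt0 ?expR_gt0// normal_peak_gt0// gt_eqF.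
apply: (le_integrable measurableT _ _ (integrableZl measurableT (C * K) i2)) => //.
  exact/measurable_EFinP.
move=> x _ /=; rewrite lee_fin (le_trans (hf x))// (le_trans _ (ler_norm _))//.
by rewrite -mulrA ler_wpM2l.
Qed.

Lemma normal_pdf_to0 (F : R -> R) (C : R) :
  (forall x, `|F x| <= C * ((1 + (x - m) ^+ 2) * w x)) ->
  (F (m + n%:R) @[n --> \oo] --> 0) /\ (F (m - n%:R) @[n --> \oo] --> 0).
Proof.
move=> hF; have [K K0 hK] := normal_pdf_tail.
have C0 : 0 <= C.
  have := le_trans (normr_ge0 _) (hF m); rewrite pmulr_lge0//.
  by rewrite subrr expr0n addr0 mul1r wE mulr_gt0 ?expR_gt0// normal_peak_gt0// gt_eqF.
set L := C * K * (normal_peak (2 * s) * (8 * s ^+ 2)).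
have key (y : R) : y != 0 -> forall x, (x - m) ^+ 2 = y ^+ 2 -> `|F x| <= L / y ^+ 2.
  move=> y0 x xy; rewrite (le_trans (hF x))//.
  apply: (@le_trans _ _ (C * (K * normal_pdf m (2 * s) x))); first by rewrite ler_wpM2l.
  rewrite /L -!mulrA ler_wpM2l// ler_wpM2l//.
  rewrite normal_pdfE; last by rewrite mulf_neq0 ?gt_eqF.
  rewrite ler_wpM2l ?normal_peak_ge0//.
  have -> : normal_fun m (2 * s) x = expR (- (y ^+ 2 / (8 * s ^+ 2))).
    by rewrite /normal_fun xy; congr expR; field; rewrite gt_eqF.
  have y2 : 0 < y ^+ 2 by rewrite exprn_even_gt0.
  have v0 : 0 < y ^+ 2 / (8 * s ^+ 2) by rewrite divr_gt0// mulr_gt0.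
  have -> : 8 * (s * (s / y ^+ 2)) = (y ^+ 2 / (8 * s ^+ 2))^-1.
    by field; rewrite y0 gt_eqF.
  rewrite expRN lef_pV2 ?qualifE/= ?expR_gt0//.
  by rewrite (le_trans _ (expR_ge1Dx _))// lerDr.
have L0 : (fun n : nat => L / n%:R ^+ 2) @ \oo --> 0.
  rewrite -(mulr0 L); apply: cvgMr; apply/(gtr0_cvgV0 (f := fun n : nat => n%:R ^+ 2)).
    by exists 1%N => // n /= n0; rewrite exprn_gt0// ltr0n.
  apply/cvgryPge => A; near=> n.
  rewrite (@le_trans _ _ n%:R)//.
    by near: n; exact: nbhs_infty_ger.
  rewrite expr2 ler_peMr// ler1n; near: n; exact: nbhs_infty_gt.
have bnd G : (forall n, (G n - m) ^+ 2 = n%:R ^+ 2) -> F (G n) @[n --> \oo] --> 0.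
  move=> hG; apply/norm_cvg0P.
  apply: (squeeze_cvgr _ (cvg_cst 0) L0).
  near=> n; rewrite normr_ge0/= key//.
  by rewrite pnatr_eq0 -lt0n; near: n; exact: nbhs_infty_gt.
by split; apply: bnd => n; ring.
Unshelve. all: by end_near. Qed.

Lemma integral_derive_normal (F f : R -> R) (C : R) :
  (forall x : R, is_derive x 1 F (f x)) -> continuous f ->
  (forall x, `|F x| <= C * ((1 + (x - m) ^+ 2) * w x)) ->
  (forall x, `|f x| <= C * ((1 + (x - m) ^+ 2) * w x)) ->
  \int[mu]_x f x = 0.
Proof.
move=> dF cf hF hf.
have mf : measurable_fun setT f by exact: continuous_measurable_fun.
have If := integrable_normal_poly mf hf.
have [F1 F2] := normal_pdf_to0 hF.
pose D (n : nat) : set (measurableTypeR R) := [set` `[m - n.+1%:R, m + n.+1%:R]].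
have ftc n : (\int[mu]_(x in D n) (f x)%:E)%E = (F (m + n.+1%:R) - F (m - n.+1%:R))%:E.
  rewrite (@continuous_FTC2 _ f F)//.
  - by rewrite ltrD2l (@lt_trans _ _ 0)// ?oppr_lt0 ltr0n.
  - exact: continuous_subspaceT.
  - split => [x _||]; first by have [] := dF x.
    + apply: cvg_at_right_filter; apply: differentiable_continuous.
      by apply/derivable1_diffP; have [] := dF (m - n.+1%:R).
    + apply: cvg_at_left_filter; apply: differentiable_continuous.
      by apply/derivable1_diffP; have [] := dF (m + n.+1%:R).
  - by move=> x _; rewrite derive1E; exact: derive_val.
have mD n : measurable (D n) by exact: measurable_itv.
have m2 : measurable_fun setT (EFin \o f) by exact/measurable_EFinP.
have m1 n : measurable_fun setT ((EFin \o f) \_ (D n)).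
  by apply/(measurable_restrictT _ (mD n)); exact: measurable_funTS m2.
have c1 : {ae mu, forall x, setT x -> ((EFin \o f) \_ (D n)) x @[n --> \oo] --> (EFin \o f) x}.
  apply: aeW => x _; apply: cvg_near_cst; near=> n; rewrite patchE mem_set//.
  have : `|x - m| <= n%:R by near: n; exact: nbhs_infty_ger.
  rewrite ler_norml /D /= in_itv/= => /andP[h1 h2].
  have h3 : (n%:R : R) <= n.+1%:R by rewrite ler_nat.
  by apply/andP; split; lra.
have b1 : {ae mu, forall x n, setT x -> (`|((EFin \o f) \_ (D n)) x| <= (EFin \o (fun x => `|f x|)%R) x)%E}.
  apply: aeW => x n _; rewrite patchE; case: ifP => _ //=.
  by rewrite normr0 lee_fin.
have [_ _] := dominated_convergence measurableT m1 m2 c1 (integrable_norm If) b1.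
have -> : [sequence (\int[mu]_(x in setT) ((EFin \o f) \_ (D n)) x)%E]_n =
   (fun n => (F (m + n.+1%:R) - F (m - n.+1%:R))%:E).
  by apply/funext => n /=; rewrite -integral_mkcond ftc.
move=> h.
have h0 : (F (m + n.+1%:R) - F (m - n.+1%:R))%:E @[n --> \oo] --> (0 : R)%:E.
  apply: cvg_EFin; first exact: nearW.
  rewrite -[0]subr0; apply: cvgB.
    by rewrite -(cvg_shiftS (fun n => F (m + n%:R))) in F1.
  by rewrite -(cvg_shiftS (fun n => F (m - n%:R))) in F2.
by rewrite /Rintegral (cvg_unique _ h h0).
Unshelve. all: by end_near. Qed.

Lemma is_derive_normal_pdf (x : R) : is_derive x 1 w (- (x - m) / s ^+ 2 * w x).
Proof.
have -> : w = (fun x => normal_peak s * expR (- (x - m) ^+ 2 / (s ^+ 2 *+ 2))).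
  exact/funext.
have sN : s != 0 by rewrite gt_eqF.
apply: is_derive_eq.
by rewrite /GRing.scale/=; field.
Qed.

Lemma integral_cos_normal_pdf (g th : R) :
  \int[mu]_x (cos (g * (x - m) + th) * w x) =
  cos th * expR (- (s ^+ 2 * g ^+ 2 / 2)).
Proof.
pose f (g x : R) := cos (g * (x - m) + th) * w x.
have mw : measurable_fun setT w by exact: measurable_normal_pdf.
have w0 x : 0 <= w x by exact: normal_pdf_ge0.
have dw := is_derive_normal_pdf.
have mcs (h : R -> R) (a : R) : continuous h ->
    measurable_fun setT (fun x : R => h (a * (x - m) + th) * w x).
  move=> ch; apply: measurable_funM => //.
  apply: continuous_measurable_fun => x.
  apply: (@continuous_comp _ _ _ (fun x : R => a * (x - m) + th) h); last exact: ch.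
  apply: differentiable_continuous; exact/derivable1_diffP.
have If (a : R) : mu.-integrable setT (EFin \o f a).
  apply: (@integrable_normal_poly _ 1); first exact: (mcs cos a (@continuous_cos R)).
  move=> x; rewrite /f normrM mul1r (ger0_norm (w0 x)) ler_wpM2r//.
  rewrite (@le_trans _ _ 1)// ?lerDl ?sqr_ge0//.
  by rewrite ler_norml cos_geN1 cos_le1.
have df (a x : R) : is_derive a 1 (f ^~ x) (- (x - m) * sin (a * (x - m) + th) * w x).
  by rewrite /f; apply: is_derive_eq; rewrite /GRing.scale/=; ring.
have pE (a x : R) : partial1of2 f a x = - (x - m) * sin (a * (x - m) + th) * w x.
  by rewrite partial1of2E; apply: derive_val.
pose J (a : R) := \int[mu]_x f a x.
have sin1 (y : R) : `|sin y| <= 1 by rewrite ler_norml sin_geN1 sin_le1.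
have cos1 (y : R) : `|cos y| <= 1 by rewrite ler_norml cos_geN1 cos_le1.
have abs1 (y : R) : `|y| <= 1 + y ^+ 2.
  by rewrite -real_normK ?num_real//; have := normr_ge0 y; nra.
have ibp (a : R) : \int[mu]_x ((x - m) * (sin (a * (x - m) + th) * w x)) = s ^+ 2 * a * J a.
  pose F (x : R) := s ^+ 2 * (sin (a * (x - m) + th) * w x).
  pose F' (x : R) := s ^+ 2 * a * f a x - (x - m) * (sin (a * (x - m) + th) * w x).
  have I2 : mu.-integrable setT
      (EFin \o (fun x : R => (x - m) * (sin (a * (x - m) + th) * w x))).
    apply: (@integrable_normal_poly _ 1).
      by apply: measurable_funM; [exact: measurable_funB|exact: (mcs sin a (@continuous_sin R))].
    move=> x; rewrite mul1r mulrA normrM (ger0_norm (w0 x)) ler_wpM2r// normrM.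
    by rewrite (le_trans _ (abs1 _))// ler_piMr.
  have h : \int[mu]_x F' x = 0.
    apply: (@integral_derive_normal F F' (s ^+ 2 * (1 + `|a|) + 1)).
    - move=> x; rewrite /F /F' /f; apply: is_derive_eq.
      by rewrite /GRing.scale/=; field; rewrite gt_eqF.
    - move=> x; rewrite /F' /f; apply: differentiable_continuous.
      exact/derivable1_diffP.
    - move=> x; rewrite /F mulrA normrM (ger0_norm (w0 x)) mulrA ler_wpM2r//.
      rewrite normrM (ger0_norm (ltW s2)).
      apply: (@le_trans _ _ (s ^+ 2 * 1)); first by rewrite ler_wpM2l// ltW.
      have h5 : 0 <= s ^+ 2 * `|a| by rewrite mulr_ge0// ltW.
      have h6 : 0 <= (s ^+ 2 * (1 + `|a|) + 1) * (x - m) ^+ 2.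
        by apply: mulr_ge0; last exact: sqr_ge0; apply: addr_ge0 => //; apply: mulr_ge0; [exact: ltW|exact: addr_ge0].
      lra.
    - move=> x; rewrite /F' /f !mulrA -mulrBl normrM (ger0_norm (w0 x)) ler_wpM2r//.
      apply: (le_trans (ler_normB _ _)).
      rewrite (normrM (s ^+ 2 * a)) (normrM (s ^+ 2)) (normrM (x - m)) (ger0_norm (ltW s2)).
      have h1 := cos1 (a * (x - m) + th); have h2 := sin1 (a * (x - m) + th).
      have h3 := abs1 (x - m); have h4 := sqr_ge0 (x - m).
      apply: (@le_trans _ _ (s ^+ 2 * `|a| * 1 + `|x - m| * 1)).
        by rewrite lerD// ler_wpM2l// mulr_ge0// ltW.
      have h5 : 0 <= s ^+ 2 * `|a| by rewrite mulr_ge0// ltW.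
      have h6 : 0 <= (s ^+ 2 * (1 + `|a|)) * (x - m) ^+ 2.
        by apply: mulr_ge0; last exact: sqr_ge0; apply: mulr_ge0; [exact: ltW|exact: addr_ge0].
      rewrite !mulr1; apply: (le_trans (lerD (lexx _) h3)).
      move: h4 h5 h6; set u := (x - m) ^+ 2; move: s2; set p := s ^+ 2; move: `|a| => b; clear; move=> *; nra.
  rewrite -[LHS]add0r -h /F' RintegralB//; last exact: (integrableZl measurableT _ (If a)).
  by rewrite RintegralZl// -/(J a) subrK.
have dJ (a : R) : is_derive a 1 J (- (s ^+ 2 * a * J a)).
  have Ia : `]a - 1, a + 1[%classic a by rewrite /= in_itv/=; apply/andP; split; lra.
  have iG : mu.-integrable setT (EFin \o (fun x : R => (1 + (x - m) ^+ 2) * w x)).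
    apply: (@integrable_normal_poly _ 1).
      apply: measurable_funM => //; apply: measurable_funD => //.
      by apply: measurable_funX; exact: measurable_funB.
    by move=> x; rewrite mul1r ger0_norm// mulr_ge0// addr_ge0 ?sqr_ge0.
  have G0 (x : R) : 0 <= (1 + (x - m) ^+ 2) * w x by rewrite mulr_ge0// addr_ge0 ?sqr_ge0.
  have Gb (b y : R) : `]a - 1, a + 1[%classic b -> setT y ->
      `|partial1of2 f b y| <= (1 + (y - m) ^+ 2) * w y.
    move=> _ _; rewrite pE normrM (ger0_norm (w0 y)) ler_wpM2r// normrM normrN.
    by rewrite (le_trans _ (abs1 _))// ler_piMr.
  have dd (b y : R) : `]a - 1, a + 1[%classic b -> setT y -> derivable (f ^~ y) b 1.
    by move=> _ _; have [] := df b y.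
  have HJ := @derivable_under_integral _ _ _ mu f setT measurableT a _ _ Ia
    (fun x _ => If x) dd _ G0 iG Gb.
  have EJ := @differentiation_under_integral _ _ _ mu f setT measurableT a _ _ Ia
    (fun x _ => If x) dd _ G0 iG Gb.
  apply: DeriveDef => //; rewrite -derive1E EJ -ibp.
  rewrite -mulN1r -RintegralZl//; last first.
    apply: (@integrable_normal_poly _ 1).
      by apply: measurable_funM; [exact: measurable_funB|exact: (mcs sin a (@continuous_sin R))].
    move=> x; rewrite mul1r mulrA normrM (ger0_norm (w0 x)) ler_wpM2r// normrM.
    by rewrite (le_trans _ (abs1 _))// ler_piMr.
  by apply: eq_Rintegral => x _; rewrite pE; ring.
have cst (a b : R) : J a * expR (s ^+ 2 * a ^+ 2 / 2) = J b * expR (s ^+ 2 * b ^+ 2 / 2).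
  apply: (@is_derive_0_is_cst _ (fun a : R => J a * expR (s ^+ 2 * a ^+ 2 / 2))) => x.
  by apply: is_derive_eq; rewrite /GRing.scale/=; field.
have := cst g 0.
rewrite expr0n/= mulr0 mul0r expR0 mulr1 => e.
have J0 : J 0 = cos th.
  rewrite /J /f; under eq_Rintegral do rewrite mul0r add0r.
  rewrite RintegralZl//; last exact: integrable_normal_pdf.
  by rewrite /Rintegral integral_normal_pdf/= mulr1.
by rewrite -J0 -e expRN mulfK// gt_eqF// expR_gt0.
Qed.
End ibp.

Lemma Ex_normal (m s : R) (f : R -> R) : bmeas f ->
  Ex (normal_prob m s) f = \int[mu]_x (f x * normal_pdf m s x).
Proof.
move=> bf; have [_ ->//] := Ex_density (measurable_normal_pdf m s)
  (normal_pdf_ge0 m s) (fun A _ => erefl : normal_prob m s A = _) bf.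
Qed.

Lemma Ex_normal_cos (m s g th : R) : 0 < s ->
  Ex (normal_prob m s) (fun x => cos (g * x + th)) =
  cos (g * m + th) * expR (- (s ^+ 2 * g ^+ 2 / 2)).
Proof.
move=> s0; rewrite Ex_normal; last first.
  apply: bmeas_cos; apply: measurable_funD => //; exact: measurable_funM.
rewrite -(integral_cos_normal_pdf m s0 g (g * m + th)).
by apply: eq_Rintegral => x _; congr (cos _ * _); ring.
Qed.

Lemma Ex_normal_weight (s A B b g th : R) : 0 < s -> 0 <= b ->
  (forall x, 0 <= A + 2 * B * x + b * x ^+ 2) ->
  let D := 1 + s ^+ 2 * b in
  Ex (normal_prob 0 s)
     (fun x => expR (- ((A + 2 * B * x + b * x ^+ 2) / 2)) * cos (g * x + th)) =
  (Num.sqrt D)^-1 * expR (- ((A - s ^+ 2 * B ^+ 2 / D) / 2)) *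
  expR (- (s ^+ 2 * g ^+ 2 / D / 2)) * cos (th - g * (s ^+ 2 * B / D)).
Proof.
move=> s0 b0 pos D.
have D0 : 0 < D by rewrite ltr_pwDl// mulr_ge0// sqr_ge0.
have sD0 : 0 < Num.sqrt D by rewrite sqrtr_gt0.
have sD2 : Num.sqrt D ^+ 2 = D by rewrite sqr_sqrtr// ltW.
set K := (Num.sqrt D)^-1 * _.
set m := - (s ^+ 2 * B / D); set s' := s / Num.sqrt D.
have s'0 : 0 < s' by rewrite divr_gt0.
rewrite Ex_normal; last first.
  apply: bmeasM.
    apply: bmeas_expN; last by move=> x; rewrite divr_ge0.
    apply: measurable_funM => //; apply: measurable_funD => //.
      by apply: measurable_funD => //; exact: measurable_funM.
    by apply: measurable_funM => //; exact: measurable_funX.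
  by apply: bmeas_cos; apply: measurable_funD => //; exact: measurable_funM.
have h x : expR (- ((A + 2 * B * x + b * x ^+ 2) / 2)) * normal_pdf 0 s x =
    K * normal_pdf m s' x.
  rewrite !normal_pdfE ?gt_eqF// /normal_fun mulrCA [RHS]mulrCA /K -mulrA.
  have -> : normal_peak s' = Num.sqrt D * normal_peak s.
    rewrite /normal_peak /s' expr_div_n sD2.
    rewrite -[in RHS](invrK (Num.sqrt D)) -invfM; congr (_^-1).
    rewrite -sqrtrV ?ltW// -sqrtrM ?invr_ge0 ?ltW//; congr Num.sqrt.
    by field; rewrite gt_eqF.
  set E1 := expR (- ((A - _) / _)); set E2 := expR (- (x - m) ^+ 2 / _).
  have -> : Num.sqrt D * normal_peak s * ((Num.sqrt D)^-1 * E1 * E2) =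
    normal_peak s * (E1 * E2) by field; rewrite gt_eqF.
  rewrite /E1 /E2.
  congr (_ * _); rewrite -!expRD; congr expR.
  have -> : s' ^+ 2 = s ^+ 2 / D by rewrite /s' expr_div_n sD2.
  rewrite /m /D; field.
  by rewrite -/D !gt_eqF.
have bc : bmeas (fun x : measurableTypeR R => cos (g * x + th)).
  by apply: bmeas_cos; apply: measurable_funD => //; exact: measurable_funM.
transitivity (\int[mu]_x (K * (cos (g * x + th) * normal_pdf m s' x))).
  by apply: eq_Rintegral => x _; rewrite mulrAC h -mulrA [_ * cos _]mulrC.
rewrite RintegralZl//; last first.
  by have [] := Ex_density (measurable_normal_pdf m s')
    (normal_pdf_ge0 m s') (fun A _ => erefl : normal_prob m s' A = _) bc.
rewrite -Ex_normal// Ex_normal_cos// -mulrA [cos _ * _]mulrC.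
have -> : s' ^+ 2 * (g ^+ 2 / 2) = s ^+ 2 * g ^+ 2 / D / 2.
  by rewrite /s' expr_div_n sD2; ring.
have -> : g * m + th = th - g * (s ^+ 2 * B / D) by rewrite /m; ring.
exact: mulrA.
Qed.

Lemma normal_second_moment (s : R) : 0 < s ->
  (\int[normal_prob 0 s]_x (x ^+ 2)%:E = (s ^+ 2)%:E)%E.
Proof.
move=> s0.
have mw : measurable_fun setT (normal_pdf 0 s) by exact: measurable_normal_pdf.
have w0 x : 0 <= normal_pdf 0 s x by exact: normal_pdf_ge0.
rewrite (@ge0_integral_density (normal_prob 0 s) _ mw w0 (fun A _ => erefl)); last 2 first.
- by move=> x; rewrite lee_fin sqr_ge0.
- by apply/measurable_EFinP; exact: measurable_funX.
have s2 : 0 < s ^+ 2 by rewrite exprn_gt0.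
have I2 : mu.-integrable setT (EFin \o (fun x : R => x ^+ 2 * normal_pdf 0 s x)).
  apply: (@integrable_normal_poly 0 s s0 _ 1).
    by apply: measurable_funM => //; exact: measurable_funX.
  move=> x; rewrite mul1r subr0 normrM (ger0_norm (w0 x)) ler_wpM2r//.
  by rewrite ger0_norm ?sqr_ge0// lerDr.
have I0 := integrable_normal_pdf 0 s.
have abs1 (y : R) : `|y| <= 1 + y ^+ 2.
  by rewrite -real_normK ?num_real//; have := normr_ge0 y; nra.
have h : \int[mu]_x (x ^+ 2 * normal_pdf 0 s x - s ^+ 2 * normal_pdf 0 s x) = 0.
  apply: (@integral_derive_normal 0 s s0
    (fun x => - (s ^+ 2 * (x * normal_pdf 0 s x)))
    (fun x => x ^+ 2 * normal_pdf 0 s x - s ^+ 2 * normal_pdf 0 s x) (s ^+ 2 + 1)).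
  - move=> x; have dw := is_derive_normal_pdf 0 s0.
    apply: is_derive_eq; rewrite /GRing.scale/=; field; rewrite gt_eqF//.
  - move=> x; have dw := is_derive_normal_pdf 0 s0.
    apply: differentiable_continuous; exact/derivable1_diffP.
  - move=> x; rewrite normrN subr0 (normrM (s ^+ 2)) (normrM x) (ger0_norm (w0 x)) (ger0_norm (ltW s2)).
    rewrite !mulrA ler_wpM2r//; have := abs1 x; have := sqr_ge0 x.
    move: s2; set p := s ^+ 2; set u := x ^+ 2; move: `|x| => v; clear; nra.
  - move=> x; rewrite subr0 -mulrBl normrM (ger0_norm (w0 x)) mulrA ler_wpM2r//.
    rewrite (le_trans (ler_normB _ _))// (ger0_norm (ltW s2)) ger0_norm ?sqr_ge0//.
    have := sqr_ge0 x; move: s2; set p := s ^+ 2; set u := x ^+ 2; clear; nra.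
have e : \int[mu]_x (x ^+ 2 * normal_pdf 0 s x) = s ^+ 2.
  move: h; rewrite RintegralB//; last exact: (integrableZl measurableT _ I0).
  rewrite RintegralZl//.
  have -> : \int[mu]_x normal_pdf 0 s x = 1 by rewrite /Rintegral integral_normal_pdf.
  by rewrite mulr1 => /subr0_eq.
rewrite -[in RHS]e /Rintegral fineK; first by apply: eq_integral => x _; rewrite EFinM.
exact: integrable_fin_num I2.
Qed.

Section exponential.
Variables (q : R).
Hypothesis q0 : 0 < q.

Definition expP : probability (measurableTypeR R) R :=
  exponential_distribution_exponential_prob__canonical__probability_measure_Probability q0.

Let Ex_expP (f : R -> R) : bmeas f ->
  mu.-integrable setT (EFin \o (fun x => f x * exponential_pdf q x)) /\
  Ex expP f = \int[mu]_x (f x * exponential_pdf q x).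
Proof.
move=> bf; apply: (@Ex_density expP) => //; first exact: measurable_exponential_pdf.
by move=> x; apply: exponential_pdf_ge0; exact: ltW.
Qed.

Lemma Ex_expP_expR (k : R) : 0 <= k ->
  Ex expP (fun x => expR (- (k * Num.max x 0))) = q / (q + k).
Proof.
move=> k0.
have qk : 0 < q + k by rewrite ltr_pwDl.
have bf : bmeas (fun x : measurableTypeR R => expR (- (k * Num.max x 0))).
  apply: bmeas_expN; first by apply: measurable_funM => //; exact: measurable_maxr.
  by move=> x; rewrite mulr_ge0// le_max lexx orbT.
have [_ ->] := Ex_expP bf.
transitivity (\int[mu]_x (q / (q + k) * exponential_pdf (q + k) x)).
  apply: eq_Rintegral => x _; have [x0|x0] := ltP x 0.
    by rewrite !lt0_exponential_pdf// !mulr0.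
  rewrite !exponential_pdfE// [RHS]mulrA divfK ?gt_eqF// mulrCA -expRD.
  by congr (_ * expR _); ring.
rewrite RintegralZl//; last exact: integrable_exponential_pdf.
by rewrite /Rintegral integral_exponential_pdf//= mulr1.
Qed.

Lemma expP_lt (y : R) : expP [set x | x < y] = (1 - expR (- (q * Num.max y 0)))%:E.
Proof.
have mA : measurable ([set x | x < y] : set (measurableTypeR R)).
  by rewrite -set_itvNyo; exact: measurable_itv.
have -> : expP [set x | x < y] = (Ex expP \1_[set x | x < y])%:E.
  by rewrite Ex_indic// fineK// fin_num_measure.
congr EFin; have [_ ->] := @Ex_expP _ (bmeas_indic mA).
have [y0|y0] := leP y 0.
  rewrite mulr0 oppr0 expR0 subrr.
  rewrite (_ : (fun x => _) = (fun=> 0)); last first.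
    apply/funext => x; rewrite indicE; have [xy|xy] := boolP (x \in _); last by rewrite mul0r.
    by rewrite lt0_exponential_pdf ?mulr0// (lt_le_trans _ y0)//; exact: set_mem xy.
  by rewrite Rintegral_cst// mul0r.
have -> : \int[mu]_x ((\1_[set x | x < y] : R -> R) x * exponential_pdf q x) =
   \int[mu]_(x in `[0, y[) exponential_pdf q x.
  rewrite [RHS]Rintegral_mkcond; apply: eq_Rintegral => x _.
  rewrite patchE indicE; have [x0|x0] := ltP x 0.
    rewrite lt0_exponential_pdf// mulr0 ifF//.
    by apply/negbTE/negP => /set_mem/=; rewrite in_itv/= leNgt x0.
  have [xy|xy] := ltP x y.
    by rewrite !mem_set ?mul1r//= in_itv/= x0.
  rewrite !memNset ?mul0r//= ?in_itv/= ?x0/= ?ltNge ?xy//.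
have I : mu.-integrable `[0, y[ (EFin \o exponential_pdf q).
  by apply: integrableS (integrable_exponential_pdf q0).
rewrite Rintegral_itv_bndo_bndc// /Rintegral.
have := exponential_prob_itv0c q y0; rewrite /exponential_prob => ->.
by rewrite /= mulNr.
Qed.

End exponential.
End Gaussian.

Section Moments.
Context {R : realType}.

(* The expectation of [\prod_(i <- l) p.[e i] * \prod_(i <- l') e i] as a function of
   the mixed moments [mom r] of the [e i] (repetitions in [r] are powers), see
   [pextE]: two families with the same or converging moments can be compared. *)
Fixpoint pext (I : Type) (mom : seq I -> R) (p : {poly R}) (l l' : seq I) : R :=
  if l is i :: s then \sum_(j < size p) p`_j * pext mom p s (nseq j i ++ l')
  else mom l'.

Lemma cvg_sum_seq (J : Type) (s : seq J) (f : J -> nat -> R) (a : J -> R) :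
  (forall j, f j n @[n --> \oo] --> a j) ->
  \sum_(j <- s) f j n @[n --> \oo] --> \sum_(j <- s) a j.
Proof.
move=> h; elim: s => [|j s IH].
  by rewrite big_nil; under eq_fun do rewrite big_nil; exact: cvg_cst.
by rewrite big_cons; under eq_fun do rewrite big_cons; exact: cvgD.
Qed.

Lemma pext_cvg (I : Type) (mom : nat -> seq I -> R) (mom0 : seq I -> R) p l l' :
  (forall l, mom n l @[n --> \oo] --> mom0 l) ->
  pext (mom n) p l l' @[n --> \oo] --> pext mom0 p l l'.
Proof.
move=> h; elim: l l' => [|i l IH] l' /=; first exact: h.
apply: (@cvg_sum_seq _ _ (fun (j : 'I_(size p)) n =>
  p`_j * pext (mom n) p l (nseq j i ++ l'))) => j.
by apply: cvgMr; exact: IH.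
Qed.

Lemma pext_eq (I : Type) (mom mom' : seq I -> R) p l l' :
  (forall l, mom l = mom' l) -> pext mom p l l' = pext mom' p l l'.
Proof. by move=> /funext ->. Qed.

Lemma pext_sum (I : Type) (J : Type) (r : seq J) (mom : J -> seq I -> R) p l l' :
  pext (fun l => \sum_(k <- r) mom k l) p l l' = \sum_(k <- r) pext (mom k) p l l'.
Proof.
elim: l l' => [|i l IH] l' //=.
rewrite exchange_big/=; apply: eq_bigr => j _; rewrite IH.
by rewrite mulr_sumr.
Qed.

Lemma pextE (I : Type) d (T : measurableType d) (P : probability T R)
  (w : T -> R) (e : I -> T -> R) p l l' : bmeas w -> (forall i, bmeas (e i)) ->
  Ex P (fun t => w t * \prod_(i <- l) p.[e i t] * \prod_(i <- l') e i t) =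
  pext (fun l => Ex P (fun t => w t * \prod_(i <- l) e i t)) p l l'.
Proof.
move=> bw be; elim: l l' => [|i l IH] l' /=.
  by apply: Ex_ext => t; rewrite big_nil mulr1.
transitivity (Ex P (fun t => \sum_(j < size p) p`_j *
    (w t * \prod_(i <- l) p.[e i t] * \prod_(i <- nseq j i ++ l') e i t))).
  apply: Ex_ext => t; rewrite big_cons horner_coef.
  rewrite mulr_suml mulr_sumr mulr_suml; apply: eq_bigr => j _.
  by rewrite big_cat/= big_nseq iter_mulr_1; ring.
have bp : forall i, bmeas (fun t => p.[e i t]).
  move=> k; under eq_fun do rewrite horner_coef.
  apply: bmeas_sum => j; apply: bmeasM; [exact: bmeas_cst|exact: bmeasX].
have bb k : bmeas (fun t => w t * \prod_(i <- l) p.[e i t] * \prod_(i <- k) e i t).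
  by apply: bmeasM; [apply: bmeasM => //; exact: bmeas_prod|exact: bmeas_prod].
rewrite Ex_sum; last by move=> j; apply/bmeas_L1/bmeasM; [exact: bmeas_cst|].
by apply: eq_bigr => j _; rewrite ExZ ?IH//; exact: bmeas_L1.
Qed.

(* On [0, 1], a polynomial that jumps from 0 to 1 around [x = 1 / N]; at
   [x = expR (- k y)] with [k] large it is a sharp threshold in [y]. *)
Definition thr (N : nat) : {poly R} := 1 - (1 - 'X) ^+ N.

Lemma thrE N x : (thr N).[x] = 1 - (1 - x) ^+ N.
Proof. by rewrite /thr !hornerE. Qed.

Section thr.
Variables (N : nat) (x : R).
Hypothesis x01 : 0 <= x <= 1.

Lemma thr_ge0 : 0 <= (thr N).[x].
Proof.
have /andP[x0 x1] := x01.
by rewrite thrE subr_ge0 exprn_ile1 ?subr_ge0// lerBlDr lerDl.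
Qed.

Lemma thr_le1 : (thr N).[x] <= 1.
Proof.
have /andP[x0 x1] := x01.
by rewrite thrE lerBlDr lerDl exprn_ge0// subr_ge0.
Qed.

Lemma thr_le : (thr N).[x] <= N%:R * x.
Proof.
have /andP[x0 x1] := x01.
rewrite thrE lerBlDr; elim: N => [|n IH]; first by rewrite mul0r add0r expr0.
rewrite exprS -natr1 mulrDl mul1r.
have h : 0 <= (1 - x) ^+ n by rewrite exprn_ge0// subr_ge0.
have h1 : (1 - x) ^+ n <= 1 by rewrite exprn_ile1 ?subr_ge0// lerBlDr lerDl.
nra.
Qed.

Lemma thr_ge : 1 - expR (- (N%:R * x)) <= (thr N).[x].
Proof.
have /andP[x0 x1] := x01.
rewrite thrE lerD2l lerN2 -mulrN expRM_natl lerXn2r ?nnegrE ?subr_ge0 ?expR_ge0//.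
exact: expR_ge1Dx.
Qed.
End thr.

Lemma prod_ge1B (I : Type) (s : seq I) (F : I -> R) (e : R) : 0 <= e ->
  (forall i, 0 <= F i <= 1) -> (forall i, 1 - e <= F i) ->
  1 - (size s)%:R * e <= \prod_(i <- s) F i.
Proof.
move=> e0 F01 Fe; elim: s => [|i s IH]; first by rewrite big_nil mul0r subr0.
rewrite big_cons /= -natr1 mulrDl mul1r.
have p1 : \prod_(j <- s) F j <= 1.
  by apply: prodr_ile1 => j _; exact: F01.
have /andP[a b] := F01 i.
by have := Fe i; nra.
Qed.

Lemma prod_le_factor (I : eqType) (s : seq I) (F : I -> R) (i : I) :
  (forall i, 0 <= F i <= 1) -> i \in s -> \prod_(j <- s) F j <= F i.
Proof.
move=> F01; elim: s => // k s IH; rewrite inE big_cons => /orP[/eqP <-|/IH h].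
  have /andP[a b] := F01 i.
  by apply: ler_piMr => //; apply: prodr_ile1 => j _; exact: F01.
apply: le_trans h; have /andP[a b] := F01 k; apply: ler_piMl => //.
by apply: prodr_ge0 => j _; case/andP: (F01 j).
Qed.
End Moments.

Section Uniqueness.
Context {R : realType}.

Lemma Ex_gauss_weight d (T : measurableType d) (P : probability T R)
  (W Y phi : T -> R) (s : R) : 0 < s -> bmeas W ->
  measurable_fun setT Y -> measurable_fun setT phi ->
  Ex P (fun t => W t * expR (- (s ^+ 2 * Y t ^+ 2 / 2)) * cos (phi t)) =
  Ex (normal_prob 0 s) (fun g => Ex P (fun t => W t * cos (g * Y t + phi t))).
Proof.
move=> s0 bW mY mphi.
transitivity (Ex P (fun t => Ex (normal_prob 0 s) (fun g => W t * cos (g * Y t + phi t)))).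
  apply: Ex_ext => t.
  rewrite ExZ; last first.
    apply/bmeas_L1/bmeas_cos; apply: measurable_funD => //; exact: measurable_funM.
  under Ex_ext do rewrite [_ * Y t]mulrC.
  by rewrite Ex_normal_cos// mulr0 add0r; ring.
apply: (@Ex_swap _ _ _ _ _ P (normal_prob 0 s)
  (fun z => W z.1 * cos (z.2 * Y z.1 + phi z.1))).
apply: bmeasM.
  have [mW [M hM]] := bW; split; last by exists M.
  exact: (measurableT_comp mW).
apply: bmeas_cos; apply: measurable_funD.
  apply: measurable_funM; first exact: measurable_snd.
  exact: (measurableT_comp mY).
exact: (measurableT_comp mphi).
Qed.

Definition same_cf (I : finType) d1 (T1 : measurableType d1) (P : probability T1 R)
    d2 (T2 : measurableType d2) (Q : probability T2 R)
    (A : I -> T1 -> R) (B : I -> T2 -> R) :=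
  forall (a : I -> R) (th : R),
  Ex P (fun t => cos (\sum_i a i * A i t + th)) =
  Ex Q (fun t => cos (\sum_i a i * B i t + th)).

Section same_cf.
Context (I : finType) d1 (T1 : measurableType d1) (P : probability T1 R)
    d2 (T2 : measurableType d2) (Q : probability T2 R)
    (A : I -> T1 -> R) (B : I -> T2 -> R).

Let bump (T : Type) (X : I -> T -> R) (s h : R) i t :=
  expR (- (s ^+ 2 * (X i t + h) ^+ 2 / 2)).

Lemma bmeas_bump d (T : measurableType d) (X : I -> T -> R) (s h : R) :
  (forall i, measurable_fun setT (X i)) -> forall i, bmeas (bump X s h i).
Proof.
move=> mX i; apply: bmeas_expN.
  apply: measurable_funM => //; apply: measurable_funM => //.
  by apply: measurable_funX; exact: measurable_funD.
by move=> t; rewrite divr_ge0// mulr_ge0// sqr_ge0.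
Qed.

Lemma measurable_lin d (T : measurableType d) (X : I -> T -> R) (a : I -> R) (th : R) :
  (forall i, measurable_fun setT (X i)) ->
  measurable_fun setT (fun t => \sum_i a i * X i t + th).
Proof.
move=> mX; apply: measurable_funD => //.
by apply: measurable_sum => i; exact: measurable_funM.
Qed.

Hypotheses (mA : forall i, measurable_fun setT (A i)).
Hypotheses (mB : forall i, measurable_fun setT (B i)).
Hypothesis AB : same_cf P Q A B.

Lemma same_cf_bump (s h : R) (l : seq I) : 0 < s -> forall a th,
  Ex P (fun t => \prod_(i <- l) bump A s h i t * cos (\sum_i a i * A i t + th)) =
  Ex Q (fun t => \prod_(i <- l) bump B s h i t * cos (\sum_i a i * B i t + th)).
Proof.
move=> s0; elim: l => [|i l IH] a th.
  under Ex_ext do rewrite big_nil mul1r.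
  under [RHS]Ex_ext do rewrite big_nil mul1r.
  exact: AB.
have step d (T : measurableType d) (P0 : probability T R) (X : I -> T -> R) :
    (forall i, measurable_fun setT (X i)) ->
    Ex P0 (fun t => \prod_(i <- i :: l) bump X s h i t * cos (\sum_i a i * X i t + th)) =
    Ex (normal_prob 0 s) (fun g => Ex P0 (fun t => \prod_(i <- l) bump X s h i t *
      cos (\sum_j (a j + g * (j == i)%:R) * X j t + (th + g * h)))).
  move=> mX; under Ex_ext do rewrite big_cons [bump _ _ _ _ _ * _]mulrC.
  rewrite (@Ex_gauss_weight _ _ P0 (fun t => \prod_(j <- l) bump X s h j t)
    (fun t => X i t + h) (fun t => \sum_j a j * X j t + th) s s0
    (bmeas_prod l (bmeas_bump s h mX)) _ (measurable_lin a th mX)); last first.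
    exact: measurable_funD.
  apply: Ex_ext => g; apply: Ex_ext => t; congr (_ * cos _).
  have E : \sum_j g * (j == i)%:R * X j t = g * X i t.
    rewrite (bigD1 i)//= eqxx mulr1 big1 ?addr0// => j /negbTE ->.
    by rewrite mulr0 mul0r.
  under [in RHS]eq_bigr do rewrite mulrDl.
  by rewrite big_split/= E; ring.
by rewrite !step//; apply: Ex_ext => g; rewrite IH.
Qed.

Hypotheses (LA : forall i, L1 P (A i)).

(* The events are approximated by products of thresholds [thr N] of the bumps
   [expR (- n (X i + n)^2)]: below level [r] all bumps are much larger than [1 / N],
   above level [r + dl] one of them is much smaller. *)
Lemma same_cf_le_max (r dl : R) : 0 < dl ->
  fine (P [set t | forall i, A i t <= r]) <= fine (Q [set t | forall i, B i t <= r + dl]).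
Proof.
move=> dl0; apply/ler_addgt0Pr => e' e'0; move: (e' : R) e'0 => {e'} e e0.
have m_all d (T : measurableType d) (X : I -> T -> R) (y : R) :
    (forall i, measurable_fun setT (X i)) -> measurable [set t | forall i, X i t <= y].
  move=> mX; have -> : [set t | forall i, X i t <= y] = \bigcap_(i in setT) [set t | X i t <= y].
    by apply/seteqP; split => t /= h i => [_|]; exact: h.
  by apply: fin_bigcap_measurable => // i _; exact: measurable_le_set.
pose C := \sum_i Ex P (fun t => `|A i t|) + (#|I|%:R + 2) / (dl / 2).
have C0 : 0 <= C.
  by apply: addr_ge0; [apply: sumr_ge0 => i _; exact: Ex_ge0|rewrite divr_ge0 ?addr_ge0// divr_ge0// ltW].
pose n := (Num.truncn (`|r| + 1 + C / e)).+1.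
have hn : `|r| + 1 + C / e < n%:R.
  by have /truncn_itv/andP[] : 0 <= `|r| + 1 + C / e by rewrite addr_ge0 ?addr_ge0// divr_ge0// ltW.
have Ce0 : 0 <= C / e by rewrite divr_ge0// ltW.
have n0 : 0 < (n%:R : R) by rewrite ltr0n.
have nr : 1 <= n%:R + r.
  have : - `|r| <= r by rewrite lerNl -normrN ler_norm.
  lra.
have Cn : C / n%:R <= e.
  by rewrite ler_pdivrMr// mulrC -ler_pdivrMr//; have := normr_ge0 r; lra.
pose s := Num.sqrt (2 * n%:R : R).
have s0 : 0 < s by rewrite sqrtr_gt0 mulr_gt0.
have s2 : s ^+ 2 = 2 * n%:R by rewrite sqr_sqrtr// mulr_ge0// ltW.
pose u := r + dl / 2.
pose N := (Num.truncn (expR (n%:R * (u + n%:R) ^+ 2))).+1.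
have /andP[N1 N2] : expR (n%:R * (u + n%:R) ^+ 2) <= N%:R <= 2 * expR (n%:R * (u + n%:R) ^+ 2).
  have /truncn_itv/andP[h1 h2] := expR_ge0 (n%:R * (u + n%:R) ^+ 2).
  rewrite ltW//= /N -natr1 mulrDl mul1r lerD// -expR0 ler_expR.
  by rewrite mulr_ge0 ?sqr_ge0// ltW.
pose F (T : Type) (X : I -> T -> R) t := \prod_i (thr N).[bump X s n%:R i t].
have b01 (T : Type) (X : I -> T -> R) i t : 0 <= bump X s n%:R i t <= 1.
  by rewrite expR_ge0 expR_le1 oppr_le0 divr_ge0// mulr_ge0// sqr_ge0.
have th01 (T : Type) (X : I -> T -> R) t i : 0 <= (thr N).[bump X s n%:R i t] <= 1.
  by rewrite thr_ge0//= thr_le1.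
have bF d (T : measurableType d) (X : I -> T -> R) :
    (forall i, measurable_fun setT (X i)) -> bmeas (F T X).
  move=> mX; apply: bmeas_prod => i; under eq_fun do rewrite horner_coef.
  apply: bmeas_sum => j; apply: bmeasM; first exact: bmeas_cst.
  by apply: bmeasX; exact: bmeas_bump.
have EF : Ex P (F _ A) = Ex Q (F _ B).
  have h := @pextE R I _ _ P (fun=> 1) (bump A s n%:R) (thr N) (index_enum I) [::]
    (bmeas_cst _ 1) (bmeas_bump s n%:R mA).
  have h' := @pextE R I _ _ Q (fun=> 1) (bump B s n%:R) (thr N) (index_enum I) [::]
    (bmeas_cst _ 1) (bmeas_bump s n%:R mB).
  transitivity (Ex P (fun t => 1 * F _ A t * \prod_(i <- [::]) bump A s n%:R i t)).
    by apply: Ex_ext => t; rewrite big_nil mulr1 mul1r.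
  rewrite h (pext_eq (mom' := fun l => Ex Q (fun t => 1 * \prod_(i <- l) bump B s n%:R i t))).
    by rewrite -h'; apply: Ex_ext => t; rewrite big_nil mulr1 mul1r.
  move=> l; have := same_cf_bump n%:R l s0 (fun=> 0) 0.
  have z d (T : measurableType d) (P0 : probability T R) (X : I -> T -> R) :
     Ex P0 (fun t => \prod_(i <- l) bump X s n%:R i t * cos (\sum_i 0 * X i t + 0)) =
     Ex P0 (fun t => 1 * \prod_(i <- l) bump X s n%:R i t).
    apply: Ex_ext => t.
    have -> : \sum_i 0 * X i t = 0 by rewrite big1// => i _; rewrite mul0r.
    by rewrite addr0 cos0 mulr1 mul1r.
  by rewrite !z.
have dl2 : 0 < dl / 2 by rewrite divr_gt0.
have nd0 : 0 < n%:R * (dl / 2) by rewrite mulr_gt0.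
rewrite -!Ex_indic; [|exact: m_all..].
have low : Ex P \1_[set t | forall i, A i t <= r] <=
    Ex P (F _ A) + ((\sum_i Ex P (fun t => `|A i t|)) / n%:R + #|I|%:R / (n%:R * (dl / 2))).
  rewrite -Ex_sum; last by move=> i; exact: L1_norm.
  rewrite [_ / n%:R]mulrC -ExZ; last by apply: L1_sum => i; exact: L1_norm.
  rewrite -[X in _ + (_ + X)](Ex_cst P) -ExD ?L1_cst//; last first.
    by apply: L1Z; apply: L1_sum => i; exact: L1_norm.
  rewrite -ExD; last 2 first.
  - exact/bmeas_L1/bF.
  - by apply: L1D; [apply: L1Z; apply: L1_sum => i; exact: L1_norm|exact: L1_cst].
  apply: Ex_le; first exact/bmeas_L1/bmeas_indic/m_all.
    apply: L1D; first exact/bmeas_L1/bF.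
    by apply: L1D; [apply: L1Z; apply: L1_sum => i; exact: L1_norm|exact: L1_cst].
  move=> t; rewrite indicE.
  have F0 : 0 <= F _ A t by apply: prodr_ge0 => i _; case/andP: (th01 _ A t i).
  have S0 : 0 <= n%:R^-1 * \sum_i `|A i t| by rewrite mulr_ge0 ?sumr_ge0// invr_ge0 ltW.
  have I0 : 0 <= #|I|%:R / (n%:R * (dl / 2)) by rewrite divr_ge0// ltW.
  have [/set_mem/= Ar|_] := boolP (t \in _); last by rewrite !addr_ge0.
  have [/existsP[i Ai]|/existsPn Ai] := boolP [exists i, A i t < - n%:R].
    have : n%:R <= \sum_i `|A i t|.
      rewrite (bigD1 i)//= (@le_trans _ _ `|A i t|)// ?lerDl ?sumr_ge0//.
      by rewrite ltr0_norm; lra.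
    move=> h; have : 1 <= n%:R^-1 * \sum_i `|A i t| by rewrite ler_pdivlMl// mulr1.
    by move=> *; change (true%:R : R) with (1 : R); lra.
  have : 1 - (size (index_enum I))%:R * (n%:R * (dl / 2))^-1 <= F _ A t.
    apply: prod_ge1B; first by rewrite invr_ge0 ltW.
      by move=> i; exact: th01.
    move=> i; apply: le_trans (thr_ge N (b01 _ A i t)).
    rewrite lerD2l lerN2 expRN lef_pV2 ?qualifE/= ?expR_gt0//.
    apply: (@le_trans _ _ (expR (n%:R * (dl / 2)))).
      by apply: le_trans (expR_ge1Dx _); rewrite lerDr.
    rewrite ler_expR.
    apply: (@le_trans _ _ (expR (n%:R * (u + n%:R) ^+ 2) * bump A s n%:R i t)); last first.
      by rewrite ler_wpM2r//; case/andP: (b01 _ A i t).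
    rewrite /bump -expRD; apply: le_trans (expR_ge1Dx _).
    have -> : s ^+ 2 * (A i t + n%:R) ^+ 2 / 2 = n%:R * (A i t + n%:R) ^+ 2.
      by rewrite s2; field.
    have h1 : 0 <= A i t + n%:R by have := Ai i; rewrite -leNgt; lra.
    have h2 := Ar i.
    have : (A i t + n%:R) ^+ 2 <= (r + n%:R) ^+ 2 by rewrite lerXn2r ?nnegrE//; lra.
    rewrite /u => h3; have : 0 <= n%:R * ((r + n%:R) ^+ 2 - (A i t + n%:R) ^+ 2).
      by rewrite mulr_ge0 ?subr_ge0// ltW.
    have : 0 <= n%:R * (dl / 2) * (r + n%:R - 1) by rewrite mulr_ge0 ?subr_ge0 1?addrC// ltW.
    have : 0 <= n%:R * (dl / 2) * (r + n%:R) by rewrite mulr_ge0 ?(ltW nd0)//; lra.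
    have : 0 <= n%:R * (dl / 2) ^+ 2 by rewrite mulr_ge0 ?sqr_ge0// ltW.
    by move=> *; lra.
  have -> : size (index_enum I) = #|I| by rewrite -sum1_size -sum1_card; apply: eq_bigl.
  by move=> *; change (true%:R : R) with (1 : R); lra.
have upp : Ex Q (F _ B) <= Ex Q \1_[set t | forall i, B i t <= r + dl] + 2 / (n%:R * (dl / 2)).
  rewrite -[X in _ + X](Ex_cst Q) -ExD ?L1_cst//; last exact/bmeas_L1/bmeas_indic/m_all.
  apply: Ex_le; first exact/bmeas_L1/bF.
    by apply: L1D; [exact/bmeas_L1/bmeas_indic/m_all|exact: L1_cst].
  move=> t; rewrite indicE; have [_|/negP Br] := boolP (t \in _).
    apply: (@le_trans _ _ 1); first by apply: prodr_ile1 => i _; exact: th01.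
    by rewrite lerDl divr_ge0// ltW.
  have [i Bi] : exists i, r + dl < B i t.
    apply: contrapT => h; apply: Br; apply/mem_set => i /=; rewrite leNgt.
    by apply/negP => h'; apply: h; exists i.
  rewrite add0r; apply: le_trans (prod_le_factor (th01 _ B t) (mem_index_enum i)) _.
  apply: le_trans (thr_le N (b01 _ B i t)) _.
  apply: (@le_trans _ _ (2 * (expR (n%:R * (u + n%:R) ^+ 2) * bump B s n%:R i t))).
    by rewrite mulrA ler_wpM2r//; case/andP: (b01 _ B i t).
  rewrite ler_wpM2l// /bump -expRD.
  have -> : s ^+ 2 * (B i t + n%:R) ^+ 2 / 2 = n%:R * (B i t + n%:R) ^+ 2.
    by rewrite s2; field.
  apply: (@le_trans _ _ (expR (- (n%:R * (dl / 2))))); last first.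
    rewrite expRN lef_pV2 ?qualifE/= ?expR_gt0//.
    by apply: le_trans (expR_ge1Dx _); rewrite lerDr.
  rewrite ler_expR.
  have : (r + dl + n%:R) ^+ 2 <= (B i t + n%:R) ^+ 2 by rewrite lerXn2r ?nnegrE//; lra.
  rewrite /u => h3; have : 0 <= n%:R * ((B i t + n%:R) ^+ 2 - (r + dl + n%:R) ^+ 2).
    by rewrite mulr_ge0 ?subr_ge0// ltW.
  have : 0 <= n%:R * (dl / 2) * (r + n%:R - 1) by rewrite mulr_ge0 ?subr_ge0 1?addrC// ltW.
  have : 0 <= n%:R * (dl / 2) ^+ 2 by rewrite mulr_ge0 ?sqr_ge0// ltW.
  by move=> *; lra.
have : Ex P \1_[set t | forall i, A i t <= r] <=
    Ex Q \1_[set t | forall i, B i t <= r + dl] + C / n%:R.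
  apply: (le_trans low); rewrite EF; apply: (le_trans (lerD upp (lexx _))).
  rewrite -addrA lerD2l /C le_eqVlt; apply/orP; left; apply/eqP.
  by field; rewrite !gt_eqF.
by move=> h; apply: (le_trans h); rewrite lerD2l.
Qed.
End same_cf.
End Uniqueness.

Section Concentration.
Context {R : realType}.

Lemma Ex_le_cdf d1 (T1 : measurableType d1) (P : probability T1 R)
    d2 (T2 : measurableType d2) (Q : probability T2 R) (X : T1 -> R) (Y : T2 -> R) :
  L1 P X -> L1 Q Y ->
  (forall r, fine (Q [set t | Y t <= r]) <= fine (P [set t | X t <= r])) ->
  Ex P X <= Ex Q Y.
Proof.
move=> LX LY h.
pose X' : {RV P >-> R} := HB.pack X (isMeasurableFun.Build _ _ _ _ X (L1_measurable LX)).
pose Y' : {RV Q >-> R} := HB.pack Y (isMeasurableFun.Build _ _ _ _ Y (L1_measurable LY)).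
have hc r : (cdf Y' r <= cdf X' r)%E.
  have := h r; rewrite -lee_fin !fineK ?fin_num_measure//.
  - exact: (measurable_le_set r (L1_measurable LX)).
  - exact: (measurable_le_set r (L1_measurable LY)).
have hcc r : (ccdf X' r <= ccdf Y' r)%E.
  by rewrite !ccdf_1_cdf leeB.
rewrite -lee_fin -!Ex_EFin//.
have eX : ('E_P[X'] = \int[P]_t (X t)%:E)%E by rewrite unlock.
have eY : ('E_Q[Y'] = \int[Q]_t (Y t)%:E)%E by rewrite unlock.
rewrite -eX -eY !expectation_cdf_ccdf; last 2 first.
- exact/Lfun1_integrable/LY.
- exact/Lfun1_integrable/LX.
apply: leeB.
  apply: ge0_le_integral => //.
  - exact: measurable_funTS (ccdf_measurable _).
  - exact: measurable_funTS (ccdf_measurable _).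
apply: ge0_le_integral => //.
- exact: measurable_funTS (cdf_measurable _).
- exact: measurable_funTS (cdf_measurable _).
Qed.

Definition mx (I : finType) (i0 : I) (T : Type) (A : I -> T -> R) (t : T) : R :=
  \big[Num.max/A i0 t]_i A i t.

Lemma mx_leP (I : finType) (i0 : I) (T : Type) (A : I -> T -> R) t r :
  mx i0 A t <= r <-> (forall i, A i t <= r).
Proof.
split=> [h i|h]; last by apply: bigmax_le.
by apply: le_trans h; exact: le_bigmax.
Qed.

Lemma mx_ge (I : finType) (i0 : I) (T : Type) (A : I -> T -> R) t i :
  A i t <= mx i0 A t.
Proof. exact: le_bigmax. Qed.

Lemma mx_attained (I : finType) (i0 : I) (T : Type) (A : I -> T -> R) t :
  exists i, mx i0 A t = A i t.
Proof.
apply: contrapT => h.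
have [r [rm hr]] : exists r, r < mx i0 A t /\ forall i, A i t <= r.
  have lt i : A i t < mx i0 A t.
    by rewrite lt_neqAle mx_ge andbT; apply/eqP => e; apply: h; exists i.
  have : mx i0 A t < mx i0 A t by apply: bigmax_lt.
  by rewrite ltxx.
by have /mx_leP := hr => /(_ i0); rewrite leNgt rm.
Qed.

Lemma L1_mx (I : finType) (i0 : I) d (T : measurableType d) (P : probability T R)
  (A : I -> T -> R) : (forall i, L1 P (A i)) -> L1 P (mx i0 A).
Proof.
move=> LA; apply: (L1_le (g := fun t => \sum_i `|A i t|)).
- rewrite /mx; elim: (index_enum I) => [|i s IH].
    by under eq_fun do rewrite big_nil; exact: L1_measurable.
  under eq_fun do rewrite big_cons; apply: measurable_maxr => //.
  exact: L1_measurable.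
- by apply: L1_sum => i; exact: L1_norm.
- move=> t; have [i ->] := mx_attained i0 A t.
  by rewrite (bigD1 i)//= lerDl sumr_ge0.
Qed.

Lemma Ex_mx_le (I : finType) (i0 : I) d1 (T1 : measurableType d1) (P : probability T1 R)
    d2 (T2 : measurableType d2) (Q : probability T2 R)
    (A : I -> T1 -> R) (B : I -> T2 -> R) :
  (forall i, L1 P (A i)) -> (forall i, L1 Q (B i)) -> same_cf P Q A B ->
  Ex Q (mx i0 B) <= Ex P (mx i0 A).
Proof.
move=> LA LB AB; apply/ler_addgt0Pr => e e0.
have -> : Ex P (mx i0 A) + e = Ex P (fun t => mx i0 A t + e).
  by rewrite ExD ?Ex_cst//; [exact: L1_mx|exact: L1_cst].
apply: Ex_le_cdf.
- exact: L1_mx.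
- by apply: L1D; [exact: L1_mx|exact: L1_cst].
move=> r.
have -> : [set t | mx i0 A t + e <= r] = [set t | forall i, A i t <= r - e].
  by apply/seteqP; split => t /=; rewrite -lerBrDr => /mx_leP.
have -> : [set t | mx i0 B t <= r] = [set t | forall i, B i t <= r - e + e].
  by apply/seteqP; split => t /=; rewrite subrK => /mx_leP.
apply: same_cf_le_max => //.
- by move=> i; exact: L1_measurable.
- by move=> i; exact: L1_measurable.
Qed.

Lemma Ex_mx_eq (I : finType) (i0 : I) d1 (T1 : measurableType d1) (P : probability T1 R)
    d2 (T2 : measurableType d2) (Q : probability T2 R)
    (A : I -> T1 -> R) (B : I -> T2 -> R) :
  (forall i, L1 P (A i)) -> (forall i, L1 Q (B i)) -> same_cf P Q A B ->
  Ex P (mx i0 A) = Ex Q (mx i0 B).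
Proof.
move=> LA LB AB; apply/eqP; rewrite eq_le !Ex_mx_le//.
Qed.


Lemma Ex_prodP d1 (T1 : measurableType d1) (P : probability T1 R)
    d2 (T2 : measurableType d2) (Q : probability T2 R) (f : T1 * T2 -> R) :
  bmeas f -> Ex (prodP P Q) f = Ex P (fun x => Ex Q (fun y => f (x, y))).
Proof.
move=> bf; apply: EFin_inj.
rewrite -!Ex_EFin; [|exact/bmeas_L1/bmeas_Ex1|exact: bmeas_L1].
under [RHS]eq_integral.
  move=> x _; rewrite -Ex_EFin; last exact/bmeas_L1/bmeas_pair1.
  over.
by rewrite (integral12_prod_meas1 (bmeas_prod_L1 P Q bf)).
Qed.

Lemma sin_le_id (x : R) : 0 <= x -> sin x <= x.
Proof.
move=> x0.
have [|c _] := @MVT_segment _ sin cos 0 x x0 (fun y _ => is_derive_sin y).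
  exact/continuous_subspaceT/continuous_sin.
rewrite sin0 !subr0 => ->; have := cos_le1 c; nra.
Qed.

Lemma onem_cos_le (x : R) : 0 <= x -> 1 - cos x <= x ^+ 2.
Proof.
move=> x0.
have [|c] := @MVT_segment _ cos (fun y => - sin y) 0 x x0 (fun y _ => is_derive_cos y).
  exact/continuous_subspaceT/continuous_cos.
rewrite in_itv/= => /andP[c0 cx]; rewrite cos0 !subr0 => h.
have := sin_le_id c0; nra.
Qed.

Section gauss.
Context (V : finType) (v0 : V) d (T : measurableType d) (Q : probability T R).
Variables (X : V -> T -> R) (G : V -> V -> R).

Definition bil (a b : V -> R) := \sum_i \sum_j a i * b j * G i j.

Definition gauss_cf := forall (a : V -> R) (th : R),
  Ex Q (fun t => cos (\sum_i a i * X i t + th)) = cos th * expR (- (bil a a / 2)).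

Hypothesis cfX : gauss_cf.
Hypothesis Gsym : forall i j, G i j = G j i.
Hypothesis LX : forall i, L1 Q (X i).

Lemma bilDl a1 a2 b (r s : R) :
  bil (fun i => a1 i * r + a2 i * s) b = r * bil a1 b + s * bil a2 b.
Proof.
rewrite /bil !mulr_sumr -big_split/=; apply: eq_bigr => i _.
rewrite !mulr_sumr -big_split/=; apply: eq_bigr => j _; ring.
Qed.

Lemma bilC a b : bil a b = bil b a.
Proof.
rewrite /bil exchange_big/=; apply: eq_bigr => i _; apply: eq_bigr => j _.
by rewrite Gsym; ring.
Qed.

Lemma bil_lin a1 a2 (r s : R) :
  let a := fun i => a1 i * r + a2 i * s in
  bil a a = r ^+ 2 * bil a1 a1 + s ^+ 2 * bil a2 a2 + 2 * (r * s) * bil a1 a2.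
Proof.
move=> a; rewrite /a bilDl (bilC a1) (bilC a2) !bilDl (bilC a2 a1); ring.
Qed.

Let QQ := prodP Q Q.

Definition rot (al : R) (i : V) (z : T * T) := cos al * X i z.1 + sin al * X i z.2.

Definition rot2 (al be : R) (k : V + V) : T * T -> R :=
  match k with inl i => rot al i | inr i => rot be i end.

Lemma measurable_rot al i : measurable_fun setT (rot al i).
Proof.
have mX := L1_measurable (LX i).
apply: measurable_funD; apply: measurable_funM => //; exact: (measurableT_comp mX).
Qed.

Lemma cf_rot2 al be (a : V + V -> R) th :
  Ex QQ (fun z => cos (\sum_k a k * rot2 al be k z + th)) =
  cos th * expR (- ((bil (a \o inl) (a \o inl) + bil (a \o inr) (a \o inr)
    + 2 * cos (al - be) * bil (a \o inl) (a \o inr)) / 2)).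
Proof.
have mX i := L1_measurable (LX i).
rewrite Ex_prodP; last first.
  apply: bmeas_cos; apply: measurable_funD => //; apply: measurable_sum => k.
  apply: measurable_funM => //; case: k => i /=; exact: measurable_rot.
pose ac i := a (inl i) * cos al + a (inr i) * cos be.
pose asn i := a (inl i) * sin al + a (inr i) * sin be.
transitivity (Ex Q (fun x => cos (\sum_i ac i * X i x + th) * expR (- (bil asn asn / 2)))).
  apply: Ex_ext => x; rewrite -cfX; apply: Ex_ext => y; congr cos.
  rewrite big_sumType/= addrA; congr (_ + _).
  rewrite -!big_split/=; apply: eq_bigr => i _; rewrite /ac /asn /rot/=; ring.
under Ex_ext do rewrite mulrC.
rewrite ExZ; last by apply/bmeas_L1/bmeas_cos; exact: measurable_lin.
rewrite cfX mulrCA -expRD; congr (_ * expR _).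
rewrite /ac /asn !bil_lin cosB.
set b1 := bil (a \o inl) (a \o inl); set b2 := bil (a \o inr) (a \o inr).
set b3 := bil (a \o inl) (a \o inr).
rewrite !sin2cos2.
by field.
Qed.

Lemma cf_rot al (a : V -> R) th :
  Ex QQ (fun z => cos (\sum_i a i * rot al i z + th)) =
  cos th * expR (- (bil a a / 2)).
Proof.
pose a' (k : V + V) := if k is inl i then a i else 0.
have := cf_rot2 al 0 a' th.
have -> : bil (a' \o inr) (a' \o inr) = 0.
  by rewrite /bil big1// => i _; rewrite big1// => j _; rewrite /= !mul0r.
have -> : bil (a' \o inl) (a' \o inr) = 0.
  by rewrite /bil big1// => i _; rewrite big1// => j _; rewrite /= mulr0 mul0r.
rewrite mulr0 !addr0 => <-; apply: Ex_ext => z; congr cos.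
by rewrite big_sumType/= [X in _ + X + _]big1 ?addr0// => i _; rewrite mul0r.
Qed.

Lemma L1_fst (f : T -> R) : L1 Q f -> L1 QQ (fun z => f z.1).
Proof.
move=> Lf; have mf := L1_measurable Lf.
have mf1 : measurable_fun setT (fun z : T * T => `|f z.1|).
  by apply: measurableT_comp => //; exact: (measurableT_comp mf).
apply/integrableP; split; first by apply/measurable_EFinP; exact: (measurableT_comp mf).
rewrite (fubini_tonelli1 (m1 := Q) (m2 := Q) (fun z : T * T => `|f z.1|%:E))//; last first.
  exact/measurable_EFinP.
have e x : fubini_F Q (fun z : T * T => `|f z.1|%:E) x = `|f x|%:E.
  by have := Ex_EFin (L1_cst Q `|f x|); rewrite Ex_cst.
by under eq_integral do rewrite e; have /integrableP[] := Lf.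
Qed.

Lemma L1_snd (f : T -> R) : L1 Q f -> L1 QQ (fun z => f z.2).
Proof.
move=> Lf; have mf := L1_measurable Lf.
have mf1 : measurable_fun setT (fun z : T * T => `|f z.2|).
  by apply: measurableT_comp => //; exact: (measurableT_comp mf).
apply/integrableP; split; first by apply/measurable_EFinP; exact: (measurableT_comp mf).
rewrite (fubini_tonelli1 (m1 := Q) (m2 := Q) (fun z : T * T => `|f z.2|%:E))//; last first.
  exact/measurable_EFinP.
have e x : fubini_F Q (fun z : T * T => `|f z.2|%:E) x = (Ex Q (fun t => `|f t|))%:E.
  by rewrite /fubini_F Ex_EFin//; exact: L1_norm.
by under eq_integral do rewrite e; have /= -> := Ex_EFin (L1_cst Q (Ex Q (fun t => `|f t|))); rewrite ltry.
Qed.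

Lemma L1_rot al i : L1 QQ (rot al i).
Proof.
by apply: L1D; apply: L1Z; [exact: (L1_fst (LX i))|exact: (L1_snd (LX i))].
Qed.

Lemma L1_rot2 al be k : L1 QQ (rot2 al be k).
Proof. by case: k => i; exact: L1_rot. Qed.

Let m := Ex Q (mx v0 X).

Lemma Ex_mx_rot al : Ex QQ (mx v0 (rot al)) = m.
Proof.
apply: Ex_mx_eq => //; first by move=> i; exact: L1_rot.
by move=> a th; rewrite cf_rot cfX.
Qed.

Lemma mx_rot2 al be z :
  mx (inl v0) (rot2 al be) z = Num.max (mx v0 (rot al) z) (mx v0 (rot be) z).
Proof.
apply/eqP; rewrite eq_le; apply/andP; split.
  apply/mx_leP => -[i|i] /=; rewrite le_max mx_ge ?orbT//.
rewrite ge_max; apply/andP; split; apply/mx_leP => i.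
  exact: (mx_ge (inl v0) (rot2 al be) z (inl i)).
exact: (mx_ge (inl v0) (rot2 al be) z (inr i)).
Qed.

(* [|x - y| = 2 max(x, y) - (x + y)], and the expectation of the joint maximum only
   depends on the covariances of [rot2 al be], hence on [be - al]. *)
Lemma Ex_rot_diff al be :
  Ex QQ (fun z => `|mx v0 (rot al) z - mx v0 (rot be) z|) =
  2 * Ex QQ (mx (inl v0) (rot2 al be)) - 2 * m.
Proof.
have L al' : L1 QQ (mx v0 (rot al')) by apply: L1_mx => i; exact: L1_rot.
have L2 : L1 QQ (mx (inl v0) (rot2 al be)) by apply: L1_mx => i; exact: L1_rot2.
transitivity (Ex QQ (fun z => 2 * mx (inl v0) (rot2 al be) z -
    (mx v0 (rot al) z + mx v0 (rot be) z))).
  apply: Ex_ext => z; rewrite mx_rot2.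
  by case: (leP (mx v0 (rot al) z)) => h; [rewrite ler0_norm ?subr_le0//|rewrite gtr0_norm ?subr_gt0//]; ring.
rewrite ExB; [|exact: L1Z|exact: L1D].
by rewrite ExZ// ExD// !Ex_mx_rot; ring.
Qed.

Lemma Ex_rot_diff_shift al be :
  Ex QQ (fun z => `|mx v0 (rot al) z - mx v0 (rot be) z|) =
  Ex QQ (fun z => `|mx v0 (rot 0) z - mx v0 (rot (be - al)) z|).
Proof.
rewrite !Ex_rot_diff; congr (_ * _ - _).
apply: Ex_mx_eq; [exact: L1_rot2|exact: L1_rot2|].
move=> a th; rewrite !cf_rot2 sub0r opprB.
by rewrite -(cosN (al - be)) opprB -(cosN (be - al)) opprB.
Qed.

Variable sg : R.
Hypothesis sgX : forall i, Ex Q (fun t => `|X i t|) <= sg.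

Lemma Ex_rot_small (dl : R) : 0 <= dl -> dl <= pi / 2 ->
  Ex QQ (fun z => `|mx v0 (rot 0) z - mx v0 (rot dl) z|) <=
  2 * ((1 - cos dl) * Ex Q (fun t => `|mx v0 X t|) + sin dl * sg).
Proof.
move=> d0 d1.
have s0 : 0 <= sin dl by rewrite sin_ge0_pi// d0/=; have := pi_ge0 R; lra.
have LZ : L1 Q (mx v0 X) by exact: L1_mx.
have L al' : L1 QQ (mx v0 (rot al')) by apply: L1_mx => i; exact: L1_rot.
pose D z := mx v0 (rot 0) z - mx v0 (rot dl) z.
have LD : L1 QQ D by exact: L1B.
have LM : L1 QQ (fun z => Num.max (D z) 0).
  apply: (L1_le (g := fun z => `|D z|)); first by apply: measurable_maxr => //; exact: (L1_measurable LD).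
    exact: L1_norm.
  by move=> z; case: (leP (D z) 0); rewrite ?normr0// ler_norm.
have -> : Ex QQ (fun z => `|mx v0 (rot 0) z - mx v0 (rot dl) z|) =
    2 * Ex QQ (fun z => Num.max (D z) 0).
  transitivity (Ex QQ (fun z => 2 * Num.max (D z) 0 - D z)).
    apply: Ex_ext => z; rewrite -/(D z).
    by case: (leP (D z) 0) => h; [rewrite ler0_norm//|rewrite gtr0_norm//]; ring.
  rewrite ExB//; last exact: L1Z.
  by rewrite ExZ// /D ExB// !Ex_mx_rot subrr subr0.
rewrite ler_pM2l// -lee_fin -Ex_EFin//.
have mM := L1_measurable LM.
rewrite (fubini_tonelli1 (m1 := Q) (m2 := Q) (fun z => (Num.max (D z) 0)%:E))//; last 2 first.
- exact/measurable_EFinP.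
- by move=> z; rewrite lee_fin le_max lexx orbT.
have LR : L1 Q (fun x => (1 - cos dl) * `|mx v0 X x| + sin dl * sg).
  by apply: L1D; [apply: L1Z; exact: L1_norm|exact: L1_cst].
have -> : (1 - cos dl) * Ex Q (fun t => `|mx v0 X t|) + sin dl * sg =
    Ex Q (fun x => (1 - cos dl) * `|mx v0 X x| + sin dl * sg).
  rewrite ExD ?Ex_cst ?ExZ//; [exact: L1_norm|apply: L1Z; exact: L1_norm|exact: L1_cst].
rewrite -Ex_EFin//.
have sg0 : 0 <= sg by apply: le_trans (sgX v0); exact: Ex_ge0.
apply: ge0_le_integral => //.
- by move=> x _; apply: integral_ge0 => y _; rewrite lee_fin le_max lexx orbT.
- apply: (measurable_fun_fubini_tonelli_F (fun z => (Num.max (D z) 0)%:E)) => //.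
    exact/measurable_EFinP.
  by move=> z; rewrite lee_fin le_max lexx orbT.
- exact/measurable_EFinP/L1_measurable/LR.
move=> x _; have [i hi] := mx_attained v0 X x.
have c1 := cos_le1 dl.
have LXi : L1 Q (fun y => (1 - cos dl) * `|mx v0 X x| + sin dl * `|X i y|).
  by apply: L1D; [exact: L1_cst|apply: L1Z; exact: L1_norm].
apply: (@le_trans _ _ (\int[Q]_y ((1 - cos dl) * `|mx v0 X x| + sin dl * `|X i y|)%:E)%E).
  apply: ge0_le_integral => //.
  - by move=> y _; rewrite lee_fin le_max lexx orbT.
  - apply/measurable_EFinP; exact: (measurableT_comp mM (pair1_measurable x)).
  - exact/measurable_EFinP/L1_measurable/LXi.
  move=> y _; rewrite lee_fin ge_max; apply/andP; split; last first.
    by rewrite addr_ge0// mulr_ge0// subr_ge0.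
  have -> : D (x, y) = mx v0 X x - mx v0 (rot dl) (x, y).
    rewrite /D; congr (_ - _); rewrite /mx /rot /=.
    by rewrite cos0 sin0; under eq_bigr do rewrite mul1r mul0r addr0; rewrite mul1r mul0r addr0.
  have h1 := mx_ge v0 (rot dl) (x, y) i; rewrite /rot/= in h1.
  have h2 := ler_norm (mx v0 X x); have h3 := ler_norm (- X i y); rewrite normrN in h3.
  rewrite hi in h2 *.
  have h4 : (1 - cos dl) * X i x <= (1 - cos dl) * `|X i x| by rewrite ler_wpM2l// subr_ge0.
  have h5 : sin dl * - X i y <= sin dl * `|X i y| by rewrite ler_wpM2l.
  lra.
rewrite Ex_EFin// lee_fin ExD ?Ex_cst; [|exact: L1_cst|by apply: L1Z; exact: L1_norm].
by rewrite lerD2l ExZ ?ler_wpM2l//; exact: L1_norm.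
Qed.

(* [rot 0] and [rot (pi / 2)] are independent copies of [X]; the distance of their
   maxima is bounded along [n] small rotations. *)
Lemma concentration : Ex Q (fun t => `|mx v0 X t - m|) <= 4 * sg.
Proof.
have LZ : L1 Q (mx v0 X) by exact: L1_mx.
have L al' : L1 QQ (mx v0 (rot al')) by apply: L1_mx => i; exact: L1_rot.
have LD a b : L1 QQ (fun z => `|mx v0 (rot a) z - mx v0 (rot b) z|).
  by apply: L1_norm; exact: L1B.
set M := Ex Q (fun t => `|mx v0 X t|).
have M0 : 0 <= M by exact: Ex_ge0.
have sg0 : 0 <= sg by apply: le_trans (sgX v0); exact: Ex_ge0.
have pi0 : 0 <= pi / 2 :> R by rewrite divr_ge0// pi_ge0.
have pi2 : pi / 2 <= 2 :> R by rewrite ltW// pihalf_lt2.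
pose W a := Ex QQ (fun z => `|mx v0 (rot 0) z - mx v0 (rot a) z|).
have tele (dl : R) k : 0 <= dl -> dl <= pi / 2 ->
    W (k%:R * dl) <= k%:R * (2 * ((1 - cos dl) * M + sin dl * sg)).
  move=> d0 d1; elim: k => [|k IH].
    rewrite /W !mul0r; under Ex_ext do rewrite subrr normr0; by rewrite Ex_cst.
  apply: (@le_trans _ _ (W (k%:R * dl) + W dl)).
    have -> : W dl = Ex QQ (fun z => `|mx v0 (rot (k%:R * dl)) z - mx v0 (rot (k.+1%:R * dl)) z|).
      by rewrite Ex_rot_diff_shift /W -natr1 mulrDl mul1r addrAC subrr add0r.
    rewrite /W -ExD//; apply: Ex_le => //; first exact: L1D.
    move=> z; apply: le_trans (ler_normD _ _).
    by rewrite addrA subrK.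
  by rewrite -natr1 mulrDl mul1r lerD//; exact: Ex_rot_small.
have Wpi : W (pi / 2) <= 4 * sg.
  apply/ler_addgt0Pr => e' e'0; move: (e' : R) e'0 => {e'} e e0.
  pose n := (Num.truncn (8 * M / e)).+1.
  have n0 : 0 < (n%:R : R) by rewrite ltr0n.
  have hn : 8 * M / e < n%:R.
    by have /truncn_itv/andP[] : 0 <= 8 * M / e by rewrite divr_ge0 ?mulr_ge0// ltW.
  pose dl : R := pi / 2 / n%:R.
  have d0 : 0 <= dl by rewrite divr_ge0// ltW.
  have nd : n%:R * dl = pi / 2 by rewrite /dl mulrC divfK// gt_eqF.
  have d1 : dl <= pi / 2 by rewrite ler_pdivrMr// ler_peMr// ler1n.
  have := tele dl n d0 d1; rewrite nd => h; apply: (le_trans h).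
  have h1 := onem_cos_le d0; have h2 := sin_le_id d0.
  have h3 : (1 - cos dl) * M + sin dl * sg <= dl ^+ 2 * M + dl * sg.
    by rewrite lerD// ler_wpM2r.
  apply: (@le_trans _ _ (n%:R * (2 * (dl ^+ 2 * M + dl * sg)))).
    by rewrite ler_wpM2l ?(ltW n0)// ler_wpM2l.
  have -> : n%:R * (2 * (dl ^+ 2 * M + dl * sg)) =
     2 * (n%:R * dl) * (dl * M) + 2 * (n%:R * dl) * sg by ring.
  rewrite nd addrC lerD//; first by have : pi / 2 * sg <= 2 * sg by [rewrite ler_wpM2r|]; lra.
  have h4 : dl * n%:R <= 2 by rewrite mulrC nd.
  have h5 : dl * M * n%:R <= 2 * M by rewrite mulrAC ler_wpM2r.
  have h6 : 8 * M <= n%:R * e by rewrite -ler_pdivrMr// ltW.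
  have h7 : dl * M <= e / 4 by rewrite -(ler_pM2r n0); lra.
  have h8 : 0 <= dl * M by rewrite mulr_ge0.
  nra.
apply: le_trans Wpi.
have mZ := L1_measurable LZ.
have LDp := LD 0 (pi / 2).
have mD : measurable_fun setT (EFin \o (fun z => `|mx v0 (rot 0) z - mx v0 (rot (pi / 2)) z|)).
  exact/measurable_EFinP/L1_measurable/LDp.
rewrite -lee_fin /W -!Ex_EFin//; last by apply: L1_norm; apply: L1B => //; exact: L1_cst.
rewrite (fubini_tonelli1 (m1 := Q) (m2 := Q)
  (fun z => `|mx v0 (rot 0) z - mx v0 (rot (pi / 2)) z|%:E))//.
apply: ge0_le_integral => //.
- by apply/measurable_EFinP; apply: measurableT_comp => //; exact: measurable_funB.
- by apply: (measurable_fun_fubini_tonelli_F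
    (fun z => `|mx v0 (rot 0) z - mx v0 (rot (pi / 2)) z|%:E)).
move=> x _.
rewrite /fubini_F (_ : (fun y => _) = (fun y => `|mx v0 X x - mx v0 X y|%:E)); last first.
  apply/funext => y; congr (`|_ - _|%:E).
    rewrite /mx /rot /=.
    by rewrite cos0 sin0; under eq_bigr do rewrite mul1r mul0r addr0; rewrite mul1r mul0r addr0.
  rewrite /mx /rot /=.
  by rewrite cos_pihalf sin_pihalf; under eq_bigr do rewrite mul1r mul0r add0r; rewrite mul1r mul0r add0r.
have LB : L1 Q (fun y => mx v0 X x - mx v0 X y) by apply: L1B => //; exact: L1_cst.
rewrite Ex_EFin ?lee_fin; last exact: L1_norm.
have -> : mx v0 X x - m = Ex Q (fun y => mx v0 X x - mx v0 X y).
  by rewrite ExB ?Ex_cst//; exact: L1_cst.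
exact: Ex_norm.
Qed.

End gauss.
End Concentration.

Section Green.
Context {R : realType} (V : finType) (c : V -> V -> R).
Hypothesis net : network c.

Definition lap (f : V -> R) (x : V) : R := \sum_y c x y * (f x - f y).
Definition dir (f k : V -> R) : R :=
  2^-1 * \sum_x \sum_y c x y * ((f x - f y) * (k x - k y)).

Let csym x y : c x y = c y x. Proof. by case: net. Qed.
Let cge0 x y : 0 <= c x y. Proof. by case: net. Qed.

Lemma sum_lap f k : \sum_x k x * lap f x = dir f k.
Proof.
have e : \sum_x k x * lap f x = \sum_x \sum_y c x y * ((f x - f y) * k x).
  by apply: eq_bigr => x _; rewrite /lap mulr_sumr; apply: eq_bigr => y _; ring.
have e' : \sum_x k x * lap f x = \sum_x \sum_y c x y * ((f x - f y) * - k y).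
  rewrite e exchange_big/=; apply: eq_bigr => x _; apply: eq_bigr => y _.
  by rewrite csym; ring.
rewrite /dir; apply: (mulfI (x := 2)); first by rewrite pnatr_eq0.
rewrite mulrA divff ?pnatr_eq0// mul1r mulrDl mul1r {1}e e' -big_split/=.
by apply: eq_bigr => x _; rewrite -big_split/=; apply: eq_bigr => y _; ring.
Qed.

Lemma dirC f k : dir f k = dir k f.
Proof.
by rewrite /dir; congr (_ * _); apply: eq_bigr => x _; apply: eq_bigr => y _; ring.
Qed.

Lemma energyE f : energy c f = dir f f.
Proof.
by rewrite /energy /dir; congr (_ * _); apply: eq_bigr => x _; apply: eq_bigr => y _;
  rewrite expr2.
Qed.

Lemma dir_ge0 f : 0 <= dir f f.
Proof.
by rewrite -energyE mulr_ge0 ?invr_ge0// sumr_ge0// => x _; rewrite sumr_ge0// => y _;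
  rewrite mulr_ge0// sqr_ge0.
Qed.

Lemma lapD f k r s x : lap (fun z => r * f z + s * k z) x = r * lap f x + s * lap k x.
Proof.
rewrite /lap !mulr_sumr -big_split/=; apply: eq_bigr => y _; ring.
Qed.

Lemma dirDr f k l (r s : R) : dir f (fun z => r * k z + s * l z) = r * dir f k + s * dir f l.
Proof.
rewrite -!(dirC _ f) -!sum_lap !mulr_sumr -big_split/=.
by apply: eq_bigr => x _; rewrite lapD; ring.
Qed.

Lemma dir_eq0 f : dir f f = 0 -> forall x y, f x = f y.
Proof.
move=> /eqP; rewrite mulf_eq0 invr_eq0 pnatr_eq0/= => /eqP h.
have step a b : 0 < c a b -> f a = f b.
  move=> cab; have h1 : \sum_y c a y * ((f a - f y) * (f a - f y)) = 0.
    apply/eqP; move/eqP: h; rewrite psumr_eq0; last first.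
      by move=> i _; rewrite sumr_ge0// => j _; rewrite -expr2 mulr_ge0// sqr_ge0.
    by move=> /allP/(_ a (mem_index_enum a)).
  move/eqP: h1; rewrite psumr_eq0; last by move=> j _; rewrite -expr2 mulr_ge0// sqr_ge0.
  move=> /allP/(_ b (mem_index_enum b))/=.
  by rewrite !mulf_eq0 (gt_eqF cab)/= orbb subr_eq0 => /eqP.
move=> x y; have [_ _ _ /(_ x y)/connectP[p]] := net.
elim: p x => [|z p IH] x /=; first by move=> _ ->.
by move=> /andP[xz zp] yl; rewrite (step _ _ xz) (IH z zp yl).
Qed.

Lemma poisson (v0 : V) (g : V -> R) :
  exists f : V -> R, forall x, lap f x + f v0 * (x == v0)%:R = g x.
Proof.
pose vT : vectType R := {ffun V -> R^o}.
pose phi (f : vT) : vT := [ffun x => lap f x + f v0 * (x == v0)%:R].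
have lin : linear phi.
  move=> a f k; apply/ffunP => x; rewrite !ffunE.
  have -> : lap (a *: f + k) x = lap (fun z => a * f z + 1 * k z) x.
    by rewrite /lap; apply: eq_bigr => y _; rewrite !ffunE /GRing.scale/=; ring.
  by rewrite lapD /GRing.scale/=; ring.
pose L : {linear vT -> vT} := HB.pack phi (GRing.isLinear.Build _ _ _ _ phi lin).
have ker : lker (linfun L) == 0%VS.
  rewrite -subv0; apply/subvP => f; rewrite memv_ker memv0 lfunE/= => /eqP h.
  have hx x : lap f x + f v0 * (x == v0)%:R = 0.
    by have /ffunP/(_ x) := h; rewrite !ffunE.
  have e : dir f f + f v0 ^+ 2 = 0.
    transitivity (\sum_x f x * (lap f x + f v0 * (x == v0)%:R)); last first.
      by rewrite big1// => x _; rewrite hx mulr0.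
    under [RHS]eq_bigr do rewrite mulrDr.
    rewrite big_split/= sum_lap; congr (_ + _).
    rewrite (bigD1 v0)//= eqxx mulr1 big1 ?addr0 ?expr2// => x /negbTE ->.
    by rewrite !mulr0.
  have f0 : f v0 = 0.
    apply/eqP; rewrite -sqrf_eq0; apply/eqP.
    by have := dir_ge0 f; have := sqr_ge0 (f v0); lra.
  have d0 : dir f f = 0 by move: e; rewrite f0 expr0n addr0.
  by apply/eqP/ffunP => x; rewrite (dir_eq0 d0 x v0) f0 ffunE.
pose G : vT := [ffun x => g x].
exists ((linfun L)^-1%VF G : vT) => x.
have := lker0_compfV ker => /lfunP/(_ G); rewrite comp_lfunE id_lfunE lfunE/=.
by move=> /ffunP/(_ x); rewrite !ffunE.
Qed.

Lemma green_exists (v0 : V) : exists g : V -> V -> R, forall y,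
  g y v0 = 0 /\ forall x, lap (g y) x = (x == y)%:R - (x == v0)%:R.
Proof.
suff h y : exists f : V -> R, f v0 = 0 /\ forall x, lap f x = (x == y)%:R - (x == v0)%:R.
  by exists (fun y => sval (cid (h y))) => y; exact: (svalP (cid (h y))).
have [f hf] := poisson v0 (fun x => (x == y)%:R - (x == v0)%:R).
have sumd z : \sum_x (x == z)%:R = 1 :> R.
  by rewrite (bigD1 z)//= eqxx big1 ?addr0// => x /negbTE ->.
have f0 : f v0 = 0.
  have : \sum_x (lap f x + f v0 * (x == v0)%:R) = 0.
    under eq_bigr do rewrite hf.
    by rewrite sumrB !sumd subrr.
  rewrite big_split/= -mulr_sumr sumd mulr1.
  have -> : \sum_x lap f x = dir f (fun=> 1).
    by rewrite -sum_lap; apply: eq_bigr => x _; rewrite mul1r.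
  rewrite /dir big1 ?mulr0 ?add0r// => x _; rewrite big1// => z _.
  by rewrite subrr !mulr0.
by exists f; split=> // x; rewrite -hf f0 mul0r addr0.
Qed.

Section green.
Variables (v0 : V) (g : V -> V -> R).
Hypothesis g0 : forall y, g y v0 = 0.
Hypothesis gl : forall y x, lap (g y) x = (x == y)%:R - (x == v0)%:R.

Lemma dir_green y k : dir (g y) k = k y - k v0.
Proof.
rewrite -sum_lap; under eq_bigr do rewrite gl mulrBr.
rewrite sumrB (bigD1 y)//= eqxx mulr1 big1 ?addr0 => [|x /negbTE ->]; last by rewrite mulr0.
by rewrite (bigD1 v0)//= eqxx mulr1 big1 ?addr0 => [//|x /negbTE ->]; rewrite mulr0.
Qed.

Lemma green_sym x y : g x y = g y x.
Proof. by have := dirC (g x) (g y); rewrite !dir_green !g0 !subr0. Qed.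

Lemma green_psd a : 0 <= bil g a a.
Proof.
have -> : bil g a a = dir (fun z => \sum_i a i * g i z) (fun z => \sum_i a i * g i z).
  rewrite -sum_lap.
  have lapS x : lap (fun z => \sum_i a i * g i z) x = \sum_i a i * lap (g i) x.
    rewrite /lap; under [RHS]eq_bigr do rewrite mulr_sumr.
    rewrite [RHS]exchange_big/=; apply: eq_bigr => y _.
    by rewrite -sumrB mulr_sumr; apply: eq_bigr => i _; ring.
  set k := (fun z => \sum_i a i * g i z).
  have k0 : k v0 = 0 by rewrite /k big1// => i _; rewrite g0 mulr0.
  under [RHS]eq_bigr do rewrite lapS mulr_sumr.
  rewrite exchange_big/= /bil exchange_big/=; apply: eq_bigr => j _.
  under [RHS]eq_bigr do rewrite mulrCA.
  rewrite -mulr_sumr (sum_lap (g j) k) dir_green k0 subr0 /k mulr_sumr.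
  by apply: eq_bigr => i _; ring.
exact: dir_ge0.
Qed.

Lemma Reff_green x y : Reff c x y = g x x + g y y - 2 * g x y.
Proof.
rewrite /Reff; have [<-|xy] := eqVneq x y; first by ring.
pose u z := 1 * g x z + - 1 * g y z.
have lu z : lap u z = (z == x)%:R - (z == y)%:R by rewrite lapD !gl; ring.
have du k : dir u k = k x - k y by rewrite dirC dirDr !(dirC k) !dir_green; ring.
set r := u x - u y.
have ru : dir u u = r by rewrite du.
have r0 : 0 < r.
  rewrite lt_neqAle -ru dir_ge0 andbT eq_sym; apply/eqP => /dir_eq0 h.
  have := lu x; rewrite /lap big1; last by move=> z _; rewrite (h x z) subrr mulr0.
  by rewrite eqxx (negbTE xy) subr0 => /esym/eqP; rewrite oner_eq0.
have -> : g x x + g y y - 2 * g x y = r by rewrite /r /u (green_sym y x); ring.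
rewrite -[RHS]invrK; congr (_^-1).
set S := [set e | _].
have lb : lbound S r^-1.
  move=> e /= [f [fx fy ->]]; rewrite energyE.
  pose w z := 1 * f z + - r^-1 * u z.
  have e1 : dir f u = 1 by rewrite dirC du fx fy subr0.
  have e2 : dir w w = dir f f - r^-1.
    have ew k : dir k w = 1 * dir k f + - r^-1 * dir k u := dirDr k f u 1 (- r^-1).
    rewrite ew (dirC w f) (dirC w u) !ew (dirC u f) e1 ru.
    by field; rewrite gt_eqF.
  by rewrite -subr_ge0 -e2; exact: dir_ge0.
have Sr : S r^-1.
  exists (fun z => r^-1 * u z + - (r^-1 * u y) * 1); split.
  - by rewrite /r; field; rewrite gt_eqF.
  - ring.
  - rewrite energyE.
    pose k z := r^-1 * u z + - (r^-1 * u y) * 1.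
    have kd f : dir f k = r^-1 * dir f u.
      rewrite /k dirDr (_ : dir f (fun=> 1) = 0) ?mulr0 ?addr0//.
      by rewrite /dir big1 ?mulr0// => z _; rewrite big1// => w _; rewrite subrr !mulr0.
    by rewrite -/k kd dirC kd ru; field; rewrite gt_eqF.
apply/eqP; rewrite eq_le; apply/andP; split.
  by apply: ge_inf => //; exists r^-1.
by apply: lb_le_inf => //; exists r^-1.
Qed.
End green.
End Green.

Section GFFlaw.
Context {R : realType} (V : finType) (c : V -> V -> R).
Context d (T : measurableType d) (Q : probability T R).
Variables (v0 : V) (eta : V -> T -> R) (g : V -> V -> R).
Hypothesis net : network c.
Hypothesis gff : is_GFF c v0 Q eta.
Hypothesis g0 : forall y, g y v0 = 0.
Hypothesis gl : forall y x, lap c (g y) x = (x == y)%:R - (x == v0)%:R.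

Let meta x : measurable_fun setT (eta x). Proof. by case: gff. Qed.
Let eta0 t : eta v0 t = 0. Proof. by case: gff. Qed.

Lemma L1_sqr (f : T -> R) (v : R) : measurable_fun setT f ->
  (\int[Q]_t (f t ^+ 2)%:E)%E = v%:E -> L1 Q (fun t => f t ^+ 2) /\ Ex Q (fun t => f t ^+ 2) = v.
Proof.
move=> mf h.
have L : L1 Q (fun t => f t ^+ 2).
  apply/integrableP; split; first by apply/measurable_EFinP; exact: measurable_funX.
  under eq_integral do rewrite /= ger0_norm ?sqr_ge0//.
  by rewrite h ltry.
by split=> //; apply: EFin_inj; rewrite -Ex_EFin.
Qed.

Lemma gff_sqr x y : L1 Q (fun t => (eta x t - eta y t) ^+ 2) /\
  Ex Q (fun t => (eta x t - eta y t) ^+ 2) = g x x + g y y - 2 * g x y.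
Proof.
rewrite -(Reff_green net g0 gl); apply: (@L1_sqr (fun t => eta x t - eta y t)).
  exact: measurable_funB.
by case: gff.
Qed.

Lemma gff_sqr1 x : L1 Q (fun t => eta x t ^+ 2) /\ Ex Q (fun t => eta x t ^+ 2) = g x x.
Proof.
have [] := gff_sqr x v0.
have gv0 : g v0 v0 = 0 by [].
rewrite (g0 x) gv0 mulr0 subr0 addr0 => L e; split.
  by move: L; under eq_fun do rewrite eta0 subr0.
by rewrite -e; apply: Ex_ext => t; rewrite eta0 subr0.
Qed.

Lemma L1_gff x : L1 Q (eta x).
Proof.
apply: (L1_le (g := fun t => 1 + eta x t ^+ 2)) => //.
  by apply: L1D; [exact: L1_cst|exact: (gff_sqr1 x).1].
by move=> t; rewrite -real_normK ?num_real//; have := normr_ge0 (eta x t); nra.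
Qed.

Lemma gff_absE (s : R) : 0 < s -> (forall x, g x x <= s ^+ 2) ->
  forall x, Ex Q (fun t => `|eta x t|) <= s.
Proof.
move=> s0 gs x; have [L e] := gff_sqr1 x.
apply: (@le_trans _ _ (Ex Q (fun t => (2 * s)^-1 * (eta x t ^+ 2 + s ^+ 2)))).
  apply: Ex_le.
  - exact/L1_norm/L1_gff.
  - by apply: L1Z; apply: L1D => //; exact: L1_cst.
  - move=> t; rewrite -(real_normK (num_real (eta x t))) ler_pdivlMl ?mulr_gt0//.
    by have := sqr_ge0 (`|eta x t| - s); nra.
rewrite ExZ; last by apply: L1D => //; exact: L1_cst.
rewrite ExD ?Ex_cst ?e//; last exact: L1_cst.
by rewrite ler_pdivrMl ?mulr_gt0//; have := gs x; nra.
Qed.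

Lemma gff_cov x y : L1 Q (fun t => eta x t * eta y t) /\
  Ex Q (fun t => eta x t * eta y t) = g x y.
Proof.
have [L1x ex] := gff_sqr1 x; have [L1y ey] := gff_sqr1 y.
have [L1xy exy] := gff_sqr x y.
have e : (fun t => eta x t * eta y t) = (fun t => 2^-1 *
   (eta x t ^+ 2 + eta y t ^+ 2 - (eta x t - eta y t) ^+ 2)).
  by apply/funext => t; field.
have LL : L1 Q (fun t => eta x t ^+ 2 + eta y t ^+ 2) by exact: L1D.
rewrite e; split; first by apply: L1Z; exact: L1B.
rewrite ExZ; last exact: L1B.
by rewrite ExB// ExD// ex ey exy; field.
Qed.

Lemma gff_lin_sqr (a : V -> R) : L1 Q (fun t => (\sum_v a v * eta v t) ^+ 2) /\
  Ex Q (fun t => (\sum_v a v * eta v t) ^+ 2) = bil g a a.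
Proof.
have e : (fun t => (\sum_v a v * eta v t) ^+ 2) =
    (fun t => \sum_i \sum_j a i * a j * (eta i t * eta j t)).
  apply/funext => t; rewrite expr2 mulr_suml; apply: eq_bigr => i _.
  by rewrite mulr_sumr; apply: eq_bigr => j _; ring.
have L i j : L1 Q (fun t => a i * a j * (eta i t * eta j t)).
  by apply: L1Z; exact: (gff_cov i j).1.
rewrite e; split; first by apply: L1_sum => i; exact: L1_sum.
rewrite Ex_sum; last by move=> i; exact: L1_sum.
apply: eq_bigr => i _; rewrite Ex_sum//; apply: eq_bigr => j _.
by have [? <-] := gff_cov i j; rewrite ExZ//; exact: (gff_cov i j).1.
Qed.

Lemma gff_gauss_cf : gauss_cf Q eta g.
Proof.
move=> a th; pose Y t := \sum_i a i * eta i t.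
have mY : measurable_fun setT Y by apply: measurable_sum => i; exact: measurable_funM.
have [_ _ /(_ a) [s2 s20 cn] _] := gff.
have [LY eY] := gff_lin_sqr a.
have bcos : bmeas (fun t => cos (Y t + th)) by apply: bmeas_cos; exact: measurable_funD.
rewrite -/Y; move: cn; rewrite /centered_normal; case: eqVneq => [s20'|s2n0] cn.
  have ae0 : ae_eq Q setT (EFin \o (fun t => Y t ^+ 2)) (cst 0%E).
    exists [set t | Y t != 0]; split => //.
      have -> : [set t | Y t != 0] = ~` (Y @^-1` [set 0]).
        by apply/seteqP; split => t /=; [move/eqP|move=> ?; apply/eqP].
      apply: measurableC; rewrite -[X in measurable X]setTI; exact: mY.
    by move=> t /= h; apply: contra_not_neq h => -> _; rewrite expr0n.
  have b0 : bil g a a = 0.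
    rewrite -eY; apply: EFin_inj; rewrite -Ex_EFin//.
    transitivity (\int[Q]_t (cst 0 t : \bar R))%E; last by rewrite integral0.
    apply: ae_eq_integral => //.
    exact/measurable_EFinP/(L1_measurable LY).
  rewrite b0 mul0r oppr0 expR0 mulr1 -[RHS](Ex_cst Q).
  apply: EFin_inj; rewrite -!Ex_EFin ?L1_cst//; last exact: bmeas_L1.
  apply: ae_eq_integral => //; first by apply/measurable_EFinP; case: bcos.
  have [N [mN N0 hN]] := ae0.
  exists N; split => //; apply: subset_trans hN => t /= h; apply: contra_not h => h _.
  have [/eqP] := h I; rewrite sqrf_eq0 => /eqP Y0.
  by rewrite -/(Y t) Y0 add0r.
have s2p : 0 < s2 by rewrite lt_neqAle eq_sym s2n0.
have sp : 0 < Num.sqrt s2 by rewrite sqrtr_gt0.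
pose N : probability (measurableTypeR R) R := normal_prob 0 (Num.sqrt s2).
have mY' : @measurable_fun _ _ T (measurableTypeR R) setT Y := mY.
have law (f : R -> \bar R) : measurable_fun setT f -> (forall x, (0 <= f x)%E) ->
    (\int[Q]_t f (Y t) = \int[N]_x f x)%E.
  move=> mf f0.
  rewrite -(ge0_integral_pushforward mY' Q measurableT)//.
  by apply: eq_measure_integral => A mA _; exact: (cn A mA).
have bE : bil g a a = s2.
  rewrite -eY; apply: EFin_inj; rewrite -Ex_EFin//.
  rewrite (law (fun x => (x ^+ 2)%:E)).
  - by rewrite normal_second_moment// sqr_sqrtr// ltW.
  - by apply/measurable_EFinP; exact: measurable_funX.
  - by move=> x; rewrite lee_fin sqr_ge0.
rewrite bE; have := Ex_normal_cos 0 1 th sp.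
have -> : Num.sqrt s2 ^+ 2 * 1 ^+ 2 / 2 = s2 / 2 by rewrite sqr_sqrtr// expr1n mulr1.
rewrite mulr0 add0r => <-.
have bc2 : bmeas (fun x : measurableTypeR R => 1 + cos (1 * x + th)).
  apply: bmeasD; first exact: bmeas_cst.
  by apply: bmeas_cos; apply: measurable_funD => //; exact: measurable_funM.
have bc3 : bmeas (fun t => 1 + cos (Y t + th)) by apply: bmeasD => //; exact: bmeas_cst.
have c1 x : 0 <= 1 + cos x :> R by have := cos_geN1 x; lra.
have e1 : Ex Q (fun t => 1 + cos (Y t + th)) = 1 + Ex Q (fun t => cos (Y t + th)).
  by rewrite ExD ?Ex_cst//; [exact: L1_cst|exact: bmeas_L1].
have e2 : Ex N (fun x => 1 + cos (1 * x + th)) = 1 + Ex N (fun x => cos (1 * x + th)).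
  rewrite ExD ?Ex_cst//; first exact: L1_cst.
  by apply/bmeas_L1/bmeas_cos; apply: measurable_funD => //; exact: measurable_funM.
apply: (addrI 1); rewrite -e1 -e2.
apply: EFin_inj; rewrite -!Ex_EFin; [|exact: (bmeas_L1 N bc2)|exact: bmeas_L1].
under [RHS]eq_integral do rewrite mul1r.
apply: (law (fun x => (1 + cos (x + th))%:E)).
- case: bc2 => + _; under eq_fun do rewrite mul1r.
  by move=> ?; exact/measurable_EFinP.
- by move=> x; rewrite lee_fin.
Qed.
End GFFlaw.

Section GaussLaplace.
Context {R : realType} (V : finType) (c : V -> V -> R).
Context d (T : measurableType d) (Q : probability T R).
Variables (v0 : V) (X : V -> T -> R) (g : V -> V -> R).
Hypothesis g0 : forall y, g y v0 = 0.
Hypothesis gl : forall y x, lap c (g y) x = (x == y)%:R - (x == v0)%:R.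
Hypothesis gsym : forall x y, g x y = g y x.
Hypothesis gpsd : forall a, 0 <= bil g a a.
Hypothesis mX : forall x, measurable_fun setT (X x).
Hypothesis cfX : gauss_cf Q X g.

Definition gwt (T : Type) (X : V -> T -> R) (s h : R) (i : V) (t : T) :=
  expR (- (s ^+ 2 * (X i t + h) ^+ 2 / 2)).

(* Each factor [gwt] is the average of [cos (g (X i + h))] over a normal [g], so adding
   one is a rank-one update of the covariance [G], which stays the Green function of
   the Laplacian with killing. *)
Lemma gauss_laplace_cf (s : R) (l : seq V) : 0 < s -> v0 \notin l ->
  exists (C kap : R) (f : V -> R) (G : V -> V -> R),
  [/\ 0 < C, 0 <= kap, f v0 = 1,
    (forall x, lap c f x + (s ^+ 2 * (count_mem x l)%:R) * f x = kap * (x == v0)%:R) &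
    [/\ (forall x y, G x y = G y x), (forall a, 0 <= bil G a a), (forall y, G y v0 = 0),
        (forall y x, lap c (G y) x + (s ^+ 2 * (count_mem x l)%:R) * G y x =
           (x == y)%:R - f y * (x == v0)%:R) &
    forall h a th,
    Ex Q (fun t => \prod_(i <- l) gwt X s h i t * cos (\sum_i a i * (X i t + h) + th)) =
    C * expR (- (h ^+ 2 * kap / 2)) * expR (- (bil G a a / 2)) *
      cos (h * \sum_i a i * f i + th)]].
Proof.
move=> s0; elim: l => [_|i l IH].
  exists 1, 0, (fun=> 1), g; split => //.
    by move=> x; rewrite mulr0 mul0r addr0 mul0r /lap big1// => y _; rewrite subrr mulr0.
  split => //; first by move=> y x; rewrite mulr0 mul0r addr0 gl mul1r.
  move=> h a th; rewrite mulr0 mul0r oppr0 expR0 !mul1r.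
  transitivity (Ex Q (fun t => cos (\sum_i a i * X i t + (h * \sum_i a i * 1 + th)))).
    apply: Ex_ext => t; rewrite big_nil mul1r; congr cos.
    rewrite addrA mulr_sumr -big_split/=; congr (_ + _).
    by apply: eq_bigr => i _; ring.
  by rewrite cfX mulrC.
rewrite inE negb_or => /andP[iv0 /IH [C [kap [f [G [C0 k0 f0 lf [Gs Gp G0 lG E]]]]]]].
have gam0 : 0 <= G i i.
  have := Gp (fun x => (x == i)%:R); congr (_ <= _).
  rewrite /bil (bigD1 i)//= [X in _ + X]big1 ?addr0; last first.
    by move=> x /negbTE ->; rewrite big1// => y _; rewrite !mul0r.
  rewrite (bigD1 i)//= big1 ?addr0 ?eqxx ?mul1r//.
  by move=> x /negbTE ->; rewrite mulr0 mul0r.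
set lam := s ^+ 2; set D := 1 + lam * G i i.
have lam0 : 0 <= lam by exact: sqr_ge0.
have D0 : 0 < D by rewrite ltr_pwDl// mulr_ge0.
have Dn0 : D != 0 by rewrite gt_eqF.
have sD0 : 0 < Num.sqrt D by rewrite sqrtr_gt0.
pose f' x := 1 * f x + - (lam * f i / D) * G i x.
pose G' x y := 1 * G x y + - (lam * G i x / D) * G i y.
have cnt x : (count_mem x (i :: l))%:R = (x == i)%:R + (count_mem x l)%:R :> R.
  by rewrite /= natrD eq_sym.
have bilE a b : bil G' a b = bil G a b - lam / D * (\sum_x a x * G i x) * (\sum_x b x * G i x).
  rewrite -mulrA mulr_suml mulr_sumr -sumrB; apply: eq_bigr => x _.
  rewrite mulr_sumr mulr_sumr -sumrB; apply: eq_bigr => y _; rewrite /G'; field.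
  exact: Dn0.
have bilS a r : bil G (fun x => a x * 1 + (x == i)%:R * r) (fun x => a x * 1 + (x == i)%:R * r) =
    bil G a a + 2 * (\sum_x a x * G i x) * r + G i i * r ^+ 2.
  rewrite (bil_lin Gs).
  have -> : bil G (fun x => (x == i)%:R) (fun x => (x == i)%:R) = G i i.
    rewrite /bil (bigD1 i)//= [X in _ + X]big1 ?addr0; last first.
      by move=> x /negbTE ->; rewrite big1// => y _; rewrite !mul0r.
    rewrite (bigD1 i)//= big1 ?addr0 ?eqxx ?mul1r//.
    by move=> x /negbTE ->; rewrite mulr0 mul0r.
  have -> : bil G a (fun x => (x == i)%:R) = \sum_x a x * G i x.
    apply: eq_bigr => x _; rewrite (bigD1 i)//= big1 ?addr0 ?eqxx ?mulr1 ?(Gs x)//.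
    by move=> y /negbTE ->; rewrite mulr0 mul0r.
  ring.
exists (C / Num.sqrt D), (kap + lam * f i ^+ 2 / D), f', G'; split.
- by rewrite divr_gt0.
- by rewrite addr_ge0// divr_ge0 ?(ltW D0)// mulr_ge0// sqr_ge0.
- by rewrite /f' f0 G0 mulr0 addr0 mul1r.
- move=> x; rewrite cnt lapD /f'.
  have e1 := lf x; have e2 := lG i x.
  have -> : lap c f x = kap * (x == v0)%:R - lam * (count_mem x l)%:R * f x.
    by rewrite -e1 addrK.
  have -> : lap c (G i) x = (x == i)%:R - f i * (x == v0)%:R - lam * (count_mem x l)%:R * G i x.
    by rewrite -e2 addrK.
  have [->|xi] := eqVneq x i.
    by rewrite (eq_sym i v0) (negbTE iv0) /= /D; field; exact: Dn0.
  by rewrite /=; field; exact: Dn0.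
split.
- by move=> x y; rewrite /G' (Gs x y); ring.
- move=> a; rewrite bilE; set w := \sum_x _.
  have := Gp (fun x => a x * 1 + (x == i)%:R * (- (lam * w / D))).
  rewrite bilS -/w => h; apply: (le_trans h); rewrite -subr_ge0.
  have -> : bil G a a - lam / D * w * w - (bil G a a + 2 * w * - (lam * w / D) +
     G i i * (- (lam * w / D)) ^+ 2) = lam * w ^+ 2 / D ^+ 2.
    have -> : lam * w ^+ 2 / D ^+ 2 = (D - lam * G i i) * (lam * w ^+ 2 / D ^+ 2).
      by rewrite /D addrK mul1r.
    by field; exact: Dn0.
  by rewrite divr_ge0 ?sqr_ge0// mulr_ge0// sqr_ge0.
- by move=> y; rewrite /G' !G0 !mulr0 addr0.
- move=> y x; rewrite cnt lapD /G' /f'.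
  have e1 := lG y x; have e2 := lG i x.
  have -> : lap c (G y) x = (x == y)%:R - f y * (x == v0)%:R - lam * (count_mem x l)%:R * G y x.
    by rewrite -e1 addrK.
  have -> : lap c (G i) x = (x == i)%:R - f i * (x == v0)%:R - lam * (count_mem x l)%:R * G i x.
    by rewrite -e2 addrK.
  have [->|xi] := eqVneq x i.
    by rewrite (eq_sym i v0) (negbTE iv0) (Gs y i) /= /D; field; exact: Dn0.
  by rewrite /=; field; exact: Dn0.
move=> h a th.
have bW : bmeas (fun t => \prod_(j <- l) gwt X s h j t).
  apply: bmeas_prod => j; exact: (bmeas_bump s h mX j).
transitivity (Ex Q (fun t => \prod_(j <- l) gwt X s h j t *
    expR (- (s ^+ 2 * (X i t + h) ^+ 2 / 2)) * cos (\sum_j a j * (X j t + h) + th))).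
  by apply: Ex_ext => t; rewrite big_cons [gwt _ _ _ _ _ * _]mulrC.
rewrite (@Ex_gauss_weight _ _ _ Q (fun t => \prod_(j <- l) gwt X s h j t)
    (fun t => X i t + h) (fun t => \sum_j a j * (X j t + h) + th) s s0 bW); last 2 first.
- exact: measurable_funD.
- by apply: (@measurable_lin _ _ _ _ (fun j t => X j t + h)) => j; exact: measurable_funD.
set w := \sum_x a x * G i x.
transitivity (Ex (normal_prob 0 s) (fun r => C * expR (- (h ^+ 2 * kap / 2)) *
   (expR (- ((bil G a a + 2 * w * r + G i i * r ^+ 2) / 2)) *
    cos ((h * f i) * r + (h * \sum_j a j * f j + th))))).
  apply: Ex_ext => r.
  transitivity (Ex Q (fun t => \prod_(j <- l) gwt X s h j t *
     cos (\sum_j (a j * 1 + (j == i)%:R * r) * (X j t + h) + th))).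
    apply: Ex_ext => t; congr (_ * cos _).
    under [in RHS]eq_bigr do rewrite mulrDl mulr1.
    rewrite big_split/= [X in _ = _ + X + _](bigD1 i)//= [X in _ = _ + (_ + X) + _]big1.
      by rewrite eqxx mul1r; ring.
    by move=> j /negbTE ->; rewrite !mul0r.
  rewrite E bilS -/w -mulrA; congr (_ * (_ * cos _)).
  under eq_bigr do rewrite mulrDl mulr1.
  rewrite big_split/= [X in _ * (_ + X) + _](bigD1 i)//= [X in _ * (_ + (_ + X)) + _]big1.
    by rewrite eqxx mul1r; ring.
  by move=> j /negbTE ->; rewrite !mul0r.
have pos r : 0 <= bil G a a + 2 * w * r + G i i * r ^+ 2 by rewrite -bilS.
rewrite ExZ; last first.
  apply/bmeas_L1/bmeasM.
    apply: bmeas_expN; last by move=> r; rewrite divr_ge0.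
    apply: measurable_funM => //; apply: measurable_funD => //.
      by apply: measurable_funD => //; exact: measurable_funM.
    by apply: measurable_funM => //; exact: measurable_funX.
  by apply: bmeas_cos; apply: measurable_funD => //; exact: measurable_funM.
rewrite (Ex_normal_weight (h * f i) (h * \sum_j a j * f j + th) s0 gam0 pos) -/lam -/D.
rewrite bilE -/w.
have -> : h ^+ 2 * (kap + lam * f i ^+ 2 / D) / 2 =
  h ^+ 2 * kap / 2 + lam * (h * f i) ^+ 2 / D / 2 by field; exact: Dn0.
rewrite opprD expRD.
have -> : bil G a a - lam / D * w * w = bil G a a - lam * w ^+ 2 / D by field; exact: Dn0.
have -> : h * (\sum_j a j * f' j) + th = h * (\sum_j a j * f j) + th - h * f i * (lam * w / D).
  have -> : \sum_j a j * f' j = \sum_j a j * f j - lam * f i / D * w.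
    rewrite /w mulr_sumr -sumrB; apply: eq_bigr => j _; rewrite /f'; ring.
  field; exact: Dn0.
ring.
Qed.

Lemma gauss_laplace (s : R) (l : seq V) : 0 < s -> v0 \notin l ->
  exists (kap : R) (f : V -> R), [/\ 0 <= kap, f v0 = 1,
    (forall x, lap c f x + (s ^+ 2 * (count_mem x l)%:R) * f x = kap * (x == v0)%:R) &
    forall h, Ex Q (fun t => \prod_(i <- l) gwt X s h i t) =
      expR (- (h ^+ 2 * kap / 2)) * Ex Q (fun t => \prod_(i <- l) gwt X s 0 i t)].
Proof.
move=> s0 lv0; have [C [kap [f [G [C0 k0 f0 lf [_ _ _ _ E]]]]]] := gauss_laplace_cf s0 lv0.
exists kap, f; split => // h.
have e h' : Ex Q (fun t => \prod_(i <- l) gwt X s h' i t) = C * expR (- (h' ^+ 2 * kap / 2)).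
  have := E h' (fun=> 0) 0.
  have -> : bil G (fun=> 0) (fun=> 0) = 0.
    by rewrite /bil big1// => i _; rewrite big1// => j _; rewrite !mul0r.
  rewrite mul0r oppr0 expR0 mulr1 addr0 big1 ?mulr0 ?cos0 ?mulr1; last by move=> i _; rewrite mul0r.
  move=> <-; apply: Ex_ext => t.
  have -> : \sum_i 0 * (X i t + h') = 0 by rewrite big1// => i _; rewrite mul0r.
  by rewrite addr0 cos0 mulr1.
by rewrite !e expr0n/= mul0r mul0r oppr0 expR0 mulr1 mulrC.
Qed.
End GaussLaplace.

Section OneHolding.
Context {R : realType} d (T : measurableType d) (P : probability T R).
Variables (Y S : T -> R) (rho : R).
Hypothesis bY : bmeas Y.
Hypothesis Y01 : forall t, 0 <= Y t <= 1.
Hypothesis mS : measurable_fun setT S.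
Hypothesis law : forall y : R,
  Ex P (fun t => Y t * (y < S t)%R%:R) = rho * expR (- Num.max y 0).

Lemma b2R_indic (T' : Type) (b : T' -> bool) : (fun t => (b t)%:R : R) = \1_[set t | b t].
Proof.
apply/funext => t; rewrite indicE; case: (boolP (b t)) => h; first by rewrite mem_set.
by rewrite memNset//; exact/negP.
Qed.

Lemma bmeas_gt_ind d' (T' : measurableType d') (f g : T' -> R) :
  measurable_fun setT f -> measurable_fun setT g -> bmeas (fun t => (f t < g t)%R%:R : R).
Proof.
move=> mf mg.
under eq_fun do rewrite -subr_gt0; rewrite b2R_indic.
by apply/bmeas_indic/measurable_gt_set; exact: measurable_funB.
Qed.

Lemma holding_total : Ex P Y = rho.
Proof.
pose S' : {RV P >-> R} := HB.pack S (isMeasurableFun.Build _ _ _ _ S mS).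
have h (n : nat) : `|Ex P Y - rho| <= fine (cdf S' (- n%:R)).
  have -> : fine (cdf S' (- n%:R)) = Ex P \1_[set t | S t <= - n%:R].
    rewrite Ex_indic; last exact: measurable_le_set.
    congr fine; rewrite /cdf /distribution /pushforward; congr (P _).
  have -> : rho = Ex P (fun t => Y t * (- n%:R < S t)%R%:R).
    by rewrite law max_r ?oppr_le0// oppr0 expR0 mulr1.
  have bg : bmeas (fun t => (- n%:R < S t)%R%:R : R).
    exact: (bmeas_gt_ind (measurable_cst _) mS).
  have LY : L1 P Y by exact: bmeas_L1.
  have L2 : L1 P (fun t => Y t * (- n%:R < S t)%R%:R) by exact/bmeas_L1/bmeasM.
  rewrite -ExB//; apply: le_trans (Ex_norm _) _; first exact: L1B.
  apply: Ex_le; [exact/L1_norm/L1B|exact/bmeas_L1/bmeas_indic/measurable_le_set|].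
  move=> t; have /andP[y0 y1] := Y01 t; rewrite indicE; case: ltP => hS.
    by rewrite mulr1 subrr normr0.
  by rewrite mulr0 subr0 ger0_norm// mem_set.
suff : `|Ex P Y - rho| <= 0 by rewrite normr_le0 subr_eq0 => /eqP.
apply/ler_addgt0Pr => e' e'0; move: (e' : R) e'0 => {e'} e e0; rewrite add0r.
have /fine_cvgP[_ /cvgr0Pnorm_lt/(_ _ e0)[A [_ hA]]] := cvg_cdfNy0 S'.
pose n := Num.bound `|A|.
have nA : - n%:R < A by rewrite ltrNl; apply: le_lt_trans (ler_norm _) _; rewrite normrN archi_boundP.
apply: le_trans (h n) _; apply: le_trans (ler_norm _) _.
exact/ltW/hA.
Qed.

(* The tails [P(S > y)] are averaged against an exponential law in [y]. *)
Lemma holding_laplace (a : R) : 0 <= a ->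
  Ex P (fun t => Y t * expR (- (a * Num.max (S t) 0))) = rho / (1 + a).
Proof.
rewrite le_eqVlt => /predU1P[<-|a0].
  by rewrite addr0 divr1 -holding_total; apply: Ex_ext => t; rewrite mul0r oppr0 expR0 mulr1.
have LY : L1 P Y by exact: bmeas_L1.
pose f (z : T * measurableTypeR R) : R := Y z.1 * (z.2 < S z.1)%R%:R.
have bf : bmeas f.
  apply: bmeasM.
    by have [mY [M hM]] := bY; split; [exact: (measurableT_comp mY)|exists M].
  by apply: bmeas_gt_ind; [exact: measurable_snd|exact: (measurableT_comp mS)].
have e1 t : Ex (expP a0) (fun y => f (t, y)) = Y t * (1 - expR (- (a * Num.max (S t) 0))).
  rewrite /f/= ExZ; last first.
    by apply/bmeas_L1/bmeas_gt_ind => //; exact: measurable_cst.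
  congr (_ * _).
  rewrite (b2R_indic (fun y : measurableTypeR R => y < S t)) Ex_indic; first by rewrite expP_lt.
  by rewrite -set_itvNyo; exact: measurable_itv.
have e2 (y : R) : Ex P (fun t => f (t, y)) = rho * expR (- (1 * Num.max y 0)).
  by rewrite mul1r -law.
have h := Ex_swap P (expP a0) bf.
rewrite (Ex_ext P e1) (Ex_ext (expP a0) e2) in h.
rewrite ExZ in h; last first.
  apply/bmeas_L1/bmeas_expN; first by apply: measurable_funM => //; exact: measurable_maxr.
  by move=> y; rewrite mul1r le_max lexx orbT.
rewrite Ex_expP_expR// in h.
have bE : bmeas (fun t => Y t * expR (- (a * Num.max (S t) 0))).
  apply: bmeasM => //; apply: bmeas_expN.
    by apply: measurable_funM => //; exact: measurable_maxr.
  by move=> t; rewrite mulr_ge0 ?(ltW a0)// le_max lexx orbT.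
have : Ex P Y - Ex P (fun t => Y t * expR (- (a * Num.max (S t) 0))) = rho * (a / (a + 1)).
  by rewrite -h -ExB//; [apply: Ex_ext => t; ring|exact: bmeas_L1].
rewrite holding_total => e.
have -> : rho / (1 + a) = rho - rho * (a / (a + 1)).
  by field; rewrite !gt_eqF// addr_gt0.
by rewrite -e subKr.
Qed.
End OneHolding.

Section Walk.
Context {R : realType} (V : finType) (c : V -> V -> R).
Context d (T : measurableType d) (P : probability T R) (v0 : V).
Variables (J : nat -> T -> V) (S : nat -> T -> R).
Hypothesis crw : is_crw c v0 P J S.

Let mJ n v : measurable [set t | J n t = v]. Proof. by case: crw. Qed.
Let mS n : measurable_fun setT (S n). Proof. by case: crw. Qed.

Definition Jis (n : nat) (x : nat -> V) (t : T) : R := \prod_(i < n.+1) (J i t == x i)%:R.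

Lemma bmeas_Jeq n v : bmeas (fun t => (J n t == v)%:R : R).
Proof.
rewrite b2R_indic; apply/bmeas_indic; rewrite (_ : [set t | _] = [set t | J n t = v])//.
by apply/seteqP; split => t /= /eqP.
Qed.

Lemma bmeas_Jfun n (f : V -> R) : bmeas (fun t => f (J n t)).
Proof.
have -> : (fun t => f (J n t)) = (fun t => \sum_v (J n t == v)%:R * f v).
  apply/funext => t; rewrite (bigD1 (J n t))//= eqxx mul1r big1 ?addr0// => v.
  by rewrite eq_sym => /negbTE ->; rewrite mul0r.
by apply: bmeas_sum => v; apply: bmeasM; [exact: bmeas_Jeq|exact: bmeas_cst].
Qed.

Lemma bmeas_Jis n x : bmeas (Jis n x).
Proof. by apply: bmeas_prod => i; exact: bmeas_Jeq. Qed.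

Definition path_wt (n : nat) (x : nat -> V) : R :=
  (x 0%N == v0)%:R * \prod_(i < n) (c (x i) (x i.+1) / cv c (x i)).

Lemma prodb_indic (n : nat) (b : nat -> bool) :
  \prod_(i < n) (b i)%:R = (all b (iota 0 n))%:R :> R.
Proof.
elim: n => [|n IH]; first by rewrite big_ord0.
by rewrite -[n.+1 in RHS]addn1 iotaD all_cat add0n big_ord_recr/= IH andbT -natrM mulnb.
Qed.

Lemma walk_PF (n : nat) (x : nat -> V) (al : nat -> R) (k : nat) (s : nat -> R) :
  (forall i, 0 <= al i) ->
  Ex P (fun t => Jis n x t * \prod_(i < n.+1)
     (if (i < k)%N then expR (- (al i * Num.max (S i t) 0)) else (s i < S i t)%R%:R)) =
  path_wt n x * \prod_(i < n.+1)
     (if (i < k)%N then (1 + al i)^-1 else expR (- Num.max (s i) 0)).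
Proof.
move=> al0; elim: k s => [|k IH] s.
  have [_ _ /(_ n x s)] := crw.
  rewrite (_ : [set t | _] = [set t | all (fun i => (J i t == x i) && (s i < S i t)) (iota 0 n.+1)]).
    set A := [set t | _] => h.
    apply: EFin_inj; transitivity (P A); last exact: h.
    have E : (fun t => Jis n x t * \prod_(i < n.+1)
        (if (i < 0)%N then expR (- (al i * Num.max (S i t) 0)) else (s i < S i t)%R%:R)) = \1_A.
      rewrite -b2R_indic; apply/funext => t; rewrite /Jis -big_split/=.
      under eq_bigr do rewrite -natrM mulnb.
      by rewrite (prodb_indic _ (fun i => (J i t == x i) && (s i < S i t))).
    have bA : bmeas (\1_A : T -> R).
      rewrite -E; apply: bmeasM; first exact: bmeas_Jis.
      apply: bmeas_prod => i /=.
      by apply: bmeas_gt_ind => //; exact: measurable_cst.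
    have mA : measurable A.
      have -> : A = [set t | 1 <= (\1_A t : R)].
        apply/seteqP; split => t; first by move=> At; rewrite /= indicE mem_set.
        rewrite /= indicE; case: (boolP (t \in A)) => [/set_mem//|_].
        by rewrite ler10.
      by apply: measurable_ge_set; case: bA.
    by rewrite E Ex_indic// fineK// fin_num_measure.
  apply/seteqP; split => t; rewrite /mkset.
    move=> h; apply/allP => i; rewrite mem_iota add0n ltnS => /h[-> ->].
    by rewrite eqxx.
  move=> /allP h i ni; have /andP[/eqP ? ?] : (J i t == x i) && (s i < S i t).
    by apply: h; rewrite mem_iota.
  by split.
have [nk|kn] := ltnP n k.
  have := IH s.
  congr (Ex P _ = _ * _).
    apply/funext => t; congr (_ * _); apply: eq_bigr => i _.
    by rewrite !(leq_trans (ltn_ord i))// (leq_trans nk).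
  by apply: eq_bigr => i _; rewrite !(leq_trans (ltn_ord i))// (leq_trans nk).
pose ko := Ordinal (kn : (k < n.+1)%N).
pose Y (t : T) : R := Jis n x t * \prod_(i < n.+1 | i != ko)
     (if (i < k)%N then expR (- (al i * Num.max (S i t) 0)) else (s i < S i t)%R%:R).
pose rho : R := path_wt n x * \prod_(i < n.+1 | i != ko)
     (if (i < k)%N then (1 + al i)^-1 else expR (- Num.max (s i) 0)).
have bF i : bmeas (fun t => if (i < k)%N then expR (- (al i * Num.max (S i t) 0)) else (s i < S i t)%R%:R : R).
  case: (i < k)%N; last by apply: bmeas_gt_ind => //; exact: measurable_cst.
  apply: bmeas_expN; first by apply: measurable_funM => //; exact: measurable_maxr.
  by move=> t; rewrite mulr_ge0// le_max lexx orbT.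
have bY : bmeas Y.
  apply: bmeasM; first exact: bmeas_Jis.
  under eq_fun do rewrite big_mkcond/=.
  by apply: bmeas_prod => i; case: (i != ko); [exact: bF|exact: bmeas_cst].
have Y01 t : 0 <= Y t <= 1.
  have h01 (I : finType) (p : pred I) (F : I -> R) : (forall i, 0 <= F i <= 1) -> 0 <= \prod_(i | p i) F i <= 1.
    move=> hF; rewrite prodr_ge0 ?prodr_ile1//= => i _; by have /andP[] := hF i.
  have /andP[a0 a1] : 0 <= Jis n x t <= 1 by apply: h01 => i; case: eqP => _; rewrite lexx ler01.
  have /andP[b0 b1] : (0 : R) <= \prod_(i < n.+1 | i != ko)
     (if (i < k)%N then expR (- (al i * Num.max (S i t) 0)) else (s i < S i t)%R%:R) <= 1.
    apply: h01 => i; case: ifP => _; last by case: (_ < _); rewrite lexx ler01.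
    by rewrite expR_ge0 expR_le1 oppr_le0 mulr_ge0// le_max lexx orbT.
  by rewrite /Y mulr_ge0//= mulr_ile1.
have law y : Ex P (fun t => Y t * (y < S k t)%R%:R) = rho * expR (- Num.max y 0).
  pose s' i := if i == k then y else s i.
  have s'E (i : 'I_n.+1) : i != ko -> s' i = s i.
    by move=> ik; rewrite /s'; case: eqP => // e; move: ik; rewrite -(inj_eq val_inj)/= e eqxx.
  have := IH s'; rewrite [RHS](_ : _ = rho * expR (- Num.max y 0)).
    move=> <-; apply: Ex_ext => t; rewrite /Y -mulrA; congr (_ * _).
    rewrite [RHS](bigD1 ko)//= ltnn /s' eqxx mulrC; congr (_ * _).
    by apply: eq_bigr => i ik; rewrite -/(s' i) s'E.
  rewrite (bigD1 ko)//= ltnn /s' eqxx /rho -mulrA [expR _ * _]mulrC; congr (_ * (_ * _)).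
  by apply: eq_bigr => i ik; rewrite -/(s' i) s'E.
have := holding_laplace bY Y01 (mS k) law (al0 k).
rewrite /rho -mulrA => e.
have E t : Jis n x t * \prod_(i < n.+1)
     (if (i < k.+1)%N then expR (- (al i * Num.max (S i t) 0)) else (s i < S i t)%R%:R) =
   Y t * expR (- (al k * Num.max (S k t) 0)).
  rewrite /Y (bigD1 ko)//= ltnSn -mulrA; congr (_ * _); rewrite mulrC; congr (_ * _).
  by apply: eq_bigr => i ik; rewrite ltnS leq_eqVlt -[i == k :> nat]/(i == ko) (negbTE ik).
under Ex_ext do rewrite E.
rewrite e [in RHS](bigD1 ko)//= ltnSn; congr (_ * _); rewrite mulrC; congr (_ * _).
by apply: eq_bigr => i ik; rewrite ltnS [(i <= k)%N]leq_eqVlt -[i == k :> nat]/(i == ko) (negbTE ik).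
Qed.

Lemma Jis_neq0 n x t : Jis n x t != 0 -> forall i, (i <= n)%N -> J i t = x i.
Proof.
move=> /prodf_neq0 h i ni; have := h (Ordinal (ni : (i < n.+1)%N)) isT => /=.
by rewrite pnatr_eq0 eqb0 negbK => /eqP.
Qed.

Definition expocc (al : V -> R) (n : nat) (t : T) : R :=
  \prod_(i < n) expR (- (al (J i t) * Num.max (S i t) 0)).

Lemma bmeas_expocc al n : (forall x, 0 <= al x) -> bmeas (expocc al n).
Proof.
move=> al0; apply: bmeas_prod => i; apply: bmeas_expN.
  apply: measurable_funM; first by have [] := bmeas_Jfun i al.
  by apply: measurable_maxr.
by move=> t; rewrite mulr_ge0// le_max lexx orbT.
Qed.

Lemma Jis_expocc al n k x : (forall x, 0 <= al x) -> (k <= n.+1)%N ->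
  Ex P (fun t => Jis n x t * expocc al k t) =
  path_wt n x * \prod_(i < k) (1 + al (x i))^-1.
Proof.
move=> al0 kn; pose a i : R := if (i < k)%N then al (x i) else 0.
have a0 i : 0 <= a i by rewrite /a; case: ifP.
have aN i : (k <= i)%N -> a i = 0 by move=> ki; rewrite /a ltnNge ki.
have := walk_PF n x n.+1 (fun=> 0) a0.
have cut (F G : nat -> R) : (forall i, (k <= i)%N -> F i = 1) ->
    (forall i, (i < k)%N -> F i = G i) -> \prod_(i < n.+1) F i = \prod_(i < k) G i.
  move=> F1 FG; rewrite -(big_mkord xpredT F) (big_cat_nat _ kn)//= big_mkord.
  rewrite [X in _ * X]big_nat_cond [X in _ * X]big1 ?mulr1.
    by apply: eq_bigr => i _; exact: FG.
  by move=> i /andP[/andP[ki _] _]; exact: F1.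
move=> h; etransitivity; last first.
  etransitivity; first exact: h.
  congr (_ * _); rewrite (cut (fun i => if (i < n.+1)%N then (1 + a i)^-1 else expR (- Num.max 0 0))
    (fun i => (1 + al (x i))^-1))//.
    by move=> i ki; rewrite aN// addr0 invr1 maxxx oppr0 expR0; case: ifP.
  by move=> i ik; rewrite (leq_trans ik kn) /a ik.
apply: Ex_ext => t.
have [->|J0] := eqVneq (Jis n x t) 0; first by rewrite !mul0r.
congr (_ * _); rewrite (eq_bigr (fun i : 'I_n.+1 => expR (- (a i * Num.max (S i t) 0)))); last first.
  by move=> i _; rewrite ltn_ord.
rewrite (cut (fun i => expR (- (a i * Num.max (S i t) 0))) (fun i => expR (- (al (J i t) * Num.max (S i t) 0))))//.
  by move=> i ki; rewrite aN// mul0r oppr0 expR0.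
by move=> i ik; rewrite /a ik (Jis_neq0 J0)// -ltnS (leq_trans ik).
Qed.

Lemma Jis_step al n x y : (forall x, 0 <= al x) ->
  Ex P (fun t => Jis n x t * (J n.+1 t == y)%:R * expocc al n.+1 t) =
  c (x n) y / cv c (x n) / (1 + al (x n)) * Ex P (fun t => Jis n x t * expocc al n t).
Proof.
move=> al0; pose x' i := if (i <= n)%N then x i else y.
have xE (i : nat) : (i <= n)%N -> x' i = x i by rewrite /x' => ->.
have yE : x' n.+1 = y by rewrite /x' ltnn.
have E t : Jis n x t * (J n.+1 t == y)%:R * expocc al n.+1 t = Jis n.+1 x' t * expocc al n.+1 t.
  congr (_ * _); rewrite [RHS]/Jis big_ord_recr/= yE; congr (_ * _).
  by apply: eq_bigr => i _; rewrite xE// -ltnS.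
rewrite (Ex_ext P E) !Jis_expocc// /path_wt !big_ord_recr/= yE !xE//.
rewrite (eq_bigr (fun i : 'I_n => c (x i) (x i.+1) / cv c (x i))); last first.
  by move=> i _; rewrite !xE// ltnW.
rewrite [\prod_(i < n) (1 + al (x' i))^-1](eq_bigr (fun i : 'I_n => (1 + al (x i))^-1)); last first.
  by move=> i _; rewrite xE// ltnW.
ring.
Qed.

Let fpath n (z : {ffun 'I_n.+1 -> V}) (i : nat) : V := z (inord i).

Lemma sum_Jis n t : \sum_(z : {ffun 'I_n.+1 -> V}) Jis n (fpath z) t = 1.
Proof.
rewrite (bigD1 [ffun i : 'I_n.+1 => J i t])//= big1 => [|z zN].
  by rewrite addr0 /Jis big1// => i _; rewrite /fpath ffunE inordK ?eqxx.
apply/eqP; apply: contraNT zN => /Jis_neq0 h.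
apply/eqP/ffunP => i; rewrite ffunE (h i); last by rewrite -ltnS.
by rewrite /fpath inord_val.
Qed.

Lemma Ex_paths n f : bmeas f -> Ex P f = \sum_(z : {ffun 'I_n.+1 -> V}) Ex P (fun t => Jis n (fpath z) t * f t).
Proof.
move=> bf; rewrite -Ex_sum; last by move=> z; apply/bmeas_L1/bmeasM => //; exact: bmeas_Jis.
by apply: Ex_ext => t; rewrite -mulr_suml sum_Jis mul1r.
Qed.

Lemma walk_step al n (H : V -> V -> R) : (forall x, 0 <= al x) ->
  Ex P (fun t => expocc al n.+1 t * H (J n t) (J n.+1 t)) =
  Ex P (fun t => expocc al n t *
    \sum_y c (J n t) y / cv c (J n t) / (1 + al (J n t)) * H (J n t) y).
Proof.
move=> al0.
have bH : bmeas (fun t => H (J n t) (J n.+1 t)).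
  have E t : H (J n t) (J n.+1 t) = \sum_y (J n.+1 t == y)%:R * H (J n t) y.
    rewrite (bigD1 (J n.+1 t))//= eqxx mul1r big1 ?addr0// => v.
    by rewrite eq_sym => /negbTE ->; rewrite mul0r.
  rewrite (funext E); apply: bmeas_sum => y; apply: bmeasM; first exact: bmeas_Jeq.
  exact: (bmeas_Jfun n (H^~ y)).
have bK := bmeas_Jfun n (fun x => \sum_y c x y / cv c x / (1 + al x) * H x y).
rewrite (@Ex_paths n); last by apply: bmeasM => //; exact: bmeas_expocc.
rewrite [RHS](@Ex_paths n); last by apply: bmeasM => //; exact: bmeas_expocc.
apply: eq_bigr => z _; set x := fpath z.
transitivity (\sum_y H (x n) y * Ex P (fun t => Jis n x t * (J n.+1 t == y)%:R * expocc al n.+1 t)).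
  have be y : bmeas (fun t => Jis n x t * (J n.+1 t == y)%:R * expocc al n.+1 t).
    by apply: bmeasM; [apply: bmeasM; [exact: bmeas_Jis|exact: bmeas_Jeq]|exact: bmeas_expocc].
  under [RHS]eq_bigr => y _ do rewrite -(ExZ (H (x n) y) (bmeas_L1 P (be y))).
  rewrite -Ex_sum; last by move=> y; apply/L1Z/bmeas_L1/be.
  apply: Ex_ext => t; have [J0|J0] := eqVneq (Jis n x t) 0.
    by rewrite J0 mul0r big1// => y _; rewrite !mul0r mulr0.
  rewrite (Jis_neq0 J0 (leqnn n)) (bigD1 (J n.+1 t))//= eqxx mulr1 big1 ?addr0; first by ring.
  by move=> y; rewrite eq_sym => /negbTE ->; rewrite mulr0 mul0r mulr0.
transitivity ((\sum_y c (x n) y / cv c (x n) / (1 + al (x n)) * H (x n) y) *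
   Ex P (fun t => Jis n x t * expocc al n t)).
  by rewrite mulr_suml; apply: eq_bigr => y _; rewrite Jis_step//; ring.
rewrite -ExZ; last by apply/bmeas_L1/bmeasM; [exact: bmeas_Jis|exact: bmeas_expocc].
apply: Ex_ext => t; have [J0|J0] := eqVneq (Jis n x t) 0; first by rewrite J0 !mul0r mulr0.
by rewrite (Jis_neq0 J0 (leqnn n)); ring.
Qed.

Lemma Ex_J0 (f : V -> R) : Ex P (fun t => f (J 0%N t)) = f v0.
Proof.
rewrite (Ex_paths 0 (bmeas_Jfun 0 f)).
have one x : (0 : R) <= (fun _ : V => 0) x by [].
transitivity (\sum_(z : {ffun 'I_1 -> V}) f (z ord0) * (z ord0 == v0)%:R).
  apply: eq_bigr => z _; have := Jis_expocc (fpath z) one (leq0n 1).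
  rewrite /path_wt !big_ord0 !mulr1 (_ : fpath z 0%N = z ord0); last first.
    by rewrite /fpath; congr (z _); apply/val_inj; rewrite /= inordK.
  move=> <-; rewrite -ExZ; last by apply/bmeas_L1/bmeasM; [exact: bmeas_Jis|exact: bmeas_expocc].
  apply: Ex_ext => t; rewrite /expocc big_ord0 mulr1.
  have [J0|J0] := eqVneq (Jis 0 (fpath z) t) 0; first by rewrite J0 mul0r mulr0.
  rewrite (Jis_neq0 J0 (leqnn 0)) mulrC (_ : fpath z 0%N = z ord0)//.
  by rewrite /fpath; congr (z _); apply/val_inj; rewrite /= inordK.
rewrite (bigD1 [ffun=> v0])//= ffunE eqxx mulr1 big1 ?addr0// => z zN.
case: eqP; rewrite ?mulr0// => e; case/eqP: zN.
by apply/ffunP => i; rewrite ffunE ord1.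
Qed.

Lemma Ex_hold_gt0 n : Ex P (fun t => (0 < S n t)%R%:R) = 1.
Proof.
have bg : bmeas (fun t => (0 < S n t)%R%:R : R) by apply: bmeas_gt_ind => //; exact: measurable_cst.
rewrite -[RHS](Ex_cst P) (@Ex_paths n)// [RHS](@Ex_paths n _ (bmeas_cst _ 1)).
apply: eq_bigr => z _; pose al (i : nat) : R := 0.
have al0 i : 0 <= al i by [].
have h1 := walk_PF n (fpath z) n (fun=> 0) al0.
have h2 := walk_PF n (fpath z) n.+1 (fun=> 0) al0.
transitivity (path_wt n (fpath z)).
  etransitivity; first last.
    etransitivity; first exact: h1.
    rewrite big1 ?mulr1// => i _; rewrite addr0 invr1 maxxx oppr0 expR0.
    by case: ifP.
  apply: Ex_ext => t; congr (_ * _); rewrite big_ord_recr/= ltnn big1 ?mul1r// => i _.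
  by rewrite ltn_ord mul0r oppr0 expR0.
rewrite -[LHS]mulr1; etransitivity; last first.
  etransitivity; last first.
    apply: Ex_ext => t; rewrite (_ : 1 = \prod_(i < n.+1)
     (if (i < n.+1)%N then expR (- (al i * Num.max (S i t) 0)) else (0 < S i t)%R%:R)); first by [].
    by rewrite big1// => i _; rewrite ltn_ord mul0r oppr0 expR0.
  exact: esym h2.
by rewrite big1// => i _; rewrite ltn_ord addr0 invr1.
Qed.
End Walk.

Section Walk2.
Context {R : realType} (V : finType) (c : V -> V -> R).
Context d (T : measurableType d) (P : probability T R) (v0 : V).
Variables (J : nat -> T -> V) (S : nat -> T -> R).
Hypothesis crw : is_crw c v0 P J S.
Hypothesis net : network c.
Hypothesis cvp : forall x, 0 < cv c x.

Lemma walk_lap (al f : V -> R) n : (forall x, 0 <= al x) ->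
  Ex P (fun t => expocc J S al n.+1 t * f (J n.+1 t)) =
  Ex P (fun t => expocc J S al n t *
    (f (J n t) - (lap c f (J n t) + al (J n t) * cv c (J n t) * f (J n t)) /
       (cv c (J n t) * (1 + al (J n t))))).
Proof.
move=> al0; rewrite (walk_step crw n (fun _ => f) al0); apply: Ex_ext => t.
congr (_ * _); set x := J n t.
have cx := cvp x; have a0 : 0 < 1 + al x by rewrite ltr_wpDr.
have E : \sum_y c x y * f y = cv c x * f x - lap c f x.
  by rewrite /cv /lap mulr_suml -sumrB; apply: eq_bigr => y _; ring.
transitivity ((\sum_y c x y * f y) / (cv c x * (1 + al x))).
  by rewrite mulr_suml; apply: eq_bigr => y _; field; rewrite !gt_eqF.
by rewrite E; field; rewrite !gt_eqF.
Qed.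

Definition alq (q : R) (Lam : V -> R) (x : V) : R := (Lam x + q * (x == v0)%:R) / cv c x.

Lemma alq_ge0 q Lam x : 0 <= q -> (forall x, 0 <= Lam x) -> 0 <= alq q Lam x.
Proof. by move=> q0 L0; rewrite divr_ge0 ?(ltW (cvp _))// addr_ge0// mulr_ge0. Qed.

(* The local time at the [n]-th jump.  Holding times are truncated at [0] so that
   bounds hold surely; they are positive only almost surely. *)
Definition occ (n : nat) (x : V) (t : T) : R :=
  (\sum_(i < n) (J i t == x)%:R * Num.max (S i t) 0) / cv c x.

Lemma expocc_alq q Lam n t :
  expocc J S (alq q Lam) n t = expR (- (q * occ n v0 t)) * expR (- \sum_x Lam x * occ n x t).
Proof.
rewrite /expocc -expR_sum -expRD -opprD; congr expR; rewrite sumrN; congr (- _).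
transitivity (\sum_x (Lam x + q * (x == v0)%:R) * occ n x t).
  rewrite /occ; under [RHS]eq_bigr do rewrite mulr_suml mulr_sumr.
  rewrite exchange_big/=; apply: eq_bigr => i _.
  rewrite (bigD1 (J i t))//= eqxx mul1r big1 ?addr0; first by rewrite /alq; ring.
  by move=> y; rewrite eq_sym => /negbTE ->; rewrite !(mul0r, mulr0).
under eq_bigr do rewrite mulrDl.
rewrite big_split/= addrC; congr (_ + _).
rewrite (bigD1 v0)//= eqxx mulr1 big1 ?addr0// => y /negbTE ->.
by rewrite mulr0 mul0r.
Qed.

Lemma occ_ge0 n x t : 0 <= occ n x t.
Proof.
rewrite divr_ge0 ?(ltW (cvp _))// sumr_ge0// => i _.
by rewrite mulr_ge0// le_max lexx orbT.
Qed.

Lemma occ_le m n x t : (m <= n)%N -> occ m x t <= occ n x t.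
Proof.
move=> mn; rewrite ler_pM2r ?invr_gt0//.
rewrite -!(big_mkord xpredT (fun i => (J i t == x)%:R * Num.max (S i t) 0)).
rewrite (big_cat_nat _ mn)//= lerDl sumr_ge0// => i _.
by rewrite mulr_ge0// le_max lexx orbT.
Qed.

Lemma occS n x t : occ n.+1 x t = occ n x t + (J n t == x)%:R * Num.max (S n t) 0 / cv c x.
Proof. by rewrite /occ big_ord_recr/= mulrDl. Qed.

Lemma measurable_occ n x : measurable_fun setT (occ n x).
Proof.
apply: measurable_funM => //; apply: measurable_sum => i.
apply: measurable_funM; first by have [] := bmeas_Jeq crw i x.
by apply: measurable_maxr => //; case: crw.
Qed.

(* The conditional probability that the local time at [v0] passes an independent
   Exp([q]) level during the [n]-th holding time. *)
Definition lwt (q : R) (n : nat) (t : T) : R :=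
  expR (- (q * occ n v0 t)) - expR (- (q * occ n.+1 v0 t)).

Lemma lwt_ge0 q n t : 0 <= q -> 0 <= lwt q n t.
Proof. by move=> q0; rewrite subr_ge0 ler_expR lerN2 ler_wpM2l// occ_le. Qed.

Lemma sum_lwt q n t : \sum_(i < n) lwt q i t = 1 - expR (- (q * occ n v0 t)).
Proof.
elim: n => [|n IH]; first by rewrite big_ord0 /occ big_ord0 mul0r mulr0 oppr0 expR0 subrr.
by rewrite big_ord_recr/= IH /lwt; ring.
Qed.

Lemma bmeas_expocc_q q n : 0 <= q -> bmeas (fun t => expR (- (q * occ n v0 t))).
Proof.
move=> q0; apply: bmeas_expN => [|t]; last by rewrite mulr_ge0// occ_ge0.
by apply: measurable_funM => //; exact: measurable_occ.
Qed.

Lemma bmeas_lwt q n : 0 <= q -> bmeas (lwt q n).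
Proof. by move=> q0; apply: bmeasD; [|apply: bmeasN]; exact: bmeas_expocc_q. Qed.

(* [f (J n)] times [expocc] decreases in mean only at visits to [v0], because [f] is
   harmonic for the killed walk away from [v0]. *)
Lemma walk_weight (q : R) (Lam f : V -> R) (kap : R) (n : nat) :
  0 < q -> 0 <= kap -> (forall x, 0 <= Lam x) -> Lam v0 = 0 -> f v0 = 1 ->
  (forall x, lap c f x + Lam x * f x = kap * (x == v0)%:R) ->
  Ex P (fun t => lwt q n t * expR (- \sum_x Lam x * occ n x t)) =
  q / (q + kap) * (Ex P (fun t => expocc J S (alq q Lam) n t * f (J n t)) -
                   Ex P (fun t => expocc J S (alq q Lam) n.+1 t * f (J n.+1 t))).
Proof.
move=> q0 k0 L0 Lv0 fv0 hf; set al := alq q Lam.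
have al0 x : 0 <= al x by apply: alq_ge0 => //; exact: ltW.
have alv : 1 + al v0 = (cv c v0 + q) / cv c v0.
  by rewrite /al /alq Lv0 add0r eqxx mulr1; field; rewrite gt_eqF.
have be n' := bmeas_expocc crw n' al0.
pose D n' := Ex P (fun t => expocc J S al n' t * (J n t == v0)%:R).
have LD n' : L1 P (fun t => expocc J S al n' t * (J n t == v0)%:R).
  by apply/bmeas_L1/bmeasM => //; exact: (bmeas_Jeq crw).
have cq : 0 < cv c v0 + q by rewrite addr_gt0.
pose D' := Ex P (fun t => expocc J S al n.+1 t * (J n t == v0)%:R).
have e1 : D' = (cv c v0 / (cv c v0 + q)) * D n.
  rewrite /D' /D (walk_step crw n (fun x _ => (x == v0)%:R) al0) -ExZ//.
  apply: Ex_ext => t; rewrite mulrCA; congr (_ * _).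
  rewrite -!mulr_suml; case: eqP => [->|_]; last by rewrite !mulr0.
  rewrite !mulr1 alv -/(cv c v0); field.
  by rewrite !gt_eqF.
have e2 : Ex P (fun t => expocc J S al n t * f (J n t)) -
          Ex P (fun t => expocc J S al n.+1 t * f (J n.+1 t)) = (q + kap) / (cv c v0 + q) * D n.
  rewrite walk_lap// -ExB; first last.
  - apply/bmeas_L1/bmeasM => //.
    exact: (bmeas_Jfun crw n (fun x => f x - (lap c f x + al x * cv c x * f x) / (cv c x * (1 + al x)))).
  - by apply/bmeas_L1/bmeasM => //; exact: (bmeas_Jfun crw).
  rewrite -ExZ//; apply: Ex_ext => t; rewrite -mulrBr mulrCA; congr (_ * _).
  rewrite subKr; have -> : al (J n t) * cv c (J n t) = Lam (J n t) + q * (J n t == v0)%:R.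
    by rewrite /al /alq divfK// gt_eqF.
  rewrite [(Lam _ + _) * _]mulrDl addrA hf; case: eqP => [->|_]; last by rewrite !(mulr0, mul0r) addr0 mul0r.
  rewrite fv0 !mulr1 alv addrC; field.
  by rewrite !gt_eqF.
rewrite e2 mulrA (_ : q / (q + kap) * ((q + kap) / (cv c v0 + q)) = 1 - cv c v0 / (cv c v0 + q)); last first.
  by field; rewrite !gt_eqF// ltr_pwDl.
rewrite mulrBl mul1r -e1 /D /D' -ExB//.
apply: Ex_ext => t.
rewrite /lwt !expocc_alq occS; case: eqP => [Jv|_]; last first.
  by rewrite mul0r mul0r addr0 subrr mul0r !mulr0 subrr.
rewrite !mulr1 mulrBl; congr (_ - _ * expR _); congr (- _); apply: eq_bigr => x _.
have [->|xv] := eqVneq x v0; first by rewrite Lv0 !mul0r.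
by rewrite occS Jv eq_sym (negbTE xv) !mul0r addr0.
Qed.

Lemma walk_weight_sum (q : R) (Lam f : V -> R) (kap : R) (M : nat) :
  0 < q -> 0 <= kap -> (forall x, 0 <= Lam x) -> Lam v0 = 0 -> f v0 = 1 ->
  (forall x, lap c f x + Lam x * f x = kap * (x == v0)%:R) ->
  \sum_(n < M) Ex P (fun t => lwt q n t * expR (- \sum_x Lam x * occ n x t)) =
  q / (q + kap) * (1 - Ex P (fun t => expocc J S (alq q Lam) M t * f (J M t))).
Proof.
move=> q0 k0 L0 Lv0 fv0 hf; elim: M => [|M IH].
  rewrite big_ord0; have -> : Ex P (fun t => expocc J S (alq q Lam) 0 t * f (J 0%N t)) = 1.
    by rewrite -fv0 -(Ex_J0 crw f); apply: Ex_ext => t; rewrite /expocc big_ord0 mul1r.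
  by rewrite subrr mulr0.
by rewrite big_ord_recr/= IH (walk_weight M q0 k0 L0 Lv0 fv0 hf); ring.
Qed.

(* A positive supersolution [h] of the walk killed at [v0] bounds the expected total
   weight of the killed walk. *)
Lemma expocc_q_decay (q : R) : 0 < q ->
  exists C : R, forall M, Ex P (fun t => expR (- (q * occ M v0 t))) * M%:R <= C.
Proof.
move=> q0; have [g hg] := green_exists net v0.
pose k0 : R := #|V|%:R / q + \sum_y \sum_x `|g y x|.
pose h0 x := \sum_(y | y != v0) g y x.
pose h x := 1 * h0 x + 1 * k0.
have lh0 x : lap c h0 x = \sum_(y | y != v0) ((x == y)%:R - (x == v0)%:R).
  under [RHS]eq_bigr => y _ do rewrite -(proj2 (hg y)).
  rewrite /lap/= exchange_big/=; apply: eq_bigr => z _.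
  by rewrite /h0 -sumrB mulr_sumr.
have lh x : lap c h x = lap c h0 x.
  rewrite (lapD c h0 (fun=> k0)) mul1r [X in _ + _ * X]big1 ?mulr0 ?addr0// => y _.
  by rewrite subrr mulr0.
have hge x : 0 <= h x.
  rewrite /h !mul1r /k0 addrCA addr_ge0//; first by rewrite divr_ge0// ltW.
  rewrite /h0 big_mkcond -big_split/= sumr_ge0// => y _.
  rewrite (bigD1 x)//= addrA addr_ge0//; last by rewrite sumr_ge0.
  case: ifP => _; last by rewrite add0r.
  by rewrite -(subrr (g y x)) lerD2l -normrN ler_norm.
have hv0 : #|V|%:R <= q * h v0.
  rewrite /h /h0 big1 ?mulr0 ?add0r ?mul1r; last by move=> y _; case: (hg y).
  rewrite -ler_pdivrMl// mulrC lerDl sumr_ge0// => y _.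
  by rewrite sumr_ge0.
pose al := alq q (fun=> 0).
have al0 x : 0 <= al x by apply: alq_ge0 => //; exact: ltW.
have alE x : al x * cv c x = q * (x == v0)%:R by rewrite /al /alq add0r divfK// gt_eqF.
have ge1 x : 1 <= lap c h x + al x * cv c x * h x.
  rewrite alE lh lh0; have [->|xv] := eqVneq x v0.
    rewrite mulr1 (eq_bigr (fun=> -1 : R)); last first.
      by move=> y yv; rewrite eq_sym (negbTE yv) sub0r.
    rewrite sumr_const mulNrn.
    have -> : #|[pred y | y != v0]| = #|V|.-1 by rewrite -(cardC1 v0); apply: eq_card.
    have V0 : (0 < #|V|)%N by apply/card_gt0P; exists v0.
    have : (#|V|.-1)%:R + 1 = #|V|%:R :> R by rewrite natr1 prednK.
    by move: hv0; lra.
  rewrite mulr0 mul0r addr0 (bigD1 x)//= eqxx subr0 big1 ?addr0// => y /andP[_ yx].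
  by rewrite eq_sym (negbTE yx) subr0.
pose K := \sum_x cv c x + q.
have Kp : 0 < K by rewrite ltr_wpDl// sumr_ge0// => x _; exact: ltW.
have Kge x : cv c x * (1 + al x) <= K.
  rewrite mulrDr mulr1 [cv c x * _]mulrC alE lerD//.
    by rewrite (bigD1 x)//= lerDl sumr_ge0// => y _; exact: ltW.
  by case: eqP => _; rewrite ?mulr1 ?mulr0// ltW.
have eE n t : expocc J S al n t = expR (- (q * occ n v0 t)).
  by rewrite expocc_alq [X in _ * expR (- X)]big1 ?oppr0 ?expR0 ?mulr1// => x _; rewrite mul0r.
pose b n := Ex P (fun t => expocc J S al n t * h (J n t)).
pose a n := Ex P (fun t => expR (- (q * occ n v0 t))).
have be n := bmeas_expocc crw n al0.
have step n : a n <= K * (b n - b n.+1).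
  rewrite /b walk_lap// -ExB; first last.
  - apply/bmeas_L1/bmeasM => //.
    exact: (bmeas_Jfun crw n (fun x => h x - (lap c h x + al x * cv c x * h x) / (cv c x * (1 + al x)))).
  - by apply/bmeas_L1/bmeasM => //; exact: (bmeas_Jfun crw).
  rewrite -ExZ; last first.
    apply/L1B; apply/bmeas_L1/bmeasM => //; first exact: (bmeas_Jfun crw).
    exact: (bmeas_Jfun crw n (fun x => h x - (lap c h x + al x * cv c x * h x) / (cv c x * (1 + al x)))).
  apply: Ex_le.
  - by apply/bmeas_L1/bmeas_expocc_q/ltW.
  - apply/L1Z/L1B; apply/bmeas_L1/bmeasM => //; first exact: (bmeas_Jfun crw).
    exact: (bmeas_Jfun crw n (fun x => h x - (lap c h x + al x * cv c x * h x) / (cv c x * (1 + al x)))).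
  move=> t; rewrite -mulrBr subKr -eE mulrCA ler_peMr//.
    by rewrite eE expR_ge0.
  set x := J n t; have p : 0 < cv c x * (1 + al x) by rewrite mulr_gt0// ltr_wpDr.
  rewrite mulrA ler_pdivlMr// mul1r (le_trans (Kge x))// ler_peMr// ltW//.
have sumb M : \sum_(n < M) a n <= K * (b 0%N - b M).
  elim: M => [|M IH]; first by rewrite big_ord0 subrr mulr0.
  rewrite big_ord_recr/= (le_trans (lerD IH (step M)))//.
  by rewrite -mulrDr addrA subrK.
exists (K * b 0%N) => M; apply: le_trans (_ : \sum_(n < M) a n <= _).
  rewrite -/(a M) mulr_natr -[X in _ *+ X](card_ord M) -sumr_const ler_sum// => n _.
  apply: Ex_le => [||t]; [exact/bmeas_L1/bmeas_expocc_q/ltW|exact/bmeas_L1/bmeas_expocc_q/ltW|].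
  by rewrite ler_expR lerN2 ler_wpM2l ?(ltW q0)// occ_le// ltnW.
rewrite (le_trans (sumb M))// (ler_wpM2l (ltW Kp))// lerBlDr lerDl.
by apply: Ex_ge0 => t; rewrite mulr_ge0// eE expR_ge0.
Qed.

Lemma natinv_cvg0 (C : R) (u : nat -> R) : (forall n, 0 <= u n) -> (forall n, u n * n%:R <= C) ->
  u n @[n --> \oo] --> (0 : R).
Proof.
move=> u0 uC; rewrite -(cvg_shiftS u).
apply: (@squeeze_cvgr _ _ _ _ (fun=> 0) (fun n => C * n.+1%:R^-1)).
- by apply: nearW => n; rewrite u0/= ler_pdivlMr ?uC// ltr0n.
- exact: cvg_cst.
- rewrite -[X in _ --> X](mulr0 C); apply: cvgM; first exact: cvg_cst.
  exact: cvg_harmonic.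
Qed.

Lemma walk_laplace_cvg (q : R) (Lam f : V -> R) (kap : R) :
  0 < q -> 0 <= kap -> (forall x, 0 <= Lam x) -> Lam v0 = 0 -> f v0 = 1 ->
  (forall x, lap c f x + Lam x * f x = kap * (x == v0)%:R) ->
  (\sum_(n < M) Ex P (fun t => lwt q n t * expR (- \sum_x Lam x * occ n x t))) @[M --> \oo]
    --> q / (q + kap).
Proof.
move=> q0 k0 L0 Lv0 fv0 hf; have [C hC] := expocc_q_decay q0.
rewrite (funext (fun M => walk_weight_sum M q0 k0 L0 Lv0 fv0 hf)).
rewrite -[X in _ --> X]mulr1; apply: cvgM; first exact: cvg_cst.
rewrite -[X in _ --> X]subr0; apply: cvgB; first exact: cvg_cst.
pose F := \sum_x `|f x|.
have al0 x : 0 <= alq q Lam x by apply: alq_ge0 => //; exact: ltW.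
have be n := bmeas_expocc crw n al0.
apply/norm_cvg0P; apply: (@natinv_cvg0 (F * C)) => // n.
rewrite -[F * _]mulrC; apply: le_trans (_ : Ex P (fun t => expR (- (q * occ n v0 t))) * n%:R * F <= _).
  rewrite -mulrA mulrCA mulrC ler_wpM2l// mulrC -ExZ; last exact/bmeas_L1/bmeas_expocc_q/ltW.
  have LE : L1 P (fun t => expocc J S (alq q Lam) n t * f (J n t)).
    by apply/bmeas_L1/bmeasM => //; exact: (bmeas_Jfun crw).
  apply: le_trans (Ex_norm LE) _; apply: Ex_le.
  - exact: L1_norm.
  - exact/L1Z/bmeas_L1/bmeas_expocc_q/ltW.
  move=> t; rewrite normrM mulrC ler_pM//; first by rewrite /F (bigD1 (J n t))//= lerDl sumr_ge0.
  rewrite expocc_alq ger0_norm ?mulr_ge0 ?expR_ge0// ler_piMr ?expR_ge0//.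
  by rewrite expR_le1 oppr_le0 sumr_ge0// => x _; rewrite mulr_ge0// occ_ge0.
by rewrite ler_wpM2r// sumr_ge0.
Qed.

Lemma Ex_exp_time n : Ex P (fun t => expR (- \sum_(i < n) Num.max (S i t) 0)) = 2^-1 ^+ n.
Proof.
have E n' t : expocc J S (fun=> 1) n' t = expR (- \sum_(i < n') Num.max (S i t) 0).
  by rewrite /expocc -expR_sum sumrN; congr (expR (- _)); apply: eq_bigr => i _; rewrite mul1r.
have al0 (x : V) : (0 : R) <= (fun _ : V => 1) x by [].
elim: n => [|n IH].
  by rewrite expr0 -[RHS](Ex_cst P); apply: Ex_ext => t; rewrite big_ord0 oppr0 expR0.
rewrite exprS -IH; have := walk_step crw n (fun _ _ => 1) al0.
rewrite (Ex_ext P (g := fun t => expR (- \sum_(i < n.+1) Num.max (S i t) 0))); last first.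
  by move=> t; rewrite mulr1 E.
move=> ->; rewrite -ExZ; last first.
  apply/bmeas_L1; have := bmeas_expocc crw n al0; congr bmeas.
  by apply/funext => t; rewrite E.
apply: Ex_ext => t; rewrite E mulrC; congr (_ * _).
under eq_bigr do rewrite mulr1.
rewrite -!mulr_suml divff; last by rewrite gt_eqF//; exact: cvp.
by rewrite mul1r; congr (_^-1); rewrite -natr1.
Qed.

Definition good : set T := [set t | forall n, 0 < S n t].

Lemma measurable_good : measurable good.
Proof.
have -> : good = \bigcap_n [set t | 0 < S n t].
  by apply/seteqP; split => t h n; [move=> _; exact: h|exact: (h n I)].
by apply: bigcap_measurable => // n _; apply: measurable_gt_set; case: crw.
Qed.

Lemma P_good (A : set T) : measurable A -> P (A `&` good) = P A.
Proof.
move=> mA; have mS n : measurable_fun setT (S n) by case: crw.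
have hn n : P (~` [set t | 0 < S n t]) = 0%E.
  have mB := measurable_gt_set 0 (mS n).
  rewrite probability_setC//.
  have := Ex_hold_gt0 crw n; rewrite b2R_indic Ex_indic// => e.
  by rewrite -[P _]fineK ?fin_num_measure// e subee.
have ng : P.-negligible (~` good).
  have -> : ~` good = \bigcup_n ~` [set t | 0 < S n t].
    rewrite -setC_bigcap; congr (~` _).
    by apply/seteqP; split => t h n; [move=> _; exact: h|exact: (h n I)].
  apply: negligible_bigcup => n; exists (~` [set t | 0 < S n t]); split => //; last exact: hn.
  exact/measurableC/measurable_gt_set.
have mG := measurable_good.
rewrite -[in RHS](setIT A) -(setUv good) setIUr measureU0//; [exact: measurableI|exact/measurableI/measurableC|].
apply: measure_negligible; first exact/measurableI/measurableC.
exact: negligibleS ng.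
Qed.

Let mS n : measurable_fun setT (S n). Proof. by case: crw. Qed.
Let mJ n v : measurable [set t | J n t = v]. Proof. by case: crw. Qed.

Lemma measurable_jump_time n : measurable_fun setT (jump_time S n).
Proof. by apply: measurable_sum => i. Qed.

Lemma measurable_local_time v time : measurable_fun setT (local_time c J S v time).
Proof.
apply: emeasurable_funM; last exact: measurable_cst.
have h := @ge0_emeasurable_sum _ T R setT (fun n t => ((J n t == v)%:R *
      Num.max 0 (Num.min time (jump_time S n.+1 t) - Num.min time (jump_time S n t)))%:E) xpredT.
apply: eq_measurable_fun (h _ _) => //.
  by move=> n t _ _; rewrite lee_fin mulr_ge0// le_max lexx.
move=> n _; apply/measurable_EFinP; apply: measurable_funM; first by have [] := bmeas_Jeq crw n v.
apply: measurable_maxr; first exact: measurable_cst.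
by apply: measurable_funB; apply: measurable_minr; try exact: measurable_cst; exact: measurable_jump_time.
Qed.

Lemma measurable_blanket time : measurable (blanket_event c J S time).
Proof.
have -> : blanket_event c J S time = \big[setI/setT]_(u : V) \big[setI/setT]_(v : V)
   [set t | (local_time c J S u time t <= 2%:E * local_time c J S v time t)%E].
  rewrite -bigcap_seq; apply/seteqP; split => t.
    by move=> h u _; rewrite -bigcap_seq => v _; exact: h.
  move=> h u v; have := h u (mem_index_enum _); rewrite -bigcap_seq; apply.
  exact: mem_index_enum.
apply: bigsetI_measurable => u _; apply: bigsetI_measurable => v _.
have h := @measurable_lee _ T R setT measurableT (local_time c J S u time)
  (fun t => 2%:E * local_time c J S v time t)%E.
rewrite -[X in measurable X]setTI; apply: h; first exact: measurable_local_time.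
by apply: emeasurable_funM; [exact: measurable_cst|exact: measurable_local_time].
Qed.

Section Pathwise.
Variables (t : T) (T0 : R) (M : nat).
Hypotheses (gt : good t) (T0p : 0 <= T0) (TM : T0 < jump_time S M t).

Let jS n : jump_time S n.+1 t = jump_time S n t + S n t.
Proof. by rewrite /jump_time big_ord_recr. Qed.

Let jmono m n : (m <= n)%N -> jump_time S m t <= jump_time S n t.
Proof.
elim: n => [|n IH]; first by rewrite leqn0 => /eqP ->.
rewrite leq_eqVlt => /predU1P[->//|]; rewrite ltnS => /IH h.
by rewrite jS (le_trans h)// lerDl ltW.
Qed.

Let find_m : exists2 m, (m < M)%N & jump_time S m t <= T0 < jump_time S m.+1 t.
Proof.
elim: M TM => [|m IH]; first by rewrite /jump_time big_ord0 ltNge T0p.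
have [h _|h hm] := ltP T0 (jump_time S m t).
  by have [k km hk] := IH h; exists k => //; rewrite ltnS ltnW.
by exists m => //; rewrite h.
Qed.

Let occE n v : occ n v t * cv c v = \sum_(i < n) (J i t == v)%:R * S i t.
Proof.
rewrite /occ divfK ?gt_eqF//; apply: eq_bigr => i _.
by rewrite max_l// ltW.
Qed.

Lemma blanket_path : blanket_event c J S T0 t ->
  exists m, [/\ (m < M)%N, forall u, occ m u t <= 2 * T0 / total_cond c &
    forall u, T0 / (2 * total_cond c) <= occ m.+1 u t].
Proof.
move=> bl; have [m mM /andP[m1 m2]] := find_m; exists m.
pose L v := (occ m v t * cv c v + (J m t == v)%:R * (T0 - jump_time S m t)) / cv c v.
have LE v : local_time c J S v T0 t = (L v)%:E.
  rewrite /local_time /occupation (nneseries_split _ m.+1)/=; last first.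
    by move=> k _; rewrite lee_fin mulr_ge0// le_max lexx.
  rewrite add0n eseries0 ?adde0; last first.
    move=> k mk _; rewrite !min_l ?subrr ?maxxx ?mulr0// ltW// (lt_le_trans m2)// jmono//.
    exact: leqW.
  rewrite sumEFin -EFinM; congr (_ / _)%:E; rewrite big_mkord big_ord_recr/= occE; congr (_ + _ * _).
    apply: eq_bigr => i _; congr (_ * _).
    by rewrite !min_r ?(le_trans (jmono _) m1)//; [rewrite jS addrAC subrr add0r max_r// ltW|exact: ltnW].
  by rewrite min_l ?ltW// min_r// max_r// subr_ge0.
have sumL : \sum_v cv c v * L v = T0.
  under eq_bigr => v _ do rewrite mulrC divfK ?gt_eqF// occE.
  rewrite big_split/= exchange_big/=.
  rewrite (eq_bigr (fun i : 'I_m => S i t)); last first.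
    move=> i _; rewrite (bigD1 (J i t))//= eqxx mul1r big1 ?addr0// => v.
    by rewrite eq_sym => /negbTE ->; rewrite mul0r.
  rewrite -/(jump_time S m t) (bigD1 (J m t))//= eqxx mul1r big1 ?addr0 ?subrKC//.
  by move=> v; rewrite eq_sym => /negbTE ->; rewrite mul0r.
have L2 u v : L u <= 2 * L v by have := bl u v; rewrite !LE -EFinM lee_fin.
have Cp : 0 < total_cond c.
  rewrite /total_cond (bigD1 v0)//= ltr_pwDl// sumr_ge0// => v _; exact: ltW.
split => // u.
  apply: le_trans (_ : L u <= _).
    rewrite ler_pdivlMr// lerDl mulr_ge0// subr_ge0//.
  rewrite ler_pdivlMr// mulrC /total_cond mulr_suml -sumL mulr_sumr ler_sum// => v _.
  by rewrite [2 * _]mulrCA (ler_wpM2l (ltW (cvp v))).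
apply: le_trans (_ : L u <= _).
  rewrite ler_pdivrMr ?mulr_gt0// -[X in X <= _]sumL.
  rewrite /total_cond !mulr_sumr ler_sum// => v _.
  rewrite (_ : L u * _ = cv c v * (2 * L u)); last by ring.
  exact: (ler_wpM2l (ltW (cvp v))).
rewrite occS -[occ m u t](mulfK (lt0r_neq0 (cvp u))) -mulrDl ler_pM2r ?invr_gt0// lerD2l ler_wpM2l//.
by rewrite (max_l (ltW (gt m))) lerBlDr addrC -jS ltW.
Qed.

End Pathwise.

Section Blanket.
Variables (q T0 eps : R) (M : nat).
Hypotheses (q0 : 0 < q) (T0p : 0 <= T0).
Hypothesis hP : (eps%:E < P (blanket_event c J S T0))%E.
Let C := total_cond c.
Let loss : R := expR T0 * 2^-1 ^+ M.
Let B := blanket_event c J S T0 `&` good.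

Let mB : measurable B. Proof. by apply: measurableI; [exact: measurable_blanket|exact: measurable_good]. Qed.

Let Lexp : L1 P (fun t => expR (- \sum_(i < M) Num.max (S i t) 0)).
Proof.
apply/bmeas_L1/bmeas_expN => [|t].
  by apply: measurable_sum => i; exact: measurable_maxr.
by rewrite sumr_ge0// => i _; rewrite le_max lexx orbT.
Qed.

Let LB : L1 P (\1_B : T -> R). Proof. exact/bmeas_L1/bmeas_indic. Qed.

Lemma blanket_lower (k : R) (F : T -> R) : 0 <= k -> L1 P F -> (forall t, 0 <= F t) ->
  (forall t m, (m < M)%N -> (forall u, occ m u t <= 2 * T0 / C) ->
     (forall u, T0 / (2 * C) <= occ m.+1 u t) -> k <= F t) ->
  k * (eps - loss) <= Ex P F.
Proof.
move=> k0 LF F0 hF.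
have h : eps <= Ex P (\1_B : T -> R).
  rewrite Ex_indic// -lee_fin fineK ?fin_num_measure// /B P_good ?ltW//.
  exact: measurable_blanket.
apply: le_trans (_ : k * (Ex P (\1_B : T -> R) - loss) <= _); first by rewrite ler_wpM2l// lerB.
rewrite /loss -Ex_exp_time -ExZ// -ExB//; last exact: L1Z.
rewrite -ExZ; last by apply: L1B => //; exact: L1Z.
apply: Ex_le => //; first by apply/L1Z/L1B => //; exact: L1Z.
move=> t; rewrite indicE; case: (boolP (t \in B)) => [/set_mem[bt gt]|_]; last first.
  rewrite (le_trans _ (F0 t))// mulr_ge0_le0// sub0r oppr_le0 mulr_ge0 ?expR_ge0//.
rewrite -expRD.
have e : \sum_(i < M) Num.max (S i t) 0 = jump_time S M t.
  by apply: eq_bigr => i _; rewrite (max_l (ltW (gt i))).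
rewrite e; have [TM|TM] := ltP T0 (jump_time S M t).
  have [m [mM h1 h2]] := blanket_path gt T0p TM bt.
  rewrite (le_trans _ (hF t m mM h1 h2))// ler_piMr// lerBlDr lerDl expR_ge0//.
rewrite (le_trans _ (F0 t))// mulr_ge0_le0// subr_le0 -[leLHS]expR0 ler_expR subr_ge0//.
Qed.

Lemma blanket_upper_occ (b : R) : 2 * T0 / C <= b ->
  (1 - expR (- (q * (T0 / (2 * C))))) * (eps - loss) <=
  \sum_(n < M) Ex P (fun t => lwt q n t * \prod_u (occ n u t <= b)%R%:R).
Proof.
move=> hb; have C0 : 0 <= C by rewrite /C /total_cond sumr_ge0// => x _; exact: ltW.
have bD n : bmeas (fun t => lwt q n t * \prod_u (occ n u t <= b)%R%:R).
  apply: bmeasM; first exact/bmeas_lwt/ltW.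
  apply: bmeas_prod => u; under eq_fun do rewrite leNgt.
  rewrite b2R_indic; apply: bmeas_indic.
  have -> : [set t | ~~ (b < occ n u t)] = [set t | occ n u t <= b].
    by apply/seteqP; split => t /=; rewrite leNgt.
  exact/measurable_le_set/measurable_occ.
have LD n := bmeas_L1 P (bD n).
have w0 n t : 0 <= lwt q n t * \prod_u (occ n u t <= b)%R%:R.
  by rewrite mulr_ge0 ?lwt_ge0 ?(ltW q0)// prodr_ge0.
rewrite -Ex_sum//; apply: blanket_lower => //.
- by rewrite subr_ge0 expR_le1 oppr_le0 mulr_ge0 ?(ltW q0)// divr_ge0// mulr_ge0.
- exact: L1_sum.
- by move=> t; exact: sumr_ge0.
move=> t m mM h1 h2.
apply: le_trans (_ : \sum_(n < m.+1) lwt q n t <= _).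
  by rewrite sum_lwt lerB// ler_expR lerN2 ler_wpM2l ?(ltW q0).
rewrite -(big_mkord xpredT (fun n => lwt q n t * \prod_u (occ n u t <= b)%R%:R)).
rewrite (big_cat_nat _ mM)//= big_mkord -[leLHS]addr0 lerD//; last exact: sumr_ge0.
apply: ler_sum => n _; rewrite big1 ?mulr1// => u _.
rewrite (le_trans _ hb)// (le_trans _ (h1 u))// occ_le// -ltnS//.
Qed.

Lemma blanket_lower_occ (x : V) : x != v0 ->
  expR (- (q * (2 * T0 / C))) * (eps - loss) - Ex P (fun t => expR (- (q * occ M v0 t))) <=
  \sum_(n < M) Ex P (fun t => lwt q n t * (T0 / (2 * C) <= occ n x t)%R%:R).
Proof.
move=> xv.
have bD n : bmeas (fun t => lwt q n t * (T0 / (2 * C) <= occ n x t)%R%:R).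
  apply: bmeasM; first exact/bmeas_lwt/ltW.
  by rewrite b2R_indic; exact/bmeas_indic/measurable_ge_set/measurable_occ.
have LD n := bmeas_L1 P (bD n).
have Lq := bmeas_L1 P (bmeas_expocc_q M (ltW q0)).
have w0 n t : 0 <= lwt q n t * (T0 / (2 * C) <= occ n x t)%R%:R.
  by rewrite mulr_ge0 ?lwt_ge0 ?(ltW q0).
have LS : L1 P (fun t => \sum_(n < M) lwt q n t * (T0 / (2 * C) <= occ n x t)%R%:R) by exact: L1_sum.
rewrite lerBlDr -Ex_sum// -ExD//; apply: blanket_lower.
- exact: expR_ge0.
- exact: L1D.
- by move=> t; rewrite addr_ge0 ?expR_ge0// sumr_ge0.
move=> t m mM h1 h2.
have sumw : \sum_(m <= n < M) lwt q n t = expR (- (q * occ m v0 t)) - expR (- (q * occ M v0 t)).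
  have := sum_lwt q M t; rewrite -(big_mkord xpredT (fun n => lwt q n t)) (big_cat_nat _ (ltnW mM))//= big_mkord sum_lwt.
  lra.
apply: le_trans (_ : \sum_(m <= n < M) lwt q n t + expR (- (q * occ M v0 t)) <= _).
  by rewrite sumw subrK ler_expR lerN2 ler_wpM2l ?(ltW q0).
rewrite lerD2r -(big_mkord xpredT (fun n => lwt q n t * (T0 / (2 * C) <= occ n x t)%R%:R)).
rewrite [leRHS](big_cat_nat _ (ltnW mM))//= -[leLHS]add0r lerD//; first exact: sumr_ge0.
rewrite big_nat_cond [leRHS]big_nat_cond; apply: ler_sum => n /andP[/andP[mn _] _].
have [nm|nm] := leqP n m; last by rewrite (le_trans (h2 x)) ?mulr1// occ_le.
have {mn nm}-> : n = m by apply/eqP; rewrite eqn_leq nm mn.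
have := h2 x; rewrite /lwt !occS; have [->|_] := eqVneq (J m t) v0.
  by rewrite eq_sym (negbTE xv) !mul0r addr0 => ->; rewrite mulr1.
by rewrite !mul0r addr0 subrr mul0r.
Qed.

End Blanket.
End Walk2.

Section Isomorphism.
Context {R : realType} (V : finType) (c : V -> V -> R).
Context d (T : measurableType d) (P : probability T R) (v0 : V).
Variables (J : nat -> T -> V) (S : nat -> T -> R).
Hypothesis crw : is_crw c v0 P J S.
Hypothesis net : network c.
Hypothesis cvp : forall x, 0 < cv c x.
Context d' (T' : measurableType d') (Q : probability T' R).
Variables (X : V -> T' -> R) (g : V -> V -> R).
Hypothesis g0 : forall y, g y v0 = 0.
Hypothesis gl : forall y x, lap c (g y) x = (x == y)%:R - (x == v0)%:R.
Hypothesis mX : forall x, measurable_fun setT (X x).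
Hypothesis cfX : gauss_cf Q X g.

Let occ := occ c J S.
Let I : finType := {x : V | x != v0}.
(* The same exponential of [L^x + eta_x^2 / 2] (walk side) and of
   [(eta_x + sqrt (2 t'))^2 / 2] (shifted field). *)
Let eL (s : R) (n : nat) (i : I) (z : T * T') : R :=
  expR (- (s ^+ 2 * occ n (val i) z.1)) * gwt X s 0 (val i) z.2.
Let eR (s : R) (i : I) (z : measurableTypeR R * T') : R :=
  gwt X s (Num.sqrt (2 * Num.max z.1 0)) (val i) z.2.

Let bmeas_fst d1 d2 (T1 : measurableType d1) (T2 : measurableType d2) (f : T1 -> R) :
  bmeas f -> bmeas (fun z : T1 * T2 => f z.1).
Proof. by move=> [mf [M hM]]; split; [exact: (measurableT_comp mf)|exists M]. Qed.

Let bmeas_snd d1 d2 (T1 : measurableType d1) (T2 : measurableType d2) (f : T2 -> R) :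
  bmeas f -> bmeas (fun z : T1 * T2 => f z.2).
Proof. by move=> [mf [M hM]]; split; [exact: (measurableT_comp mf)|exists M]. Qed.

Let bgwt s i : bmeas (gwt X s 0 i).
Proof. exact: (bmeas_bump s 0 mX). Qed.

Let bocc s n i : bmeas (fun t => expR (- (s ^+ 2 * occ n i t))).
Proof.
apply: bmeas_expN => [|t]; last by rewrite mulr_ge0 ?sqr_ge0// occ_ge0.
by apply: measurable_funM => //; exact: (measurable_occ crw).
Qed.

Let beL s n i : bmeas (eL s n i).
Proof. exact: (bmeasM (@bmeas_fst _ _ T T' _ (bocc s n (val i))) (@bmeas_snd _ _ T T' _ (bgwt s (val i)))). Qed.

Let beR s i : bmeas (eR s i).
Proof.
apply: bmeas_expN => [|z]; last by rewrite divr_ge0// mulr_ge0 ?sqr_ge0.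
apply: measurable_funM => //; apply: measurable_funM => //.
apply: measurable_funX; apply: measurable_funD; first exact: (measurableT_comp (mX _)).
have ms : measurable_fun setT (fun y : measurableTypeR R => Num.sqrt (2 * Num.max y 0)).
  have m1 : measurable_fun setT (fun y : measurableTypeR R => 2 * Num.max y 0 : measurableTypeR R).
    by apply: measurable_funM => //; exact: measurable_maxr.
  exact: (measurableT_comp (continuous_measurable_fun (@sqrt_continuous R)) m1).
exact: (measurableT_comp ms).
Qed.

Lemma Ex_prod_mul (f1 : T -> R) (f2 : T' -> R) : bmeas f1 -> bmeas f2 ->
  Ex (prodP P Q) (fun z => f1 z.1 * f2 z.2) = Ex P f1 * Ex Q f2.
Proof.
move=> b1 b2; rewrite Ex_prodP; last by apply: bmeasM; [exact: bmeas_fst|exact: bmeas_snd].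
rewrite mulrC -ExZ; last exact: bmeas_L1.
apply: Ex_ext => t; transitivity (f1 t * Ex Q f2); last exact: mulrC.
exact: (ExZ (f1 t) (bmeas_L1 Q b2)).
Qed.

Lemma moment_limit (s q : R) (q0 : 0 < q) (l : seq I) : 0 < s ->
  (\sum_(n < M) Ex (prodP P Q) (fun z => lwt c v0 J S q n z.1 * \prod_(i <- l) eL s n i z)) @[M --> \oo]
  --> Ex (prodP (expP q0) Q) (fun z => 1 * \prod_(i <- l) eR s i z).
Proof.
move=> s0; pose l' := map val l.
have gsym := green_sym net g0 gl; have gpsd := green_psd net g0 gl.
have lv0 : v0 \notin l' by apply/mapP => -[i _ e]; have := valP i; rewrite -e eqxx.
have [kap [f [k0 f0 hf E]]] := gauss_laplace g0 gl gsym gpsd mX cfX s0 lv0.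
pose Lam x : R := s ^+ 2 * (count_mem x l')%:R.
have L0 x : 0 <= Lam x by rewrite mulr_ge0// sqr_ge0.
have Lv : Lam v0 = 0 by rewrite /Lam (count_memPn lv0) mulr0.
have occE n t : \prod_(i <- l) expR (- (s ^+ 2 * occ n (val i) t)) = expR (- \sum_x Lam x * occ n x t).
  rewrite -expR_sum sumrN -(big_map val xpredT (fun x => s ^+ 2 * occ n x t)) -/l'.
  congr (expR (- _)); elim: l' {lv0 E Lv hf L0} @Lam => [|x r IH] Lam.
    by rewrite big_nil big1// => y _; rewrite /Lam mulr0 mul0r.
  rewrite big_cons IH /Lam /= [RHS](eq_bigr (fun y => (y == x)%:R * (s ^+ 2 * occ n y t) +
    s ^+ 2 * (count_mem y r)%:R * occ n y t)); last by move=> y _; rewrite eq_sym natrD; ring.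
  rewrite big_split/=; congr (_ + _); rewrite (bigD1 x)//= eqxx mul1r big1 ?addr0// => y /negbTE ->.
  by rewrite mul0r.
pose G := Ex Q (fun t => \prod_(i <- l') gwt X s 0 i t).
have lhs M : \sum_(n < M) Ex (prodP P Q) (fun z => lwt c v0 J S q n z.1 * \prod_(i <- l) eL s n i z) =
   (\sum_(n < M) Ex P (fun t => lwt c v0 J S q n t * expR (- \sum_x Lam x * occ n x t))) * G.
  rewrite mulr_suml; apply: eq_bigr => n _; rewrite -Ex_prod_mul.
  - apply: Ex_ext => z; rewrite -occE -mulrA; congr (_ * _).
    by rewrite big_split/= big_map.
  - apply: bmeasM; first exact/(bmeas_lwt crw cvp)/ltW.
    rewrite -(funext (occE n)); apply: bmeas_prod => i; exact: bocc.
  - by apply: bmeas_prod => i; exact: bgwt.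
rewrite (funext lhs).
have -> : Ex (prodP (expP q0) Q) (fun z => 1 * \prod_(i <- l) eR s i z) = q / (q + kap) * G.
  rewrite Ex_prodP; last by apply: bmeasM; [exact: bmeas_cst|exact: bmeas_prod].
  rewrite -(Ex_expP_expR q0 k0) mulrC -ExZ; last first.
    apply/bmeas_L1/bmeas_expN; first by apply: measurable_funM => //; exact: measurable_maxr.
    by move=> y; rewrite mulr_ge0// le_max lexx orbT.
  apply: Ex_ext => y /=; rewrite mulrC -/G.
  have := E (Num.sqrt (2 * Num.max y 0)); rewrite sqr_sqrtr; last by rewrite mulr_ge0// le_max lexx orbT.
  rewrite [2 * _ * kap / 2](_ : _ = kap * Num.max y 0); last by field.
  by move=> <-; apply: Ex_ext => t; rewrite mul1r big_map.
apply: cvgM; last exact: cvg_cst.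
exact: (walk_laplace_cvg crw net cvp q0 k0 L0 Lv f0 hf).
Qed.

Lemma threshold_limit (s q : R) (q0 : 0 < q) (N : nat) : 0 < s ->
  (\sum_(n < M) Ex (prodP P Q) (fun z => lwt c v0 J S q n z.1 * \prod_i (thr N).[eL s n i z])) @[M --> \oo]
  --> Ex (prodP (expP q0) Q) (fun z => \prod_i (thr N).[eR s i z]).
Proof.
move=> s0.
have bw n : bmeas (fun z : T * T' => lwt c v0 J S q n z.1).
  exact/bmeas_fst/(bmeas_lwt crw cvp)/ltW.
have E1 n : Ex (prodP P Q) (fun z => lwt c v0 J S q n z.1 * \prod_i (thr N).[eL s n i z]) =
  pext (fun l => Ex (prodP P Q) (fun z => lwt c v0 J S q n z.1 * \prod_(i <- l) eL s n i z)) (thr N) (index_enum I) [::].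
  have := pextE (prodP P Q) (thr N) (index_enum I) [::] (bw n) (beL s n).
  by move=> <-; apply: Ex_ext => z; rewrite big_nil mulr1.
have E2 : Ex (prodP (expP q0) Q) (fun z => \prod_i (thr N).[eR s i z]) =
  pext (fun l => Ex (prodP (expP q0) Q) (fun z => 1 * \prod_(i <- l) eR s i z)) (thr N) (index_enum I) [::].
  have := pextE (prodP (expP q0) Q) (thr N) (index_enum I) [::] (bmeas_cst _ 1) (beR s).
  by move=> <-; apply: Ex_ext => z; rewrite big_nil mulr1 mul1r.
rewrite E2.
have E3 M : \sum_(n < M) Ex (prodP P Q) (fun z => lwt c v0 J S q n z.1 * \prod_i (thr N).[eL s n i z]) =
  pext (fun l => \sum_(n < M) Ex (prodP P Q) (fun z => lwt c v0 J S q n z.1 * \prod_(i <- l) eL s n i z)) (thr N) (index_enum I) [::].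
  by rewrite pext_sum; apply: eq_bigr => n _; exact: E1.
rewrite (funext E3).
by apply: pext_cvg => l; exact: moment_limit.
Qed.

Hypothesis X0 : forall t, X v0 t = 0.
Variables (q T0 eps y0 : R).
Hypotheses (q0 : 0 < q) (T0p : 0 <= T0) (eps0 : 0 < eps).
Hypothesis hP : (eps%:E < P (blanket_event c J S T0))%E.
Let C := total_cond c.
Let C0 : 0 <= C. Proof. by rewrite /C /total_cond sumr_ge0// => x _; exact: ltW. Qed.
Let bnd : T' -> R := fun t => \prod_u (`|X u t| <= y0)%R%:R.

Let bb : bmeas bnd.
Proof.
apply: bmeas_prod => u; rewrite b2R_indic; apply: bmeas_indic; apply: measurable_le_set.
exact: (measurableT_comp _ (mX u)).
Qed.

Let bocl n : bmeas (fun t => lwt c v0 J S q n t * \prod_u (occ n u t <= 2 * T0 / C)%R%:R).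
Proof.
apply: bmeasM; first exact/(bmeas_lwt crw cvp)/ltW.
apply: bmeas_prod => u; rewrite b2R_indic; apply: bmeas_indic; apply: measurable_le_set.
exact: (measurable_occ crw).
Qed.

Let eL01 s n i z : 0 <= eL s n i z <= 1.
Proof.
rewrite mulr_ge0 ?expR_ge0//= mulr_ile1 ?expR_ge0// expR_le1 oppr_le0.
  by rewrite mulr_ge0 ?sqr_ge0// occ_ge0.
by rewrite divr_ge0// mulr_ge0 ?sqr_ge0.
Qed.

Let eR01 s i z : 0 <= eR s i z <= 1.
Proof. by rewrite expR_ge0//= expR_le1 oppr_le0 divr_ge0// mulr_ge0 ?sqr_ge0. Qed.

Let bthr d1 (T1 : measurableType d1) (N : nat) (e : I -> T1 -> R) :
  (forall i, bmeas (e i)) -> bmeas (fun t => \prod_i (thr N).[e i t]).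
Proof.
move=> be; apply: bmeas_prod => i; under eq_fun do rewrite horner_coef.
by apply: bmeas_sum => j; apply: bmeasM; [exact: bmeas_cst|exact: bmeasX].
Qed.

Lemma thr_sum_ge (s e : R) (N M : nat) : 0 <= e -> #|I|%:R * e <= 1 ->
  expR (- (N%:R * expR (- (s ^+ 2 * (2 * T0 / C + y0 ^+ 2 / 2))))) <= e ->
  (1 - expR (- (q * (T0 / (2 * C))))) * (eps - expR T0 * 2^-1 ^+ M) * (Ex Q bnd * (1 - #|I|%:R * e)) <=
  \sum_(n < M) Ex (prodP P Q) (fun z => lwt c v0 J S q n z.1 * \prod_i (thr N).[eL s n i z]).
Proof.
move=> e0 Ie he.
have k0 : 0 <= 1 - #|I|%:R * e by rewrite subr_ge0.
have b0 : 0 <= Ex Q bnd by apply: Ex_ge0 => t; rewrite prodr_ge0.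
have := blanket_upper_occ crw cvp M q0 T0p hP (lexx (2 * T0 / C)).
move=> /(ler_wpM2r (mulr_ge0 b0 k0)) h; apply: le_trans h _.
rewrite mulr_suml; apply: ler_sum => n _.
rewrite mulrA -[X in X * _](_ : Ex (prodP P Q) (fun z => (lwt c v0 J S q n z.1 *
   \prod_u (occ n u z.1 <= 2 * T0 / C)%R%:R) * bnd z.2) = _); last first.
  exact: (Ex_prod_mul (bocl n) bb).
have bA : bmeas (fun z : T * T' => lwt c v0 J S q n z.1 * \prod_u (occ n u z.1 <= 2 * T0 / C)%R%:R * bnd z.2).
  exact: (bmeasM (@bmeas_fst _ _ T T' _ (bocl n)) (@bmeas_snd _ _ T T' _ bb)).
have bB : bmeas (fun z : T * T' => lwt c v0 J S q n z.1 * \prod_i (thr N).[eL s n i z]).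
  apply: bmeasM; first exact/bmeas_fst/(bmeas_lwt crw cvp)/ltW.
  by apply: bthr => i; exact: beL.
rewrite mulrC -ExZ; last exact: bmeas_L1.
apply: Ex_le; [exact/L1Z/bmeas_L1|exact: bmeas_L1|move=> z].
have w0 : 0 <= lwt c v0 J S q n z.1 by apply: lwt_ge0 => //; exact: ltW.
rewrite mulrC -!mulrA (ler_wpM2l w0)//.
have p01 : 0 <= \prod_i (thr N).[eL s n i z].
  by rewrite prodr_ge0// => i _; exact: thr_ge0.
have prodb (b : V -> bool) : \prod_u (b u)%:R = ([forall u, b u])%:R :> R.
  have [/forallP h|/forallPn[u hu]] := boolP [forall u, b u].
    by rewrite big1// => u _; rewrite h.
  by rewrite (bigD1 u)//= (negbTE hu) mul0r.
rewrite (prodb (fun u => occ n u z.1 <= _)) /bnd (prodb (fun u => `|X u z.2| <= y0)).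
have [/forallP h1|_] := boolP [forall u, occ n u z.1 <= 2 * (T0 / C)]; last by rewrite !mul0r.
have [/forallP h2|_] := boolP [forall u, `|X u z.2| <= y0]; last by rewrite mul0r mulr0.
rewrite !mul1r.
have -> : #|I| = size (index_enum I) by rewrite -sum1_size -sum1_card; apply: eq_bigl.
apply: prod_ge1B => //; first by move=> i; rewrite thr_ge0//= thr_le1.
move=> i; apply: le_trans (thr_ge N (eL01 s n i z)); rewrite lerD2l lerN2.
apply: le_trans he; rewrite ler_expR lerN2 ler_wpM2l// /eL /gwt -expRD ler_expR.
rewrite -opprD lerN2 addr0.
have hx : X (val i) z.2 ^+ 2 <= y0 ^+ 2.
  rewrite -(real_normK (num_real (X (val i) z.2))) lerXn2r ?nnegrE//.
  exact: le_trans (normr_ge0 _) (h2 (val i)).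
have ho := h1 (val i); rewrite mulrA in ho.
rewrite -mulrA -mulrDr ler_wpM2l ?sqr_ge0// lerD// ler_wpM2r//.
Qed.

Lemma thr_limit_le (s r a b : R) (N : nat) : 0 <= r -> 0 <= a ->
  2 * b <= (r + Num.sqrt (2 * a)) ^+ 2 ->
  Ex (prodP (expP q0) Q) (fun z => \prod_i (thr N).[eR s i z]) <=
  q * a + Ex Q (fun t => (mx v0 X t <= r)%R%:R) + N%:R * expR (- (s ^+ 2 * b)).
Proof.
move=> r0 a0 hb.
have mmx : measurable_fun setT (mx v0 X).
  rewrite /mx; elim: (index_enum V) => [|i l IH]; first by under eq_fun do rewrite big_nil; exact: mX.
  by under eq_fun do rewrite big_cons; apply: measurable_maxr.
have b1 : bmeas (fun y : measurableTypeR R => (y < a)%R%:R : R).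
  by apply: bmeas_gt_ind => //; exact: measurable_id.
have b2 : bmeas (fun t => (mx v0 X t <= r)%R%:R : R).
  by rewrite b2R_indic; exact/bmeas_indic/measurable_le_set.
have b1' := @bmeas_fst _ _ _ T' _ b1.
have b2' := @bmeas_snd _ _ (measurableTypeR R) _ _ b2.
set rr := N%:R * _.
have e1 : Ex (prodP (expP q0) Q) (fun z => (z.1 < a)%R%:R) <= q * a.
  rewrite Ex_prodP//=; under Ex_ext do rewrite Ex_cst.
  rewrite b2R_indic Ex_indic; last by rewrite -set_itvNyo; exact: measurable_itv.
  rewrite expP_lt/= max_l// lerBlDr addrC -lerBlDr.
  exact: expR_ge1Dx.
have e2 : Ex (prodP (expP q0) Q) (fun z => (mx v0 X z.2 <= r)%R%:R) = Ex Q (fun t => (mx v0 X t <= r)%R%:R).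
  by rewrite Ex_prodP//= Ex_cst.
have e3 : Ex (prodP (expP q0) Q) (fun z => (z.1 < a)%R%:R + (mx v0 X z.2 <= r)%R%:R + rr) <=
   q * a + Ex Q (fun t => (mx v0 X t <= r)%R%:R) + rr.
  rewrite ExD; [|exact/bmeas_L1/bmeasD|exact: L1_cst].
  by rewrite ExD ?Ex_cst ?e2 ?lerD2r//; exact: bmeas_L1.
apply: le_trans e3; apply: Ex_le.
- by apply: bmeas_L1; apply: bthr => i; exact: beR.
- by apply: L1D; [exact/bmeas_L1/bmeasD|exact: L1_cst].
move=> z; have th01 i : 0 <= (thr N).[eR s i z] <= 1 by rewrite thr_ge0//= thr_le1.
have p1 : \prod_i (thr N).[eR s i z] <= 1 by rewrite prodr_ile1.
have rr0 : 0 <= rr by rewrite mulr_ge0 ?expR_ge0.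
have [za|za] := ltP z.1 a.
  by rewrite (le_trans p1)// -addrA lerDl addr_ge0.
have [zr|zr] := leP (mx v0 X z.2) r.
  by rewrite (le_trans p1)// add0r lerDl.
rewrite !add0r; have [i hi] := mx_attained v0 X z.2.
have iv : i != v0.
  by apply/eqP => ie; move: zr; rewrite hi ie X0 ltNge r0.
apply: le_trans (prod_le_factor th01 (mem_index_enum (Sub i iv : I))) _.
apply: le_trans (thr_le N (eR01 s _ z)) _.
rewrite ler_wpM2l// /eR /gwt SubK ler_expR lerN2 -mulrA ler_wpM2l ?sqr_ge0//.
rewrite ler_pdivlMr// mulrC (le_trans hb)// lerXn2r ?nnegrE//.
- by rewrite addr_ge0.
- by rewrite addr_ge0// -hi (le_trans r0)// ltW.
rewrite -hi lerD ?(ltW zr)// ler_wsqrtr// ler_wpM2l// le_max za//.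
Qed.

Lemma threshold_choice (b0 b e : R) : 0 < e -> 0 <= b0 -> b0 < b -> exists (s : R) (N : nat),
  [/\ 0 < s, expR (- (N%:R * expR (- (s ^+ 2 * b0)))) <= e & N%:R * expR (- (s ^+ 2 * b)) <= e].
Proof.
move=> e0 b00 bb0; pose D := (b - b0) / 2; have D0 : 0 < D by rewrite divr_gt0 ?subr_gt0.
pose K := 2 / (e * D); have K0 : 0 < K by rewrite divr_gt0// mulr_gt0.
have KD : K * D = 2 / e by rewrite /K; field; rewrite !gt_eqF.
pose N := (Num.truncn (expR (K * (b0 + D)))).+1.
have e2 : 0 < 2 / e by rewrite divr_gt0.
exists (Num.sqrt K), N; rewrite sqrtr_gt0 K0 sqr_sqrtr ?(ltW K0)//.
have /truncn_itv/andP[N1 N2] := expR_ge0 (K * (b0 + D)).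
have exp2 : 2 / e <= expR (2 / e) by rewrite (le_trans _ (expR_ge1Dx _))// lerDr.
have inv (x : R) : 0 < x -> expR (- x) <= x^-1.
  move=> x0; rewrite expRN lef_pV2 ?qualifE/= ?expR_gt0//.
  by rewrite (le_trans _ (expR_ge1Dx _))// lerDr.
split => //.
  have h : e^-1 <= N%:R * expR (- (K * b0)).
    apply: le_trans (_ : expR (K * (b0 + D)) * expR (- (K * b0)) <= _); last first.
      by rewrite ler_wpM2r ?expR_ge0// ltW.
    rewrite -expRD (_ : _ - _ = 2 / e) ?(le_trans _ exp2)//; last by rewrite -KD; ring.
    by rewrite ler_peMl ?invr_ge0 ?(ltW e0)// ler1n.
  have N0 : 0 < N%:R * expR (- (K * b0)) by apply: lt_le_trans h; rewrite invr_gt0.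
  apply: le_trans (inv _ N0) _.
  by rewrite -[leRHS]invrK lef_pV2 ?qualifE/= ?invr_gt0// (lt_le_trans _ h)// invr_gt0.
apply: le_trans (_ : expR (- (2 / e)) * 2 <= _); last first.
  by rewrite -ler_pdivlMr// (le_trans (inv _ e2))// invf_div.
have bD : b = b0 + D + D by rewrite /D; field.
have N3 : N%:R <= 1 + expR (K * (b0 + D)) by rewrite /N -natr1 addrC lerD2l.
have e1 : 1 <= expR (K * (b0 + D)).
  by rewrite -expR0 ler_expR mulr_ge0 ?(ltW K0)// addr_ge0 ?(ltW D0).
apply: le_trans (_ : (expR (K * (b0 + D)) * 2) * expR (- (K * b)) <= _).
  by rewrite ler_wpM2r ?expR_ge0// mulr2n mulrDr mulr1 (le_trans N3)// lerD2r.
rewrite mulrAC -expRD (_ : _ - _ = - (2 / e))//.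
by rewrite -KD bD; ring.
Qed.

Lemma blanket_gauss_compare (r a : R) : 0 <= r -> 0 <= a ->
  4 * T0 / C + y0 ^+ 2 < (r + Num.sqrt (2 * a)) ^+ 2 ->
  (1 - expR (- (q * (T0 / (2 * C))))) * eps * Ex Q bnd <=
  q * a + Ex Q (fun t => (mx v0 X t <= r)%R%:R).
Proof.
move=> r0 a0 hra.
pose b0 := 2 * T0 / C + y0 ^+ 2 / 2; pose b := (r + Num.sqrt (2 * a)) ^+ 2 / 2.
have b00 : 0 <= b0 by apply: addr_ge0; apply: divr_ge0 => //; rewrite ?sqr_ge0// mulr_ge0.
have b0b : b0 < b.
  rewrite /b0 /b (_ : 2 * T0 / C = 4 * T0 / C / 2); last by move: (C^-1) => x; field.
  by rewrite -mulrDl ltr_pM2r.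
set A := 1 - _; set B := Ex Q bnd.
have A01 : 0 <= A <= 1.
  rewrite subr_ge0 expR_le1 oppr_le0 mulr_ge0 ?(ltW q0) ?divr_ge0 ?mulr_ge0//=.
  by rewrite lerBlDr lerDl expR_ge0.
have B01 : 0 <= B <= 1.
  have bn01 t : 0 <= bnd t <= 1.
    rewrite /bnd prodr_ge0//= prodr_ile1// => u _; by rewrite ler0n lern1 leq_b1.
  rewrite Ex_ge0/=; last by move=> t; case/andP: (bn01 t).
  rewrite -[leRHS](Ex_cst Q); apply: Ex_le; [exact: bmeas_L1|exact: L1_cst|].
  by move=> t; case/andP: (bn01 t).
apply/ler_addgt0Pr => e' e'0; move: (e' : R) e'0 => {e'} e e0.
pose n := #|I|%:R : R; have n0 : 0 <= n by [].
pose k := eps * n + 1 + n; have en0 : 0 <= eps * n by rewrite mulr_ge0// ltW.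
have k0 : 0 < k by rewrite /k; lra.
pose e1 := Num.min (e / k) (n + 1)^-1.
have e10 : 0 < e1 by rewrite lt_min divr_gt0//= invr_gt0 ltr_wpDl.
have [s [N [s0 h1 h2]]] := threshold_choice e10 b00 b0b.
have ne1 : n * e1 <= 1.
  apply: le_trans (_ : n * (n + 1)^-1 <= _); first by rewrite ler_wpM2l// ge_min lexx orbT.
  by rewrite ler_pdivrMr ?ltr_wpDl// mul1r lerDl.
have lower := fun M => thr_sum_ge M (ltW e10) ne1 h1.
have hb : 2 * b <= (r + Num.sqrt (2 * a)) ^+ 2 by rewrite /b mulrC divfK.
have upper := thr_limit_le s N r0 a0 hb.
have : A * eps * (B * (1 - n * e1)) <= q * a + Ex Q (fun t => (mx v0 X t <= r)%R%:R) + N%:R * expR (- (s ^+ 2 * b)).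
  apply: le_trans upper.
  have cvL : A * (eps - expR T0 * 2^-1 ^+ M) * (B * (1 - n * e1)) @[M --> \oo] --> A * eps * (B * (1 - n * e1)).
    apply: cvgM; last exact: cvg_cst.
    apply: cvgM; first exact: cvg_cst.
    rewrite -[X in _ --> X]subr0; apply: cvgB; first exact: cvg_cst.
    rewrite -(mulr0 (expR T0)); apply: cvgM; first exact: cvg_cst.
    by apply: cvg_expr; rewrite ger0_norm// invf_lt1// ltr1n.
  have cvR := @threshold_limit s q q0 N s0.
  rewrite -(cvg_lim _ cvL)// -(cvg_lim _ cvR)//; apply: ler_lim.
  - by apply/cvg_ex; eexists; exact: cvL.
  - by apply/cvg_ex; eexists; exact: cvR.
  - by apply: nearW => M; exact: lower.
have ke : k * e1 <= e by rewrite mulrC -ler_pdivlMr// ge_min lexx.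
have /andP[A0 A1] := A01; have /andP[B0 B1] := B01.
have : A * (eps * B) * (n * e1) <= eps * (n * e1).
  rewrite ler_wpM2r ?mulr_ge0 ?(ltW e10)//.
  by rewrite mulrCA ler_piMr ?(ltW eps0)// mulr_ile1//.
have : 0 <= n * e1 by rewrite mulr_ge0// ltW.
move: ke h2; rewrite /k; lra.
Qed.
End Isomorphism.

Section Resistance.
Context {R : realType} (V : finType) (c : V -> V -> R).
Context d (T : measurableType d) (P : probability T R) (v0 : V).
Variables (J : nat -> T -> V) (S : nat -> T -> R).
Hypothesis crw : is_crw c v0 P J S.
Hypothesis net : network c.
Hypothesis cvp : forall x, 0 < cv c x.
Variable g : V -> V -> R.
Hypothesis g0 : forall y, g y v0 = 0.
Hypothesis gl : forall y x, lap c (g y) x = (x == y)%:R - (x == v0)%:R.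

Lemma green_diag_ge0 x : 0 <= g x x.
Proof.
have := green_psd net g0 gl (fun y => (y == x)%:R); rewrite /bil (bigD1 x)//= [X in _ + X]big1 ?addr0.
  rewrite (bigD1 x)//= [X in _ + X]big1 ?addr0 ?eqxx ?mul1r// => y /negbTE ->.
  by rewrite mulr0 mul0r.
by move=> y /negbTE yx; rewrite big1// => z _; rewrite yx !mul0r.
Qed.

Lemma total_cond_gt0 : 0 < total_cond c.
Proof. by rewrite /total_cond (bigD1 v0)//= ltr_pwDl// sumr_ge0// => v _; exact: ltW. Qed.

(* The local time at [x] is compared with the probability of never reaching [x]:
   [k] is the effective conductance from [v0] to a cemetery attached to [x]. *)
Lemma blanket_resistance (x : V) (T0 eps : R) : x != v0 -> 0 < T0 -> 0 < eps ->
  (eps%:E < P (blanket_event c J S T0))%E ->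
  eps * g x x * total_cond c <= 16 * T0.
Proof.
move=> xv T00 eps0 hP; have C0 := total_cond_gt0; set C := total_cond c in C0 *.
pose t0 := T0 / (2 * C); have t00 : 0 < t0 by rewrite divr_gt0// mulr_gt0.
pose lam := t0^-1; have lam0 : 0 < lam by rewrite invr_gt0.
pose q := (4 * t0)^-1; have q0 : 0 < q by rewrite invr_gt0 mulr_gt0.
have gx := green_diag_ge0 x.
have lg : 0 < 1 + lam * g x x by rewrite ltr_wpDr// mulr_ge0// ltW.
pose k := lam / (1 + lam * g x x); have k0 : 0 <= k by rewrite divr_ge0 ?ltW.
pose Lam y : R := lam * (y == x)%:R.
have L0 y : 0 <= Lam y by rewrite mulr_ge0// ltW.
have Lv : Lam v0 = 0 by rewrite /Lam eq_sym (negbTE xv) mulr0.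
pose f y : R := 1 * 1 + (- k) * g x y.
have fv : f v0 = 1 by rewrite /f g0 mulr0 addr0 mulr1.
have hf y : lap c f y + Lam y * f y = k * (y == v0)%:R.
  have l1 : lap c (fun=> 1) y = 0 by rewrite /lap big1// => z _; rewrite subrr mulr0.
  rewrite (lapD c (fun=> 1) (g x)) gl mul1r l1 add0r.
  rewrite /Lam; have [->|yx] := eqVneq y x; last by rewrite mulr0 mul0r addr0 sub0r mulrNN.
  rewrite (negbTE xv) /f /k /= subr0 !mulr1 mulr0; field.
  by rewrite gt_eqF.
have c1 := walk_laplace_cvg crw net cvp q0 k0 L0 Lv fv hf.
have c2 : (\sum_(n < M) Ex P (lwt c v0 J S q n)) @[M --> \oo] --> (1 : R).
  have := @walk_laplace_cvg _ _ _ _ _ _ _ _ _ crw net cvp q (fun=> 0) (fun=> 1) 0 q0.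
  rewrite addr0 divff ?gt_eqF// => h; have {}h := h (lexx _) (fun=> lexx _) erefl erefl.
  have e n : Ex P (lwt c v0 J S q n) =
      Ex P (fun t => lwt c v0 J S q n t * expR (- \sum_x 0 * occ c J S n x t)).
    apply: Ex_ext => t; rewrite [X in expR (- X)]big1 ?oppr0 ?expR0 ?mulr1// => y _.
    by rewrite mul0r.
  rewrite (funext (fun M => eq_bigr _ (fun (n : 'I_M) _ => e n))).
  apply: h => y; rewrite /lap big1 ?add0r ?mul0r// => z _.
  by rewrite subrr mulr0.
have bw n : bmeas (lwt c v0 J S q n) by exact/(bmeas_lwt crw cvp)/ltW.
have oE n t : \sum_y Lam y * occ c J S n y t = lam * occ c J S n x t.
  rewrite (bigD1 x)//= /Lam eqxx mulr1 big1 ?addr0// => y /negbTE ->.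
  by rewrite mulr0 mul0r.
have be n : bmeas (fun t => expR (- \sum_y Lam y * occ c J S n y t)).
  apply: bmeas_expN.
    by apply: measurable_sum => y; apply: measurable_funM => //; exact: (measurable_occ crw).
  by move=> t; rewrite oE mulr_ge0 ?(ltW lam0)// occ_ge0.
have low M : (expR (- (q * (2 * T0 / C))) * (eps - expR T0 * 2^-1 ^+ M) -
      Ex P (fun t => expR (- (q * occ c J S M v0 t)))) / 2 <=
   \sum_(n < M) Ex P (lwt c v0 J S q n) -
   \sum_(n < M) Ex P (fun t => lwt c v0 J S q n t * expR (- \sum_y Lam y * occ c J S n y t)).
  have := blanket_lower_occ crw cvp M q0 (ltW T00) hP xv.
  rewrite ler_pdivrMr// => h; apply: le_trans h _.
  rewrite -sumrB mulr_suml; apply: ler_sum => n _.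
  have LA := bmeas_L1 P (bw n); have LB := bmeas_L1 P (bmeasM (bw n) (be n)).
  rewrite -ExB// [_ * 2]mulrC -ExZ; last exact: L1B.
  apply: Ex_le; last 1 first.
  - move=> t; have w0 : 0 <= lwt c v0 J S q n t by apply: lwt_ge0 => //; exact: ltW.
    rewrite -[X in X - _]mulr1 -mulrBr mulrCA ler_wpM2l// oE.
    have [h|h] := leP (T0 / (2 * C)) (occ c J S n x t); last first.
      by rewrite mulr_ge0// subr_ge0 expR_le1 oppr_le0 mulr_ge0 ?(ltW lam0)// occ_ge0.
    have l1 : 1 <= lam * occ c J S n x t.
      by rewrite mulrC ler_pdivlMr// mul1r.
    have : expR (- (lam * occ c J S n x t)) <= 2^-1.
      rewrite expRN lef_pV2 ?qualifE/= ?expR_gt0//.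
      apply: le_trans (expR_ge1Dx _); lra.
    move=> *; change (true%:R : R) with (1 : R); lra.
  - apply/bmeas_L1/bmeasM; first exact: bw.
    rewrite b2R_indic; apply/bmeas_indic/measurable_ge_set.
    exact: (measurable_occ crw).
  - exact/L1Z/L1B.
have cL : (expR (- (q * (2 * T0 / C))) * (eps - expR T0 * 2^-1 ^+ M) -
      Ex P (fun t => expR (- (q * occ c J S M v0 t)))) / 2 @[M --> \oo] -->
   (expR (- (q * (2 * T0 / C))) * eps - 0) / 2.
  apply: cvgM; last exact: cvg_cst.
  apply: cvgB; last first.
    have [K hK] := expocc_q_decay crw net cvp q0.
    by apply: natinv_cvg0 hK => n; apply: Ex_ge0 => t; exact: expR_ge0.
  apply: cvgM; first exact: cvg_cst.
  rewrite -[X in _ --> X]subr0; apply: cvgB; first exact: cvg_cst.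
  rewrite -(mulr0 (expR T0)); apply: cvgM; first exact: cvg_cst.
  by apply: cvg_expr; rewrite ger0_norm// invf_lt1// ltr1n.
have cR : (\sum_(n < M) Ex P (lwt c v0 J S q n) -
   \sum_(n < M) Ex P (fun t => lwt c v0 J S q n t * expR (- \sum_y Lam y * occ c J S n y t))) @[M --> \oo]
   --> 1 - q / (q + k) by exact: cvgB.
have main : (expR (- (q * (2 * T0 / C))) * eps - 0) / 2 <= 1 - q / (q + k).
  rewrite -(cvg_lim _ cL)// -(cvg_lim _ cR)//; apply: ler_lim.
  - by apply/cvg_ex; eexists; exact: cL.
  - by apply/cvg_ex; eexists; exact: cR.
  - by apply: nearW => M; exact: low.
have q1 : q * (2 * T0 / C) = 1 by rewrite /q /t0; field; rewrite !gt_eqF.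
rewrite q1 subr0 in main.
have e4 : 4^-1 <= expR (-1) :> R.
  have h : 2^-1 <= expR (- 2^-1) :> R.
    by apply: le_trans (expR_ge1Dx _); lra.
  have -> : -1 = - 2^-1 + - 2^-1 :> R by field.
  by rewrite expRD; nra.
have kq : 1 - q / (q + k) <= k / q.
  have qk : 0 < q + k by rewrite ltr_pwDl.
  rewrite -[X in X - _](divff (lt0r_neq0 qk)) -mulrBl addrC addKr.
  by rewrite ler_wpM2l// lef_pV2 ?qualifE//= lerDl.
have kg : k * g x x <= 1.
  by rewrite /k mulrAC ler_pdivrMr// mul1r lerDr.
have qi : q^-1 = 2 * T0 / C by rewrite /q invrK /t0; field; rewrite gt_eqF.
have h1 : 4^-1 * eps / 2 <= k * (2 * T0 / C).
  rewrite -qi; apply: le_trans kq; apply: le_trans main.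
  by rewrite ler_pM2r// ler_wpM2r// ltW.
have h2 : 4^-1 * eps / 2 * g x x <= 2 * T0 / C.
  apply: le_trans (ler_wpM2r gx h1) _.
  have p : 0 <= 2 * T0 / C by apply: divr_ge0; [apply: mulr_ge0 => //|]; exact: ltW.
  by rewrite mulrAC -[leRHS]mul1r (ler_wpM2r p).
rewrite ler_pdivlMr// in h2; lra.
Qed.
End Resistance.

Section Final.
Context {R : realType} (V : finType) (c : V -> V -> R).
Hypothesis net : network c.

Lemma cv_gt0 (a b : V) : a != b -> forall x, 0 < cv c x.
Proof.
move=> ab x; have [csym cge _ conn] := net.
have [y yx] : exists y, y != x.
  by have [ax|ax] := eqVneq a x; [exists b; rewrite -ax eq_sym|exists a].
have /connectP[[|z p] /=] := conn x y; first by move=> _ e; rewrite e eqxx in yx.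
move=> /andP[cz _] _; rewrite /cv (bigD1 z)//= ltr_pwDl// sumr_ge0//.
Qed.

Context d (T : measurableType d) (Q : probability T R).
Variables (v0 : V) (eta : V -> T -> R) (g : V -> V -> R).
Hypothesis gff : is_GFF c v0 Q eta.
Hypothesis g0 : forall y, g y v0 = 0.
Hypothesis gl : forall y x, lap c (g y) x = (x == y)%:R - (x == v0)%:R.
Let m := Ex Q (mx v0 eta).
Let L1e := L1_gff net gff g0 gl.
Let cfe := gff_gauss_cf net gff g0 gl.
Let gs := green_sym net g0 gl.

Lemma mx_gff_ge0 t : 0 <= mx v0 eta t.
Proof. by have [_ e0 _ _] := gff; rewrite -(e0 t); exact: mx_ge. Qed.

Lemma expected_supE : expected_sup Q v0 eta = m%:E.
Proof. by rewrite /expected_sup -Ex_EFin//; exact: L1_mx. Qed.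

Lemma gauss_cf_opp : gauss_cf Q (fun x t => - eta x t) g.
Proof.
move=> a th; have := cfe (fun i => - a i) th.
have -> : bil g (fun i => - a i) (fun i => - a i) = bil g a a.
  by apply: eq_bigr => i _; apply: eq_bigr => j _; rewrite mulrNN.
move=> <-; apply: Ex_ext => t; congr (cos (_ + _)).
by apply: eq_bigr => i _; rewrite mulrN mulNr.
Qed.

Lemma Ex_mx_opp : Ex Q (mx v0 (fun x t => - eta x t)) = m.
Proof.
apply: Ex_mx_eq => //.
  by move=> x; have := L1Z (-1) (L1e x); under eq_fun do rewrite mulN1r.
by move=> a th; rewrite gauss_cf_opp cfe.
Qed.

Lemma gff_tail (X : V -> T -> R) (sg u : R) : (forall x, L1 Q (X x)) -> gauss_cf Q X g ->
  (forall x, Ex Q (fun t => `|X x t|) <= sg) -> Ex Q (mx v0 X) = m -> 0 < u ->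
  Ex Q (fun t => (u <= `|mx v0 X t - m|)%R%:R) <= 4 * sg / u.
Proof.
move=> LX cX hs mE u0.
have L : L1 Q (fun t => `|mx v0 X t - m|) by apply/L1_norm/L1B; [exact: L1_mx|exact: L1_cst].
rewrite b2R_indic Ex_indic; last exact: (measurable_ge_set u (L1_measurable L)).
apply: le_trans (Markov L _ u0) _ => //.
rewrite ler_pM2r ?invr_gt0// -mE.
exact: (concentration v0 cX gs LX hs).
Qed.


Lemma gff_bounded (sg u : R) : 0 < sg -> 0 < u -> (forall x, g x x <= sg ^+ 2) ->
  1 - 2 * (4 * sg / u) <= Ex Q (fun t => \prod_x (`|eta x t| <= m + u)%R%:R).
Proof.
move=> sg0 u0 hg; have hs := gff_absE net gff g0 gl sg0 hg.
have LN x : L1 Q (fun t => - eta x t) by have := L1Z (-1) (L1e x); under eq_fun do rewrite mulN1r.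
have t1 := gff_tail L1e cfe hs (erefl m) u0.
have t2 : Ex Q (fun t => (u <= `|mx v0 (fun x t => - eta x t) t - m|)%R%:R) <= 4 * sg / u.
  apply: gff_tail => //; [exact: gauss_cf_opp| |exact: Ex_mx_opp].
  by move=> x; under Ex_ext do rewrite normrN.
have bi X : (forall x, L1 Q (X x)) -> bmeas (fun t => (u <= `|mx v0 X t - m|)%R%:R : R).
  move=> LX; rewrite b2R_indic; apply: bmeas_indic.
  have L : L1 Q (fun t => `|mx v0 X t - m|) by apply/L1_norm/L1B; [exact: L1_mx|exact: L1_cst].
  exact: (measurable_ge_set u (L1_measurable L)).
have b1 := bi _ L1e; have b2 := bi _ LN.
pose F t : R := 1 - ((u <= `|mx v0 eta t - m|)%R%:R + (u <= `|mx v0 (fun x t => - eta x t) t - m|)%R%:R).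
have LF : L1 Q F by apply: L1B; [exact: L1_cst|exact/bmeas_L1/bmeasD].
apply: le_trans (_ : Ex Q F <= _).
  rewrite /F ExB; [|exact: L1_cst|exact/bmeas_L1/bmeasD].
  rewrite Ex_cst ExD; [|exact: bmeas_L1..].
  lra.
apply: Ex_le => //.
  apply/bmeas_L1/bmeas_prod => x; rewrite b2R_indic; apply/bmeas_indic/measurable_le_set.
  by apply: measurableT_comp => //; exact: L1_measurable.
move=> t; rewrite /F; set p := \prod_x _.
have p0 : 0 <= p by rewrite prodr_ge0.
have [h1|h1] := leP u `|mx v0 eta t - m|.
  by apply: le_trans p0; rewrite subr_le0 lerDl.
have [h2|h2] := leP u `|mx v0 (fun x t => - eta x t) t - m|.
  by apply: le_trans p0; rewrite subr_le0 lerDr.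
rewrite addr0 subr0 /p big1// => x _.
have -> // : `|eta x t| <= m + u.
have m1 := mx_ge v0 eta t x; have m2 := mx_ge v0 (fun x t => - eta x t) t x.
move: h1 h2; rewrite !ltr_norml => /andP[_ h1] /andP[_ h2].
by rewrite ler_norml; apply/andP; split; lra.
Qed.

Lemma gff_low (sg u : R) : 0 < sg -> 0 < u -> (forall x, g x x <= sg ^+ 2) ->
  Ex Q (fun t => (mx v0 eta t <= m - u)%R%:R) <= 4 * sg / u.
Proof.
move=> sg0 u0 hg; have hs := gff_absE net gff g0 gl sg0 hg.
apply: le_trans (gff_tail L1e cfe hs (erefl m) u0).
have LM := L1_mx v0 L1e.
have L : L1 Q (fun t => `|mx v0 eta t - m|) by apply/L1_norm/L1B; [exact: L1_mx|exact: L1_cst].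
apply: Ex_le.
- apply: bmeas_L1; rewrite b2R_indic; apply: bmeas_indic.
  exact: (measurable_le_set (m - u) (L1_measurable LM)).
- apply: bmeas_L1; rewrite b2R_indic; apply/bmeas_indic.
  exact: (measurable_ge_set u (L1_measurable L)).
move=> t; have [h|_] := leP (mx v0 eta t) (m - u) => //.
by rewrite ler_normr; have -> : (u <= mx v0 eta t - m) || (u <= - (mx v0 eta t - m)) by apply/orP; right; lra.
Qed.

Context d' (T' : measurableType d') (P : probability T' R).
Variables (J : nat -> T' -> V) (S : nat -> T' -> R).
Hypothesis crw : is_crw c v0 P J S.
Hypothesis cvp : forall x, 0 < cv c x.

Lemma small_resistance_blanket (eps : R) : 0 < eps < 1 -> 0 < m ->
  (forall x, g x x <= (eps / 100 * eps * m / 64) ^+ 2) ->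
  ~ (eps%:E < P (blanket_event c J S (2 * total_cond c * (eps / 100 * m ^+ 2))))%E.
Proof.
move=> /andP[eps0 eps1] m0; set u := eps / 100; set sg := u * eps * m / 64 => hg.
set C := total_cond c; set T0 := 2 * C * _ => hP.
have u0 : 0 < u by rewrite divr_gt0.
have C0 : 0 < C := total_cond_gt0 v0 cvp.
have sg0 : 0 < sg by rewrite divr_gt0// !mulr_gt0.
have um0 : 0 < u * m by rewrite mulr_gt0.
have t00 : 0 < u * m ^+ 2 by rewrite mulr_gt0// exprn_gt0.
pose q := (u * m ^+ 2)^-1; have q0 : 0 < q by rewrite invr_gt0.
have T00 : 0 <= T0 by rewrite /T0 mulr_ge0 ?(ltW t00)// mulr_ge0// ltW.
pose h := 13 / 2 * (u * m); have h0 : 0 < h by rewrite mulr_gt0// divr_gt0.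
pose a := h ^+ 2 / 2; have a0 : 0 <= a by rewrite divr_ge0// sqr_ge0.
have sqa : Num.sqrt (2 * a) = h.
  by rewrite /a mulrC divfK// sqrtr_sqr ger0_norm// ltW.
have r0 : 0 <= m - u * m by rewrite subr_ge0 ler_piMl ?(ltW m0)// /u; lra.
have mE x : measurable_fun setT (eta x) by case: gff.
have e0 t : eta v0 t = 0 by case: gff.
have T0C : T0 / (2 * C) = u * m ^+ 2 by rewrite /T0; field; rewrite gt_eqF.
have T4 : 4 * T0 / C = 8 * (u * m ^+ 2) by rewrite /T0; field; rewrite gt_eqF.
have hra : 4 * T0 / C + (m + u * m) ^+ 2 < (m - u * m + Num.sqrt (2 * a)) ^+ 2.
  rewrite sqa T4 /h -subr_gt0.
  rewrite (_ : _ - _ = u * m ^+ 2 + (117 / 4) * (u * m) ^+ 2); last by field.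
  by rewrite addr_gt0// mulr_gt0 ?exprn_gt0// divr_gt0.
have cmp := blanket_gauss_compare crw net cvp g0 gl mE cfe e0 q0 T00 eps0 hP r0 a0 hra.
have ratio : 4 * sg / (u * m) = eps / 16 by rewrite /sg; field; rewrite !gt_eqF.
have B := gff_bounded sg0 um0 hg; have Lw := gff_low sg0 um0 hg.
rewrite ratio in B Lw; rewrite T0C mulVf ?gt_eqF// in cmp.
have qa : q * a = 169 / 8 * u by rewrite /q /a /h; field; rewrite !gt_eqF.
rewrite qa in cmp.
have e2 : expR (-1) <= 2^-1 :> R.
  by rewrite expRN lef_pV2 ?qualifE/= ?expR_gt0//; apply: le_trans (expR_ge1Dx _); lra.
have : 2^-1 * eps * (1 - 2 * (eps / 16)) <= 169 / 8 * u + eps / 16.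
  apply: le_trans (lerD (lexx _) Lw); apply: le_trans cmp.
  have p1 : 2^-1 * eps <= (1 - expR (-1)) * eps by rewrite ler_wpM2r ?(ltW eps0)//; lra.
  have p2 : 0 <= 1 - 2 * (eps / 16) by lra.
  apply: ler_pM => //; rewrite mulr_ge0// ltW//.
rewrite /u; nra.
Qed.

End Final.

Theorem mainTheorem9 (R : realType) (eps : R) :
  0 < eps < 1 ->
  exists2 ceps : R, 0 < ceps &
  forall (V : finType) (c : V -> V -> R), network c ->
  forall (d : measure_display) (Omega : measurableType d)
         (P : probability Omega R)
         (J : V -> nat -> Omega -> V) (S : V -> nat -> Omega -> R),
  (forall w : V, is_crw c w P (J w) (S w)) ->
  forall (d' : measure_display) (Omega' : measurableType d')
         (Q : probability Omega' R) (v0 : V) (eta : V -> Omega' -> R),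
  is_GFF c v0 Q eta ->
  ((ceps * total_cond c)%:E
     * (expected_sup Q v0 eta * expected_sup Q v0 eta)
   <= blanket_time c eps P J S)%E.
Proof.
move=> eps01; have /andP[eps0 eps1] := eps01.
pose K : R := 10 ^+ 9; have K0 : 0 < K by rewrite exprn_gt0.
exists (eps ^+ 5 / K); first by rewrite divr_gt0// exprn_gt0.
move=> V c net d Omega P J S crw d' Omega' Q v0 eta gff.
have [g hg] := green_exists net v0.
have g0 y : g y v0 = 0 by case: (hg y).
have gl y x : lap c (g y) x = (x == y)%:R - (x == v0)%:R by case: (hg y).
rewrite (expected_supE net gff g0 gl); set m := Ex Q _.
have m0 : 0 <= m by apply: Ex_ge0 => t; exact: mx_gff_ge0 gff t.
rewrite -!EFinM; apply: le_trans (_ : (blanket_time_from c eps P (J v0) (S v0) <= _)%E); last first.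
  by apply: ereal_sup_ubound; exists v0.
apply: le_ereal_inf_tmp => _ [s [s0 hs] <-]; rewrite lee_fin.
have [->|mN0] := eqVneq m 0; first by rewrite mulr0 mulr0.
have {mN0}m0 : 0 < m by rewrite lt_neqAle eq_sym mN0.
rewrite leNgt; apply/negP => sT; set T0 := _ * (m * m) in sT.
have [x xv] : exists x, x != v0.
  apply: contrapT => h; move: m0; rewrite ltNge => /negP; apply.
  have -> : m = 0; last by [].
  have [_ e0 _ _] := gff; rewrite -(Ex_cst Q 0); apply: Ex_ext => t.
  have [y ->] := mx_attained v0 eta t.
  have -> : y = v0 by apply/eqP/negPn/negP => yv; apply: h; exists y.
  exact: e0.
have cvp := cv_gt0 net xv.
have C0 := total_cond_gt0 v0 cvp; set C := total_cond c in C0 T0 sT.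
have T00 : 0 < T0 by rewrite !mulr_gt0 ?invr_gt0 ?exprn_gt0.
have e5 : eps ^+ 5 <= eps by rewrite -[leRHS]expr1 ler_wiXn2l// ltW.
have [hx|] := pselect (forall x, g x x <= (eps / 100 * eps * m / 64) ^+ 2).
  apply: (small_resistance_blanket net gff g0 gl (crw v0) cvp eps01 m0 hx).
  apply: hs; apply: le_trans (ltW sT) _; rewrite -/m -/C /T0 -expr2.
  rewrite (_ : eps ^+ 5 / K * C * m ^+ 2 = C * m ^+ 2 * (eps ^+ 5 / K)); last by ring.
  rewrite (_ : 2 * C * _ = C * m ^+ 2 * (eps / 50)); last by field.
  rewrite ler_pM2l; last by rewrite mulr_gt0 ?exprn_gt0.
  rewrite /K; lra.
move=> /existsNP[z /negP]; rewrite -ltNge => gz.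
have zv : z != v0.
  by apply: contraTneq gz => ->; rewrite g0 -leNgt sqr_ge0.
have := blanket_resistance (crw v0) net cvp g0 gl zv T00 eps0 (hs _ (ltW sT)).
apply/negP; rewrite -ltNge -/C.
apply: lt_trans (_ : eps * (eps / 100 * eps * m / 64) ^+ 2 * C < _); last first.
  by rewrite ltr_pM2r// ltr_pM2l.
rewrite /T0 -expr2 (_ : eps * _ * C = eps ^+ 5 * C * m ^+ 2 / (6400 ^+ 2)); last by field.
rewrite (_ : 16 * _ = eps ^+ 5 * C * m ^+ 2 * (16 / K)); last by field; rewrite gt_eqF.
rewrite ltr_pM2l; last by rewrite !mulr_gt0 ?exprn_gt0.
rewrite /K; lra.
Qed.
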